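(* Let $\rho>0$ and $\chi$ be real numbers such that either $\chi\ge 0$, or $\chi<0$ and $\rho/|\chi|$ is a positive integer; assume moreover that $\chi+\rho>0$. Let $(T_n^{\chi,\rho})_{n\ge1}$ be the sequence of linear preferential attachment trees with weights $w_k=\chi k+\rho$, and let $(T_n^{\mathcal P})_{n\ge1}$ be the sequence of random split trees with $b=\infty$ and split vector $\mathcal P\sim \mathrm{GEM}\bigl(\tfrac{\chi}{\chi+\rho},\tfrac{\rho}{\chi+\rho}\bigr)$. (1) For every $n\ge 1$, $T_n^{\chi,\rho}$ and $T_n^{\mathcal P}$ have the same distribution, provided the trees are regarded as unordered rooted trees. (2) Moreover, if in both constructions the children of each node are (re)labelled $1,2,3,\dots$ in order of appearance, then the sequences $(T_n^{\chi,\rho})_{n=1}^\infty$ and $(T_n^{\mathcal P})_{n=1}^\infty$ of random trees have the same distribution. (3) The assertions (1) and (2) hold also if instead $\mathcal P\sim\mathrm{PD}\bigl(\tfrac{\chi}{\chi+\rho},\tfrac{\rho}{\chi+\rho}\bigr)$.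
   Context: **Linear preferential attachment tree.** $T_1^{\chi,\rho}$ is a single root. Given $T_n^{\chi,\rho}$, the tree $T_{n+1}^{\chi,\rho}$ is obtained by adding one new node as a child of an existing node, where the parent is chosen to be $v$ with probability proportional to $w_{d(v)}$; here $d(v)$ is the current outdegree (number of children) of $v$ and $w_k=\chi k+\rho$. (If $\chi<0$ and $\rho=m|\chi|$, then $w_m=0$, so no node ever gets more than $m$ children and $w_k$, $k>m$, are irrelevant.) The children of each node may be labelled $1,2,3,\dots$ in the order they appear, making $T_n^{\chi,\rho}$ a subtree of the infinite Ulam–Harris tree $\mathcal T_\infty$, in which every node has children labelled $1,2,3,\dots$ (nodes of $\mathcal T_\infty$ are the finite strings of positive integers, the root being the empty string). **Random split tree** with $b=\infty$. Let $\mathcal P=(P_i)_{i=1}^\infty$ be a random vector with $P_i\ge0$ and $\sum_i P_i=1$ (the split vector). Give each node $v$ of $\mathcal T_\infty$ an independent copy $\mathcal P^{(v)}=(P^{(v)}_i)_i$ of $\mathcal P$, chosen once and kept fixed. Each node holds at most one ball and is full if it holds one; initially all nodes are empty. Balls arrive one by one at the root and move instantaneously: (i) a ball arriving at an empty node stays there, making it full; (ii) a ball arriving at a full node $v$ continues to a child of $v$, child $i$ being chosen with probability $P_i^{(v)}$; given all vectors $\mathcal P^{(v)}$, all these choices are independent. $T_n^{\mathcal P}$ is the subtree of $\mathcal T_\infty$ consisting of the nodes that contain the first $n$ balls; all $T_n^{\mathcal P}$, $n\ge1$, are constructed from the same stream of balls. Relabelling in order of appearance means that the children of each node are relabelled $1,2,\dots$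 according to the order in which they become full. **Distributions.** $B(\alpha,\beta)$ for $\alpha,\beta>0$ is the Beta distribution on $[0,1]$ with density proportional to $x^{\alpha-1}(1-x)^{\beta-1}$; $B(0,\beta)=\delta_0$ for $\beta>0$ and $B(\alpha,0)=\delta_1$ for $\alpha>0$. For $-\infty<\alpha<1$ and $\theta+\alpha\ge 0$, where if $\alpha<0$ also $\theta/|\alpha|$ is an integer, $\mathrm{GEM}(\alpha,\theta)$ is the distribution of the random probability vector $(P_i)_{i=1}^\infty$ given by $P_i=Z_i\prod_{j=1}^{i-1}(1-Z_j)$, where the $Z_j$ are independent with $Z_j\sim B(1-\alpha,\theta+j\alpha)$. (If $\alpha<0$ and $\theta=m|\alpha|$, then $Z_m=1$ and $P_i=0$ for $i>m$; $Z_j$ is needed only for $j\le m$.) $\mathrm{PD}(\alpha,\theta)$ is the distribution of the vector obtained by reordering $(P_i)_{i=1}^\infty\sim\mathrm{GEM}(\alpha,\theta)$ in decreasing order. *)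

(* Defs.v *)
From HB Require Import structures.
From mathcomp Require Import all_boot all_order all_algebra finmap.
From mathcomp Require Import all_classical all_reals all_analysis.

Set Implicit Arguments.
Unset Strict Implicit.
Unset Printing Implicit Defensive.

Import Order.TTheory GRing.Theory Num.Theory.
Import numFieldNormedType.Exports.

Local Open Scope classical_set_scope.
Local Open Scope ring_scope.

(* Labels are shifted by one throughout: the natural number i stands for the
   child label i + 1, and a sequence indexed by nat has its first term at 0. *)
Definition node := seq nat.
Definition root : node := [::].
Definition tree := {fset node}.

Definition is_child (u v : node) : bool :=
  prefix u v && (size v == (size u).+1).

(* A rooted tree is a set of nodes containing the root and closed under taking
   parents; an isomorphism need not respect the labels, nor the birth order. *)
Definition tree_iso (t t' : tree) : Prop :=
  exists f : node -> node,
    [/\ {in t &, injective f}, f @` t = t' :> {fset node},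
        f root = root & {in t &, forall u v, is_child (f u) (f v) = is_child u v}]%fset.

(** Linear preferential attachment *)

Definition outdeg (t : tree) (v : node) : nat :=
  count (is_child v) (enum_fset t).

(* The new child of v receives the first label unused among its siblings, so
   that labels follow the order of appearance. *)
Definition attach (t : tree) (v : node) : tree := (rcons v (outdeg t v) |` t)%fset.

(* pa_tree u n is T_n when u k is the parent chosen in T_k, k >= 1; T_0 is
   empty and u 0 is not used. *)
Fixpoint pa_tree (u : nat -> node) (n : nat) : tree :=
  if n is k.+1 then
    if k == 0%N then [fset root]%fset else attach (pa_tree u k) (u k)
  else fset0.

Definition pa_weight (R : realType) (chi rho : R) (t : tree) (v : node) : R :=
  chi * (outdeg t v)%:R + rho.

Definition pa_prob (R : realType) (chi rho : R) (t : tree) (v : node) : R :=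
  if v \in t then
    pa_weight chi rho t v / \sum_(w <- enum_fset t) pa_weight chi rho t w
  else 0.

(* Conditionally on the past U 1, ..., U (n - 1), which determines T_n, the
   parent U n chosen in T_n is v with probability pa_prob T_n v. *)
Definition pa_process (R : realType) (chi rho : R) d (T : measurableType d)
    (P : probability T R) (U : nat -> T -> node) : Prop :=
  (forall n v, measurable (U n @^-1` [set v])) /\
  (forall n (u : nat -> node), (0 < n)%N ->
    P [set x | forall k, (0 < k <= n)%N -> U k x = u k] =
    (P [set x | forall k, (0 < k < n)%N -> U k x = u k]
      * (pa_prob chi rho (pa_tree u n) (u n))%:E)%E).

(** Split trees *)

(* The node where a ball currently at v stops, when s lists the full nodes and
   c w is the child chosen by the ball if it leaves w.  A ball at the root
   leaves at most size s nodes, whence the fuel used below. *)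
Fixpoint landing (c : node -> nat) (s : seq node) (fuel : nat) (v : node) : node :=
  if fuel is k.+1 then
    if v \in s then landing c s k (rcons v (c v)) else v
  else v.

Lemma landing_notin (c : node -> nat) (s : seq node) :
  landing c s (size s) root \notin s.
Proof.
suff H : forall (l : seq node) k v, (forall w, w \in l -> (size w < size v)%N) ->
    uniq l -> {subset l <= s} -> (size s <= size l + k)%N ->
    landing c s k v \notin s by exact: (H [::]).
move=> l k; elim: k l => [|k IHk] l v lv ul ls sl /=.
  apply/negP => vs; have /uniq_leq_size/(_ _) : uniq (v :: l).
    by rewrite /= ul andbT; apply/negP => /lv; rewrite ltnn.
  move=> /(_ s); suff ss : {subset v :: l <= s}.
    by move=> /(_ ss) /=; rewrite ltnNge -[size l]addn0 sl.
  by move=> w; rewrite inE => /orP[/eqP->|/ls].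
case: ifPn => // vs; apply: (IHk (v :: l)).
- move=> w; rewrite size_rcons inE ltnS => /orP[/eqP->//|/lv/ltnW//].
- by rewrite /= ul andbT; apply/negP => /lv; rewrite ltnn.
- by move=> w; rewrite inE => /orP[/eqP->|/ls].
- by rewrite /= addSn -addnS.
Qed.

(* The nodes filled by the first n balls, in the order in which they are
   filled; c k v is the child chosen by ball k at v. *)
Fixpoint split_nodes (c : nat -> node -> nat) (n : nat) : seq node :=
  if n is k.+1 then
    let s := split_nodes c k in rcons s (landing (c k) s (size s) root)
  else [::].

Definition split_tree (c : nat -> node -> nat) (n : nat) : tree :=
  [fset v in split_nodes c n]%fset.

(* The i-th label of v is replaced by the rank of the i-th non-root ancestor
   (or v itself) among its siblings, listed in the order of s. *)
Definition relabel (s : seq node) (v : node) : node :=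
  [seq index (take i.+1 v) [seq w <- s | is_child (take i v) w]
     | i <- iota 0 (size v)].

Definition relabelled_split_tree (c : nat -> node -> nat) (n : nat) : tree :=
  let s := split_nodes c n in [fset relabel s v | v in s]%fset.

(** Laws and independence *)

(* The product sigma-algebra on I -> S when S carries the sigma-algebra G. *)
Definition prod_sigma (I S : Type) (G : set (set S)) : set (set (I -> S)) :=
  <<s [set E | exists i, exists2 B, G B & E = [set x | B (x i)]] >>.

Definition real_seq_sigma (R : realType) : set (set (nat -> R)) :=
  @prod_sigma nat R (@measurable _ R).

(* There are countably many trees: each T_n is a discrete random element. *)
Definition tree_seq_sigma : set (set (nat -> tree)) :=
  @prod_sigma nat tree [set: set tree].

Definition same_law (S : Type) (G : set (set S)) (R : realType)
    d (T : measurableType d) (P : probability T R) (X : T -> S)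
    d' (T' : measurableType d') (P' : probability T' R) (X' : T' -> S) : Prop :=
  forall E, G E -> P (X @^-1` E) = P' (X' @^-1` E).

(* Equality in law of the isomorphism classes. *)
Definition same_unordered_law (R : realType)
    d (T : measurableType d) (P : probability T R) (X : T -> tree)
    d' (T' : measurableType d') (P' : probability T' R) (X' : T' -> tree) : Prop :=
  same_law [set E : set tree | forall t t', tree_iso t t' -> (E t <-> E t')]
    P X P' X'.

Definition mutually_independent (I : choiceType) (S : Type) (G : set (set S))
    (R : realType) d (T : measurableType d) (P : probability T R)
    (X : I -> T -> S) : Prop :=
  forall (F : {fset I}) (E : I -> set S), (forall i, G (E i)) ->
    P [set x | forall i, i \in F -> E i (X i x)] =
    (\prod_(i <- enum_fset F) P (X i @^-1` E i))%E.

(** Beta, GEM and Poisson-Dirichlet distributions *)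

Definition beta_density (R : realType) (a b x : R) : R :=
  x `^ (a - 1) * (1 - x) `^ (b - 1).

(* Rintegral is used in the quotient; both integrals are finite for a, b > 0. *)
Definition beta_law (R : realType) (a b : R) (E : set R) : \bar R :=
  if a == 0 then dirac (0 : R) E
  else if b == 0 then dirac (1 : R) E
  else (Rintegral lebesgue_measure (E `&` `[0, 1]) (beta_density a b) /
        Rintegral lebesgue_measure `[0, 1] (beta_density a b))%:E.

Definition stick_breaking (R : realType) (z : nat -> R) (i : nat) : R :=
  z i * \prod_(j < i) (1 - z j).

(* Z j is Z_(j + 1).  When alpha < 0 and theta = m |alpha|, the condition
   0 <= theta + (j + 1) alpha means j + 1 <= m; then Z_m = 1 almost surely, and
   the variables of higher index, left unspecified, play no role. *)
Definition is_GEM (R : realType) (alpha theta : R) d (T : measurableType d)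
    (P : probability T R) (X : nat -> {RV P >-> R}) : Prop :=
  exists d' (T' : measurableType d') (P' : probability T' R)
         (Z : nat -> {RV P' >-> R}),
    [/\ mutually_independent (@measurable _ R) P' (fun j => Z j : T' -> R),
        (forall j, 0 <= theta + j.+1%:R * alpha ->
           forall B, measurable B ->
           distribution P' (Z j) B = beta_law (1 - alpha) (theta + j.+1%:R * alpha) B)
      & same_law (@real_seq_sigma R) P (fun x i => X i x)
          P' (fun x => stick_breaking (fun j => Z j x))].

Definition decreasing_rearrangement (R : realType) (x y : nat -> R) : Prop :=
  nonincreasing_seq y /\
  exists2 s : nat -> nat, bijective s & forall i, y i = x (s i).

Definition is_PD (R : realType) (alpha theta : R) d (T : measurableType d)
    (P : probability T R) (X : nat -> {RV P >-> R}) : Prop :=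
  exists d' (T' : measurableType d') (P' : probability T' R)
         (G Y : nat -> {RV P' >-> R}),
    [/\ is_GEM alpha theta G,
        \forall x \ae P', decreasing_rearrangement (fun i => G i x) (fun i => Y i x)
      & same_law (@real_seq_sigma R) P (fun x i => X i x) P' (fun x i => Y i x)].

(** The random environment of split trees *)

Definition env_sigma (R : realType) d (T : measurableType d) (P : probability T R)
    (V : node -> nat -> {RV P >-> R}) : set (set T) :=
  <<s [set A | exists v i, exists2 B : set R, measurable B & A = V v i @^-1` B] >>.

(* V v is the split vector of v, and C k v the child that ball k chooses if it
   leaves v.  The last condition says that, given all split vectors, the C k v
   are independent and C k v = i has conditional probability V v i. *)
Definition split_process (R : realType) d (T : measurableType d)
    (P : probability T R) (law : (nat -> {RV P >-> R}) -> Prop)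
    (V : node -> nat -> {RV P >-> R}) (C : nat -> node -> {RV P >-> nat}) : Prop :=
  [/\ forall v, law (V v),
      mutually_independent (@real_seq_sigma R) P (fun v x i => V v i x)
    & forall (F : {fset nat * node}) (i : nat * node -> nat) (A : set T),
        env_sigma V A ->
        P (A `&` [set x | forall kv, kv \in F -> C kv.1 kv.2 x = i kv]) =
        (\int[P]_(x in A) (\prod_(kv <- enum_fset F) V kv.2 (i kv) x)%:E)%E].

(* Main.v *)
Require Import Defs.
From HB Require Import structures.
From mathcomp Require Import all_boot all_order all_algebra finmap.
From mathcomp Require Import ring lra.
From mathcomp Require Import all_classical all_reals all_analysis measurable_realfun.

Set Implicit Arguments.
Unset Strict Implicit.
Unset Printing Implicit Defensive.

Import Order.TTheory GRing.Theory Num.Theory.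
Import numFieldNormedType.Exports.

Local Open Scope classical_set_scope.
Local Open Scope ring_scope.

(** A split tree whose vectors are GEM(alpha, theta), looked at in order of
    appearance, is a tree of nested Chinese restaurant processes: if N_c is the
    number of balls that visit the child c of v, then the pattern of choices made
    at v has probability
      prod_(i < k) (theta + i alpha) prod_c (1 - alpha)_(N_c - 1) / (theta)_(sum N_c),
    k being the number of children.  Here theta = 1 - alpha, so the product over
    all nodes telescopes to prod_v prod_(i < d(v)) (theta + i alpha) over
    (theta)_(n - 1), which is the probability of the history of the preferential
    attachment tree.

    The probability at v is the expectation of the sum, over the injections i of
    the children into the labels, of prod_c P_(i c)^(N_c).  This sum is symmetric
    in the P_i, hence the same for GEM and PD.  For GEM it is computed by removing
    the first stick Z_1: both sides satisfy the same recursion, from theta to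
    theta + alpha, and the error is controlled by E prod_(j < L) (1 - Z_j), which
    tends to 0.  Only lower bounds for the probabilities of the histories are
    needed, because both families of probabilities sum to 1; thus finite sums over
    labels below some L suffice throughout. *)

(** * Integration and independence *)

(** The vectors are attached to fixed positions of the infinite tree, while the position at which a
    node of the history appears is random. A history is therefore decomposed according to the labels
    of all its nodes. For one fixed labelling, injective on siblings, the required choices are
    independent given the vectors, and the expectation factors because distinct nodes sit at
    distinct positions. Distinct labellings exclude each other, so their probabilities add up. Since
    the position of a node depends on the labels of its ancestors, the sum is carried out from the
    last parent back to the root; the bound obtained at a node is the same at every position, which
    lets it be pulled out of the remaining sum.

    Inequalities are what makes PD accessible. Its coordinates have no simple joint law, but the
    rearrangement carries a finite set of GEM labels into a finite set of PD labels, although one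
    that varies with the sample point.

    For [alpha < 0] the parameter of a stick may reach 0; that stick is 1, the quotients in the
    formulas become 0 / 0, and the later parameters are negative. The case distinctions on the sign
    of [theta l] come from there. *)

Section transfer.
Import HBNNSimple.

Section approximation.
Context d (T : measurableType d) dS (S : measurableType dS) (R : realType).
Variables (mu : {measure set T -> \bar R}) (X : T -> S) (g : T -> \bar R).
Hypotheses (mX : measurable_fun setT X) (mg : measurable_fun setT g)
  (g0 : forall x, (0 <= g x)%E).

(** The approximating sums involve [X] and [g] only through the integrals of [g] over preimages
    under [X], so two integrals with the same such data have the same approximations. *)
Lemma ge0_integral_comp_approx (f : S -> \bar R) (mf : measurable_fun setT f) :
  (forall s, 0 <= f s)%E ->
  (\int[mu]_x (f (X x) * g x) =
   limn (fun n => let a := nnsfun_approx measurableT mf n in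
     \sum_(r \in range a) (r%:E * \int[mu]_(x in X @^-1` (a @^-1` [set r])) g x)))%E.
Proof.
move=> f0; set a := nnsfun_approx measurableT mf.
have mpre (B : set S) : measurable B -> measurable (X @^-1` B).
  by move=> mB; rewrite -[X in measurable X]setTI; exact: mX.
have nda x : nondecreasing_seq (fun n => (a n x)%:E).
  by move=> m n mn; rewrite lee_fin; exact/lefP/nd_nnsfun_approx.
have a0 n s : (0 <= (a n s)%:E)%E by rewrite lee_fin fun_ge0.
transitivity (\int[mu]_x limn (fun n => (a n (X x))%:E * g x))%E.
  apply: eq_integral => x _; apply/esym/cvg_lim => //.
  rewrite muleC; under eq_fun do rewrite muleC.
  have := @cvg_nnsfun_approx _ _ _ _ measurableT _ mf (fun s _ => f0 s) (X x) Logic.I.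
  set u := (EFin \o _); move=> cu.
  have [g1|g1] := boolP (g x \is a fin_num); first exact: cvgeZl.
  have gy : g x = +oo%E by move: g1; rewrite ge0_fin_numE// ltey negbK => /eqP.
  (* Multiplication by [+oo] is not continuous at 0: the products are 0 throughout if [f (X x) = 0],
     and otherwise [+oo] as soon as an approximation is positive. *)
  rewrite gy; have [fx0|fx0] := eqVneq (f (X x)) 0%E.
    have u0 n : u n = 0%E.
      apply/eqP; rewrite eq_le a0 andbT -fx0.
      rewrite -(cvg_unique _ (ereal_nondecreasing_cvgn (nda (X x))) cu)//.
      by apply: ereal_sup_ubound; exists n.
    rewrite fx0 mule0 (_ : (fun n => _) = cst 0%E); first exact: cvg_cst.
    by apply/funext => n; have := u0 n; rewrite /u /= => ->; rewrite mule0.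
  have fp : (0 < f (X x))%E by rewrite lt_neqAle eq_sym fx0 f0.
  rewrite gt0_mulye//.
  have [n un] : exists n, (0 < u n)%E.
    apply: contrapT => /forallNP H.
    have u0 n : u n = 0%E.
      by apply/eqP; rewrite eq_le a0 andbT leNgt; apply/negP.
    have : u @ \oo --> 0%E.
      by rewrite (_ : u = cst 0%E); [exact: cvg_cst|exact/funext].
    by move/(cvg_lim (@ereal_hausdorff R)); rewrite (cvg_lim _ cu)// => fx; rewrite fx eqxx in fx0.
  apply: cvg_near_cst; near=> m; rewrite gt0_mulye//.
  apply: (lt_le_trans un); apply: (nda (X x)); near: m; exact: nbhs_infty_ge.
rewrite monotone_convergence//; last 3 first.
- move=> n; apply: emeasurable_funM => //.
  by apply/measurable_EFinP; apply: measurableT_comp.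
- by move=> n x _; rewrite mule_ge0// lee_fin.
- by move=> x _ m n mn; rewrite lee_wpmul2r//; exact: nda.
congr (limn _); apply/funext => n /=.
transitivity (\int[mu]_x (\sum_(r \in range (a n))
   (r%:E * (g \_ (X @^-1` (a n @^-1` [set r]))) x)))%E.
  apply: eq_integral => x _.
  rewrite [in LHS](fimfunE (a n) (X x)) -fsumEFin//.
  rewrite !fsbig_finite//= ge0_sume_distrl; last first.
    move=> r _; rewrite lee_fin.
    rewrite indicE; case: (boolP (_ \in _)) => [|_]; last by rewrite mulr0.
    by rewrite inE /= => <-; rewrite mulr1.
  apply: eq_bigr => r _; rewrite patchE indicE EFinM -muleA; congr (_ * _)%E.
  by rewrite (_ : (X x \in _) = (x \in X @^-1` (a n @^-1` [set r])))//;
    case: ifP => _; rewrite ?mul1e ?mul0e.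
have pos r x : (0 <= r%:E * (g \_ (X @^-1` (a n @^-1` [set r]))) x)%E.
  rewrite patchE; case: ifPn; last by rewrite mule0.
  by rewrite inE /= => <-; rewrite mule_ge0// lee_fin.
have mgr r : measurable_fun setT (g \_ (X @^-1` (a n @^-1` [set r]))).
  have mr : measurable (X @^-1` (a n @^-1` [set r])).
    by apply: mpre; exact: measurable_funPTI.
  by apply/(measurable_restrictT g mr); exact: measurable_funTS.
rewrite ge0_integral_fsum//; last by move=> r; exact: measurable_funeM.
apply: eq_fsbigr => r; rewrite inE /= => -[s _ <-].
rewrite ge0_integralZl//; first by rewrite -integral_mkcond.
by move=> x _; rewrite patchE; case: ifP.
Unshelve. all: by end_near.
Qed.
End approximation.

(** The last hypothesis says that the measures with densities [g] and [h] have the same image under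
    [X] and [Y]. The weights let one statement cover equality in law ([g = h = 1]), laws given by a
    density ([Y = id]) and the separation of an independent variable ([h] constant). *)
Lemma ge0_integral_transfer d1 (T1 : measurableType d1) d2 (T2 : measurableType d2)
    dS (S : measurableType dS) (R : realType)
    (mu : {measure set T1 -> \bar R}) (nu : {measure set T2 -> \bar R})
    (X : T1 -> S) (Y : T2 -> S) (g : T1 -> \bar R) (h : T2 -> \bar R)
    (f : S -> \bar R) :
  measurable_fun setT X -> measurable_fun setT Y ->
  measurable_fun setT g -> measurable_fun setT h ->
  (forall x, 0 <= g x)%E -> (forall y, 0 <= h y)%E ->
  measurable_fun setT f -> (forall s, 0 <= f s)%E ->
  (forall B, measurable B ->
    \int[mu]_(x in X @^-1` B) g x = \int[nu]_(y in Y @^-1` B) h y)%E ->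
  (\int[mu]_x (f (X x) * g x) = \int[nu]_y (f (Y y) * h y))%E.
Proof.
move=> mX mY mg mh g0 h0 mf f0 gh.
rewrite (ge0_integral_comp_approx mu mX mg g0 mf f0).
rewrite (ge0_integral_comp_approx nu mY mh h0 mf f0).
by congr (limn _); apply/funext => n; apply: eq_fsbigr => r _; rewrite gh.
Qed.

End transfer.

Lemma mutually_independent_comp (I : choiceType) (S : Type) (G : set (set S))
    dS' (S' : measurableType dS') (R : realType) d (T : measurableType d)
    (P : probability T R) (X : I -> T -> S) (h : I -> S -> S') :
  (forall i B, measurable B -> G (h i @^-1` B)) ->
  mutually_independent G P X ->
  mutually_independent (@measurable _ S') P (fun i x => h i (X i x)).
Proof. by move=> hG indX F E mE; apply: (indX F (fun i => h i @^-1` E i)) => i; exact: hG. Qed.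

Section independence.
Context (I : choiceType) (R : realType) d (T : measurableType d).
Variables (P : probability T R) (W : I -> T -> R).
Hypotheses (indW : mutually_independent (@measurable _ R) P W)
  (mW : forall i, measurable_fun setT (W i)) (W0 : forall i x, 0 <= W i x).

Let mcond (s : seq I) (E : I -> set R) : (forall i, measurable (E i)) ->
  measurable [set x | forall i, i \in s -> E i (W i x)].
Proof.
move=> mE; rewrite (_ : [set x | _] = \bigcap_(i in [set` s]) (W i @^-1` E i)).
  by apply: fin_bigcap_measurable => // i _; rewrite -[X in measurable X]setTI; exact: mW.
by [].
Qed.

Let mprod (s : seq I) : measurable_fun setT (fun x => \prod_(i <- s) (W i x)%:E)%E.
Proof.
rewrite (_ : (fun x => _) = (fun x => (\prod_(i <- s) W i x)%:E)).
  by apply/measurable_EFinP; exact: measurable_prod.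
by apply/funext => x; rewrite prodEFin.
Qed.

(** Variables of [s2] enter through events, those of [s1] through integrals; with [s1] empty this is
    the definition of independence. A variable can pass from the events to the integrals because, by
    induction for arbitrary events, weighting by the other variables multiplies its law by a
    constant. *)
Let independent_integral_prod_in (s1 s2 : seq I) (E : I -> set R) :
  (forall i, measurable (E i)) -> uniq (s1 ++ s2) ->
  (\int[P]_(x in [set x | forall i, i \in s2 -> E i (W i x)])
     \prod_(i <- s1) (W i x)%:E =
   \prod_(i <- s1) \int[P]_x (W i x)%:E * \prod_(i <- s2) P (W i @^-1` E i))%E.
Proof.
elim: s1 s2 E => [|i s1 IH] s2 E mE /=.
  move=> us2; under eq_integral do rewrite big_nil.
  rewrite big_nil mul1e integral_cst ?mul1e; last exact: mcond.
  have := indW [fset j in s2]%fset mE => /=.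
  rewrite (_ : [set x | _] = [set x | forall i, i \in s2 -> E i (W i x)]).
    move=> ->; apply: perm_big; apply: uniq_perm; rewrite ?fset_uniq// => j.
    by rewrite inE.
  by apply/seteqP; split=> x /= H j => [js|]; [apply: H; rewrite inE|rewrite inE; exact: H].
move=> /andP[]; rewrite mem_cat negb_or => /andP[is1 is2] us.
pose c := (\prod_(j <- s1) \int[P]_x (W j x)%:E * \prod_(j <- s2) P (W j @^-1` E j))%E.
have c0 : (0 <= c)%E.
  apply: mule_ge0; apply: prode_ge0 => j _ //.
  by apply: integral_ge0 => x _; rewrite lee_fin.
pose A := [set x | forall i, i \in s2 -> E i (W i x)].
have mA : measurable A by exact: mcond.
pose g := ((fun x => \prod_(j <- s1) (W j x)%:E) \_ A)%E.
(* The absolute value makes the transferred function nonnegative on all of [R], not only on the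
   values of [W i]. *)
transitivity (\int[P]_x (`|W i x|%:E * g x))%E.
  rewrite integral_mkcond; apply: eq_integral => x _.
  by rewrite /g !patchE ger0_norm//; case: ifP => _; rewrite ?mule0// big_cons.
rewrite (@ge0_integral_transfer _ T _ T _ R R P P (W i) (W i) g (cst c) (fun r => `|r|%:E))//; first last.
- move=> B mB; rewrite integral_cst; last by rewrite -[X in measurable X]setTI; exact: mW.
  have mE' j : measurable (if j == i then B else E j) by case: ifP.
  have us' : uniq (s1 ++ i :: s2).
    by rewrite -cat1s uniq_catCA /= mem_cat negb_or is1 is2.
  have := IH (i :: s2) _ mE' us'.
  rewrite big_cons eqxx (_ : [set x | _] = A `&` W i @^-1` B); last first.
    apply/seteqP; split => x /=.
      move=> H; split; last by have := H i (mem_head _ _); rewrite eqxx.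
      move=> j js; have := H j; rewrite inE js orbT => /(_ isT).
      by rewrite (negbTE (memPn is2 _ js)).
    move=> [Ax Bx] j; rewrite inE => /predU1P[->|js]; first by rewrite eqxx.
    by rewrite (negbTE (memPn is2 _ js)); exact: Ax.
  rewrite [X in (_ * (_ * X))%E](_ : _ = \prod_(j <- s2) P (W j @^-1` E j))%E; last first.
    rewrite [LHS]big_seq [RHS]big_seq; apply: eq_bigr => j js.
    by rewrite (negbTE (memPn is2 _ js)).
  rewrite muleCA [RHS]muleC -/c => <-.
  by rewrite setIC integral_mkcondr.
- by apply/measurable_EFinP; exact: measurable_realfun.normr_measurable.
- by move=> x; rewrite /g patchE; case: ifP => // _; rewrite prodEFin lee_fin prodr_ge0.
- by apply/(measurable_restrictT _ mA); exact: measurable_funTS.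
under eq_integral do rewrite ger0_norm//.
rewrite ge0_integralZr//; first by rewrite big_cons -muleA.
- exact/measurable_EFinP.
- by move=> x _; rewrite lee_fin.
Qed.

Lemma independent_integral_prod (s : seq I) : uniq s ->
  (\int[P]_x \prod_(i <- s) (W i x)%:E = \prod_(i <- s) \int[P]_x (W i x)%:E)%E.
Proof.
move=> us; have := @independent_integral_prod_in s [::] (fun=> setT) (fun=> measurableT).
rewrite cats0 => /(_ us); rewrite big_nil mule1 => <-; congr (integral _ _ _).
by apply/seteqP; split.
Qed.

End independence.

(** * Laws of discrete random elements *)

(** For a countable codomain this is measurability with respect to the discrete sigma-algebra,
    stated without putting a measurable structure on nodes, trees and sequences of nodes. *)
Definition atomwise_measurable (Y : Type) d (T : measurableType d) (X : T -> Y) :=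
  forall y, measurable (X @^-1` [set y]).

Section discrete.
Context d (T : measurableType d).

Lemma atomwise_measurable_preimage (Y : countType) (X : T -> Y) (E : set Y) :
  atomwise_measurable X -> measurable (X @^-1` E).
Proof.
move=> mX; rewrite (_ : X @^-1` E =
    \bigcup_n X @^-1` (E `&` [set y : Y | choice.pickle y = n])).
  apply: bigcupT_measurable => n.
  have [[y [Ey yn]]|H] := pselect (exists y, E y /\ choice.pickle y = n).
    rewrite (_ : _ `&` _ = [set y]); first exact: mX.
    apply/seteqP; split=> z /= => [[_ zn]|->//].
    by apply: (pcan_inj choice.pickleK); rewrite zn.
  rewrite (_ : _ `&` _ = set0) ?preimage_set0//.
  by apply/seteqP; split=> z //= [Ez zn]; apply: H; exists z.
by apply/seteqP; split=> x /= => [Ex|[n _ []//]]; exists (choice.pickle (X x)).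
Qed.

Lemma atomwise_measurable_comp (Y Z : countType) (X : T -> Y) (f : Y -> Z) :
  atomwise_measurable X -> atomwise_measurable (fun x => f (X x)).
Proof. by move=> mX z; exact: (@atomwise_measurable_preimage _ X (f @^-1` [set z])). Qed.

Lemma atomwise_measurable_bind (Y Z : countType) (X : T -> Y) (F : Y -> T -> Z) :
  atomwise_measurable X -> (forall y, atomwise_measurable (F y)) ->
  atomwise_measurable (fun x => F (X x) x).
Proof.
move=> mX mF z.
rewrite (_ : _ @^-1` _ = \bigcup_n
    if @choice.unpickle Y n is Some y then X @^-1` [set y] `&` F y @^-1` [set z] else set0).
  apply: bigcupT_measurable => n; case: choice.unpickle => // y.
  by apply: measurableI; [exact: mX|exact: mF].
apply/seteqP; split=> x /= => [<-|[n _]].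
  by exists (choice.pickle (X x)); rewrite ?choice.pickleK.
by case: choice.unpickle => // y /= [->].
Qed.

End discrete.

Section laws.
Context (R : realType) d (T : measurableType d) (P : probability T R)
  d' (T' : measurableType d') (P' : probability T' R).

Let le_law (Y : countType) d1 (T1 : measurableType d1) (P1 : probability T1 R)
    d2 (T2 : measurableType d2) (P2 : probability T2 R) (X : T1 -> Y) (X' : T2 -> Y) (E : set Y) :
  atomwise_measurable X -> atomwise_measurable X' ->
  (forall y, P1 (X @^-1` [set y]) <= P2 (X' @^-1` [set y]))%E ->
  (P1 (X @^-1` E) <= P2 (X' @^-1` E))%E.
Proof.
move=> mX mX' le.
have bigc U (Z : U -> Y) : Z @^-1` E = \bigcup_n Z @^-1` (E `&` [set y : Y | choice.pickle y = n]).
  by apply/seteqP; split=> x /= => [Ex|[n _ []//]]; exists (choice.pickle (Z x)).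
have triv U (Z : U -> Y) : trivIset setT (fun n => Z @^-1` (E `&` [set y : Y | choice.pickle y = n])).
  apply/trivIsetP => i j _ _ ij; apply/seteqP; split => x //= [[_ ei] [_ ej]].
  by move: ij; rewrite -ei -ej eqxx.
rewrite (bigc _ X) (bigc _ X') !measure_semi_bigcup//; try by
  try apply: bigcupT_measurable => n; try move=> n; exact: atomwise_measurable_preimage.
apply: lee_nneseries => // n _.
have [[y [Ey yn]]|H] := pselect (exists y, E y /\ choice.pickle y = n).
  rewrite (_ : _ `&` _ = [set y]); first exact: le.
  apply/seteqP; split=> z /= => [[_ zn]|->//].
  by apply: (pcan_inj choice.pickleK); rewrite zn.
rewrite (_ : _ `&` _ = set0) ?preimage_set0 ?measure0//.
by apply/seteqP; split=> z //= [Ez zn]; apply: H; exists z.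
Qed.

(* Both laws have total mass 1, so an inequality between atoms is an equality. *)
Lemma same_law_of_le_atoms (Y : countType) (X : T -> Y) (X' : T' -> Y) :
  atomwise_measurable X -> atomwise_measurable X' ->
  (forall y, P (X @^-1` [set y]) <= P' (X' @^-1` [set y]))%E ->
  same_law setT P X P' X'.
Proof.
move=> mX mX' le E _; apply/eqP; rewrite eq_le le_law//=.
have := le_law (~` E) mX mX' le.
have mE := atomwise_measurable_preimage E mX.
have mE' := atomwise_measurable_preimage E mX'.
rewrite -!preimage_setC.
rewrite (probability_setC _ mE) (probability_setC _ mE').
by rewrite leeD2lE ?leeN2.
Qed.

(** Dynkin's theorem: the events determined by finitely many initial coordinates are stable under
    intersection and generate the product sigma-algebra. *)
Lemma same_law_prod_sigma (S : countType) (X : T -> nat -> S) (X' : T' -> nat -> S) :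
  (forall i, atomwise_measurable (X^~ i)) -> (forall i, atomwise_measurable (X'^~ i)) ->
  (forall n, same_law setT P (fun x => mkseq (X x) n) P' (fun x => mkseq (X' x) n)) ->
  same_law (@prod_sigma nat S setT) P X P' X'.
Proof.
move=> mX mX' XX' E GE.
have mseq d1 (T1 : measurableType d1) (Z : T1 -> nat -> S) :
    (forall i, atomwise_measurable (Z^~ i)) -> forall n, atomwise_measurable (fun x => mkseq (Z x) n).
  move=> mZ; elim=> [|n IH].
    move=> y; have [->|y0] := eqVneq y [::].
      by rewrite (_ : _ @^-1` _ = setT)//; apply/seteqP; split.
    rewrite (_ : _ @^-1` _ = set0)//; apply/seteqP; split => // x /= e.
    by rewrite -e eqxx in y0.
  have -> : (fun x => mkseq (Z x) n.+1) = (fun x => rcons (mkseq (Z x) n) (Z x n)).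
    by apply/funext => x; rewrite /mkseq -addn1 iotaD map_cat cats1.
  by apply: (@atomwise_measurable_bind _ _ _ _ _ (fun s x => rcons s (Z x n)) IH) => s;
    apply: (atomwise_measurable_comp (rcons s)); exact: mZ.
pose D : set (set (nat -> S)) :=
  [set A | exists n (B : set (seq S)), A = [set t | B (mkseq t n)]].
pose H : set (set (nat -> S)) := [set A | [/\ measurable (X @^-1` A),
   measurable (X' @^-1` A) & P (X @^-1` A) = P' (X' @^-1` A)]].
suff DH : <<s D >> `<=` H.
  suff GD : @prod_sigma nat S setT `<=` <<s D >> by case: (DH E (GD _ GE)).

  apply: (@smallest_sub _ (sigma_algebra setT) _ <<s D>> (smallest_sigma_algebra _ _)).
  move=> A GA; apply: sub_gen_smallest; move: GA.
  (* Quantifying over the default value avoids choosing an element of [S]; on [mkseq t i.+1] the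
     default is never reached. *)
  move=> [i [B _ ->]]; exists i.+1, [set s | forall x, B (nth x s i)].
  apply/seteqP; split => t /=; first by move=> Bt x; rewrite nth_mkseq.
  by move=> /(_ (t i)); rewrite nth_mkseq.
apply: lambda_system_subset.
- have nest n m (B B' : set (seq S)) : (n <= m)%N ->
      D ([set t | B (mkseq t n)] `&` [set t | B' (mkseq t m)]).
    move=> nm; exists m, [set s | B (take n s) /\ B' s].
    by apply/seteqP; split => t /=; rewrite -map_take take_iota (minn_idPl nm).
  move=> _ _ [n [B ->]] [m [B' ->]].
  by case: (leqP n m) => [/nest//|/ltnW/nest]; rewrite setIC; exact.
- apply/dynkin_lambda_system; split.
  + by split; rewrite ?preimage_setT// !probability_setT.
  + move=> A [mA mA' AA']; have EA : X @^-1` (~` A) = ~` (X @^-1` A) by [].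
    have EA' : X' @^-1` (~` A) = ~` (X' @^-1` A) by [].
    rewrite /H /= EA EA'; split; try exact: measurableC.
    by rewrite (probability_setC _ mA) (probability_setC _ mA') AA'.
  + move=> F tF HF.
    have mF : forall n, measurable (X @^-1` F n) by move=> n; case: (HF n).
    have mF' : forall n, measurable (X' @^-1` F n) by move=> n; case: (HF n).
    split; rewrite preimage_bigcup; try exact: bigcupT_measurable.
    rewrite [in RHS]preimage_bigcup !measure_semi_bigcup//.
    * by apply: eq_eseriesr => n _; case: (HF n).
    * by move/trivIsetP: tF => tF; apply/trivIsetP => i j _ _ ij; rewrite -preimage_setI tF.
    * exact: bigcupT_measurable.
    * by move/trivIsetP: tF => tF; apply/trivIsetP => i j _ _ ij; rewrite -preimage_setI tF.
    * exact: bigcupT_measurable.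
- move=> _ [n [B ->]]; split.
  + exact: (@atomwise_measurable_preimage _ _ _ _ B (mseq _ _ _ mX n)).
  + exact: (@atomwise_measurable_preimage _ _ _ _ B (mseq _ _ _ mX' n)).
  + exact: (XX' n B).
- by [].
Qed.

End laws.

(** * Beta distributions *)

Section beta_integral.
Context (R : realType).
Local Notation leb := (@lebesgue_measure R).
Implicit Types a b : R.

(** The density may blow up at 0 and 1, so integration by parts is done on compact subintervals. The
    shift by 3 puts the left end strictly below 1/2, which keeps every interval nondegenerate. *)
Let itv_n (n : nat) : set R := `[n.+3%:R^-1, 1 - n.+3%:R^-1].

Let itv_n_in n x : itv_n n x -> 0 < x < 1.
Proof.
rewrite /itv_n /= in_itv /= => /andP[h1 h2].
have n0 : 0 < n.+3%:R^-1 :> R by rewrite invr_gt0.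
by rewrite (lt_le_trans n0 h1) (le_lt_trans h2)// ltrBlDr ltrDl.
Qed.

Let bigcup_itv_n : \bigcup_n itv_n n = `]0, 1[%classic.
Proof.
apply/seteqP; split => x /=; first by move=> [n _ /itv_n_in]; rewrite in_itv.
rewrite in_itv /= => /andP[x0 x1].
pose m := Num.min x (1 - x); have m0 : 0 < m by rewrite lt_min x0 subr_gt0.
pose n := Num.truncn m^-1; exists n => //; rewrite /itv_n /= in_itv /=.
have : n.+3%:R^-1 <= m.
  rewrite -[leRHS]invrK lef_pV2 ?posrE ?invr_gt0//.
  by apply: (le_trans (ltW (truncnS_gt _))); rewrite ler_nat ltnS leqW ?leqW.
rewrite le_min => /andP[-> h] /=; rewrite lerBrDr.
by rewrite -lerBrDl.
Qed.

Let nd_itv_n : nondecreasing_seq itv_n.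
Proof.
move=> m n mn; apply/subsetPset => x; rewrite /itv_n /= !in_itv /= => /andP[h1 h2].
have h : n.+3%:R^-1 <= m.+3%:R^-1 :> R by rewrite lef_pV2 ?posrE// ler_nat.
by rewrite (le_trans h h1) (le_trans h2)// lerD2l lerN2.
Qed.

Definition beta_integral a b : \bar R :=
  (\int[leb]_(x in `[0%R, 1%R]) (beta_density a b x)%:E)%E.

Lemma measurable_beta_density a b : measurable_fun setT (beta_density a b).
Proof.
apply: measurable_funM; first exact: measurable_powR.
apply: (measurableT_comp (measurable_powR _)).
by apply: measurable_funB => //; exact: measurable_cst.
Qed.

Lemma beta_density_ge0 a b x : 0 <= beta_density a b x.
Proof. by rewrite mulr_ge0 ?powR_ge0. Qed.

Lemma beta_integral_ge0 a b : (0 <= beta_integral a b)%E.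
Proof. by apply: integral_ge0 => x _; rewrite lee_fin beta_density_ge0. Qed.

Let powR_le1 (x c : R) : 0 <= x <= 1 -> 0 <= c -> x `^ c <= 1.
Proof.
move=> /andP[x0 x1] c0; rewrite [leRHS](_ : 1 = 1 `^ c); last by rewrite powR1.
by apply: ge0_ler_powR; rewrite ?nnegrE.
Qed.

Let beta_integral_cvg a b :
  (\int[leb]_(x in itv_n n) (beta_density a b x)%:E @[n --> \oo] --> beta_integral a b)%E.
Proof.
have mE : measurable_fun setT (fun x => (beta_density a b x)%:E).
  by apply/measurable_EFinP; exact: measurable_beta_density.
rewrite /beta_integral.
rewrite -(integral_itv_obnd_cbnd (f := fun x => (beta_density a b x)%:E)); last first.
  exact: measurable_funTS.
rewrite -(integral_itv_bndo_bndc (f := fun x => (beta_density a b x)%:E)); last first.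
  exact: measurable_funTS.
rewrite -bigcup_itv_n; apply: ge0_nondecreasing_set_cvg_integral => //.
- by move=> n; exact: measurable_itv.
- by move=> n; exact: measurable_funTS.
- by move=> n x _; rewrite lee_fin beta_density_ge0.
Qed.

Let cont_powR a x : 0 < x -> {for x, continuous (fun y : R => y `^ a)}.
Proof.
move=> x0; apply: differentiable_continuous; apply/derivable1_diffP.
by apply: derivable_powR; rewrite in_itv /= x0.
Qed.

Let cont_density a b n : {within itv_n n, continuous (beta_density a b)}.
Proof.
apply: continuous_in_subspaceT => x; rewrite inE => /itv_n_in /andP[x0 x1].
apply: cvgM; first exact: cont_powR.
apply: (@continuous_comp _ _ _ (fun y : R => 1 - y) (fun y : R => y `^ (b - 1))).
  by apply: cvgB; [exact: cvg_cst|exact: cvg_id].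
by apply: cont_powR; rewrite subr_gt0.
Qed.

Let integrable_density a b n : leb.-integrable (itv_n n) (fun x => (beta_density a b x)%:E).
Proof. by apply: continuous_compact_integrable; [exact: segment_compact|exact: cont_density]. Qed.

Let beta_parts_n a b n : 0 < a -> 0 <= b ->
  (a%:E * \int[leb]_(x in itv_n n) (beta_density a (b + 1) x)%:E =
   ((1 - n.+3%:R^-1) `^ a * n.+3%:R^-1 `^ b
     - n.+3%:R^-1 `^ a * (1 - n.+3%:R^-1) `^ b)%:E
   + b%:E * \int[leb]_(x in itv_n n) (beta_density (a + 1) b x)%:E)%E.
Proof.
move=> a0 b0; set s : R := n.+3%:R^-1.
have s0 : 0 < s by rewrite invr_gt0.
have s1 : s < 1 by rewrite invf_lt1// ltr1n.
have st : s < 1 - s.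
  rewrite ltrBrDr -mulr2n -mulr_natr -ltr_pdivlMr// mul1r ltf_pV2 ?posrE//.
  by rewrite ltr_nat.
have mE c d := integrable_density c d n.
have inI x : x \in `]s, 1 - s[ -> 0 < x < 1.
  rewrite in_itv /= => /andP[h1 h2].
  by rewrite (lt_trans s0 h1) (lt_trans h2)// ltrBlDr ltrDl.
have dF (x : R) : 0 < x -> is_derive x (1 : R) (fun y : R => y `^ a) (a * x `^ (a - 1)).
  by move=> x0; exact: is_derive1_powR.
have dG (x : R) : x < 1 -> is_derive x (1 : R) (fun y : R => (1 - y) `^ b) (- b * (1 - x) `^ (b - 1)).
  move=> x1; have x1' : 0 < 1 - x by rewrite subr_gt0.
  have hd : is_derive x (1 : R) (fun y : R => 1 - y) (0 - 1) by exact: is_deriveB.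
  have h := @is_derive1_comp R (fun y => y `^ b) (fun y => 1 - y) x _ _
     (is_derive1_powR b x1') hd.
  by apply: is_derive_eq h _; rewrite sub0r mulrN1 mulNr.
have cF (x : R) : 0 < x -> {for x, continuous (fun y : R => y `^ a)} by exact: cont_powR.
have cG (x : R) : x < 1 -> {for x, continuous (fun y : R => (1 - y) `^ b)}.
  move=> x1; apply: (@continuous_comp _ _ _ (fun y : R => 1 - y) (fun y : R => y `^ b)).
    by apply: cvgB; [exact: cvg_cst|exact: cvg_id].
  by apply: cont_powR; rewrite subr_gt0.
have := @integration_by_parts R (fun x => x `^ a) (fun x => (1 - x) `^ b)
  (fun x => a * x `^ (a - 1)) (fun x => - b * (1 - x) `^ (b - 1)) s (1 - s) st.
rewrite -/(itv_n n) => parts.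
have {}parts : (\int[leb]_(x in itv_n n) (x `^ a * (- b * (1 - x) `^ (b - 1)))%:E =
    ((1 - s) `^ a * (1 - (1 - s)) `^ b - s `^ a * (1 - s) `^ b)%:E -
     \int[leb]_(x in itv_n n) (a * x `^ (a - 1) * (1 - x) `^ b)%:E)%E.
  apply: parts.
  - apply: continuous_in_subspaceT => x; rewrite inE => /itv_n_in /andP[x0 x1].
    by apply: cvgM; [exact: cvg_cst|exact: cont_powR].
  - split; first by move=> x /inI/andP[x0 _]; have [] := dF x x0.
    + exact: cvg_at_right_filter (cF _ s0).
    + by apply: cvg_at_left_filter; apply: cF; rewrite subr_gt0.
  - by move=> x /inI/andP[x0 _]; rewrite derive1E; have [_ ->] := dF x x0.
  - apply: continuous_in_subspaceT => x; rewrite inE => /itv_n_in /andP[x0 x1].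
    apply: cvgM; first exact: cvg_cst.
    apply: (@continuous_comp _ _ _ (fun y : R => 1 - y) (fun y : R => y `^ (b - 1))).
      by apply: cvgB; [exact: cvg_cst|exact: cvg_id].
    by apply: cont_powR; rewrite subr_gt0.
  - split; first by move=> x /inI/andP[_ x1]; have [] := dG x x1.
    + exact: cvg_at_right_filter (cG _ s1).
    + by apply: cvg_at_left_filter; apply: cG; rewrite ltrBlDr ltrDl.
  - by move=> x /inI/andP[_ x1]; rewrite derive1E; have [_ ->] := dG x x1.
move: parts; rewrite opprB addrCA subrr addr0.
rewrite (_ : \int[leb]_(x in itv_n n) _ =
    (- b)%:E * \int[leb]_(x in itv_n n) (beta_density (a + 1) b x)%:E)%E; last first.
  rewrite -integralZl//; last exact: measurable_itv.
  by apply: eq_integral => x _; rewrite /beta_density addrK -EFinM mulrCA.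
rewrite (_ : \int[leb]_(x in itv_n n) (a * _ * _)%:E =
    a%:E * \int[leb]_(x in itv_n n) (beta_density a (b + 1) x)%:E)%E; last first.
  rewrite -integralZl//; last exact: measurable_itv.
  by apply: eq_integral => x _; rewrite /beta_density addrK -EFinM mulrA.
have If c d : (\int[leb]_(x in itv_n n) (beta_density c d x)%:E)%E \is a fin_num.
  by apply: integrable_fin_num => //; exact: measurable_itv.
rewrite -(fineK (If a (b + 1))) -(fineK (If (a + 1) b)) -!EFinM -EFinB -EFinD => -[e].
by congr EFin; rewrite mulNr in e; lra.
Qed.

Lemma beta_integral_parts a b : 0 < a -> 0 < b ->
  (a%:E * beta_integral a (b + 1) = b%:E * beta_integral (a + 1) b)%E.
Proof.
move=> a0 b0.
have c1 : (a%:E * \int[leb]_(x in itv_n n) (beta_density a (b + 1) x)%:E @[n --> \oo]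
    --> a%:E * beta_integral a (b + 1))%E.
  by apply: cvgeZl => //; exact: beta_integral_cvg.
pose r (n : nat) : R := (1 - n.+3%:R^-1) `^ a * n.+3%:R^-1 `^ b
     - n.+3%:R^-1 `^ a * (1 - n.+3%:R^-1) `^ b.
have r0 : r @ \oo --> (0 : R).
  pose u (n : nat) : R := n.+3%:R^-1.
  have u0 : u @ \oo --> (0 : R) by have := @cvg_harmonic R; rewrite -(cvg_shiftn 2); under eq_fun do rewrite /harmonic /= addn2.
  have up c : 0 < c -> u n `^ c @[n --> \oo] --> (0 : R).
    move=> c0; have /cvg_at_rightP := powR_cvg0 c0; apply; split => // n.
    by rewrite invr_gt0.
  have u1 c : (1 - u n) `^ c @[n --> \oo] --> (1 : R).
    rewrite -[X in _ --> X](_ : 1 `^ c = 1); last by rewrite powR1.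
    apply: (@cvg_comp _ _ _ (fun n => 1 - u n) (fun y : R => y `^ c) _ (nbhs (1 : R))); last exact: cont_powR.
    suff : (1 - u n) @[n --> \oo] --> (1 : R) by [].
    by rewrite -[X in _ --> X]subr0; apply: cvgB => //; exact: cvg_cst.
  rewrite -[X in _ --> X](_ : 1 * 0 - 0 * 1 = 0); last by rewrite mulr0 mul0r subrr.
  by apply: cvgB; apply: cvgM; [exact: u1|exact: up|exact: up|exact: u1].
have c2 : (a%:E * \int[leb]_(x in itv_n n) (beta_density a (b + 1) x)%:E @[n --> \oo]
    --> b%:E * beta_integral (a + 1) b)%E.
  rewrite (_ : (fun n => _) = (fun n => (r n)%:E +
      b%:E * \int[leb]_(x in itv_n n) (beta_density (a + 1) b x)%:E)%E); last first.
    by apply/funext => n; rewrite beta_parts_n// ltW.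
  rewrite -[X in _ --> X]add0e; apply: cvgeD => //.
  - by apply/fine_cvgP; split; [exact: nearW|exact: r0].
  - by apply: cvgeZl => //; exact: beta_integral_cvg.
exact: (cvg_unique _ c1 c2).
Qed.

Lemma beta_integral_split a b : 0 < a -> 0 < b ->
  (beta_integral a b = beta_integral (a + 1) b + beta_integral a (b + 1))%E.
Proof.
move=> a0 b0; rewrite /beta_integral -ge0_integralD//.
- apply: eq_integral => x; rewrite inE /= in_itv /= => /andP[x0 x1].
  rewrite -EFinD /beta_density !addrK; congr EFin.
  by rewrite -(mulr_powRB1 x0 a0) -(@mulr_powRB1 _ (1 - x) b) ?subr_ge0//; ring.
- by move=> x _; rewrite lee_fin beta_density_ge0.
- by apply/measurable_EFinP; apply: measurable_funTS; exact: measurable_beta_density.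
- by move=> x _; rewrite lee_fin beta_density_ge0.
- by apply/measurable_EFinP; apply: measurable_funTS; exact: measurable_beta_density.
Qed.

(** Finiteness spreads from [b = 1], where the integral is at most [a^-1]: to [b + 1] by domination,
    to [(a + 1, b)] by parts, and to [(a, b)] by inserting [1 = x + (1 - x)]. *)
Lemma beta_integral_lty a b : 0 < a -> 0 < b -> (beta_integral a b < +oo)%E.
Proof.
move=> a0 b0.
have B1 : (beta_integral a 1%R <= (a^-1)%R%:E)%E.
  apply: cvge_le (@beta_integral_cvg a 1); apply: nearW => n.
  rewrite -(@lee_pmul2l _ a%:E)// -EFinM divff ?gt_eqF// -[X in beta_density a X]add0r.
  rewrite beta_parts_n// mul0e adde0 lee_fin !powRr0 !mulr1.
  have s1 : n.+3%:R^-1 <= 1 :> R by rewrite invf_le1// ler1n.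
  rewrite (le_trans (y := (1 - n.+3%:R^-1) `^ a))//; first by rewrite gerBl powR_ge0.
  by apply: powR_le1; rewrite ?(ltW a0)// subr_ge0 s1 gerBl invr_ge0 ler0n.
have B2 : (beta_integral a (b + 1) < +oo)%E.
  apply: (@le_lt_trans _ _ (beta_integral a 1%R)); last exact: le_lt_trans B1 (ltry _).
  apply: ge0_le_integral => //.
  - by move=> x _; rewrite lee_fin beta_density_ge0.
  - by apply/measurable_EFinP; apply: measurable_funTS; exact: measurable_beta_density.
  - by apply/measurable_EFinP; apply: measurable_funTS; exact: measurable_beta_density.
  - move=> x /=; rewrite in_itv /= => /andP[x0 x1]; rewrite lee_fin /beta_density addrK.
    rewrite ler_wpM2l ?powR_ge0// subrr powRr0.
    by rewrite powR_le1 ?(ltW b0)// subr_ge0 x1 gerBl.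
rewrite beta_integral_split// lte_add_pinfty//.
have := beta_integral_parts a0 b0 => e.
have : (b%:E * beta_integral (a + 1) b < +oo)%E.
  by rewrite -e lte_mul_pinfty// ?lee_fin ?ltW.
by case: (beta_integral (a + 1) b) => [r _| |//]; rewrite ?ltry// gt0_muley ?lte_fin.
Qed.

End beta_integral.

(* Clipping keeps all moments finite: the split vectors are in [0, 1] only almost
   surely, and the sticks of high index of GEM are arbitrary when alpha < 0. *)
Definition clip (R : realType) (x : R) : R := Num.max 0 (Num.min 1 x).

Definition rising (R : realType) (a : R) (n : nat) : R := \prod_(i < n) (a + i%:R).

Section clip.
Context (R : realType).
Implicit Type x : R.

Lemma clip_ge0 x : 0 <= clip x. Proof. by rewrite /clip le_max lexx. Qed.

Lemma clip_le1 x : clip x <= 1.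
Proof. by rewrite /clip ge_max ler01 ge_min lexx. Qed.

Lemma clip_id x : 0 <= x <= 1 -> clip x = x.
Proof. by move=> /andP[x0 x1]; rewrite /clip min_r// max_r. Qed.

Lemma clip_le_norm x : clip x <= `|x|.
Proof. by rewrite /clip ge_max normr_ge0 ge_min ler_norm orbT. Qed.

Lemma measurable_clip : measurable_fun setT (@clip R).
Proof.
apply: measurable_maxr; first exact: measurable_cst.
by apply: measurable_minr; [exact: measurable_cst|exact: measurable_id].
Qed.

End clip.

Section rising.
Context (R : realType).
Implicit Types a b : R.

Lemma rising0 a : rising a 0 = 1. Proof. by rewrite /rising big_ord0. Qed.

Lemma risingS a n : rising a n.+1 = rising a n * (a + n%:R).
Proof. by rewrite /rising big_ord_recr. Qed.

Lemma risingSl a n : rising a n.+1 = a * rising (a + 1) n.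
Proof.
rewrite /rising big_ord_recl addr0; congr (_ * _); apply: eq_bigr => i _.
by rewrite -addrA -natr1 [1 + _]addrC.
Qed.

Lemma rising_gt0 a n : 0 < a -> 0 < rising a n.
Proof. by move=> a0; apply: prodr_gt0 => i _; rewrite ltr_wpDr. Qed.

Lemma rising_ge0 a n : 0 <= a -> 0 <= rising a n.
Proof. by move=> a0; apply: prodr_ge0 => i _; rewrite addr_ge0. Qed.

Lemma rising0n n : rising 0 n = (n == 0%N)%:R :> R.
Proof. by case: n => [|n]; rewrite ?rising0// risingSl mul0r. Qed.

End rising.

Section beta_moments.
Context (R : realType).
Local Notation leb := (@lebesgue_measure R).
Implicit Types a b : R.

Local Notation B a b := (fine (beta_integral a b)).

Let BE a b : 0 < a -> 0 < b -> beta_integral a b = (B a b)%:E.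
Proof.
by move=> a0 b0; rewrite fineK// ge0_fin_numE ?beta_integral_ge0// beta_integral_lty.
Qed.

(** Integration by parts and the splitting [1 = x + (1 - x)] are two linear equations in the two
    shifted integrals. Solving them replaces the Gamma function. *)
Let Bsucc a b : 0 < a -> 0 < b ->
  B (a + 1) b = a / (a + b) * B a b /\ B a (b + 1) = b / (a + b) * B a b.
Proof.
move=> a0 b0; have ab0 : a + b != 0 by rewrite gt_eqF// addr_gt0.
have := beta_integral_parts a0 b0; have := beta_integral_split a0 b0.
rewrite (BE a0 b0) (BE (addr_gt0 a0 ltr01) b0) (BE a0 (addr_gt0 b0 ltr01)) -EFinD -!EFinM => -[->] [e].
move: (B _ _) (B _ _) e => X Y e.
have k c : (a + b) * (c / (a + b) * (X + Y)) = c * (X + Y) by field.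
by split; apply: (mulfI ab0); rewrite k mulrDl mulrDr -?e// e addrC.
Qed.

Lemma beta_integral_shift a b s t : 0 < a -> 0 < b ->
  B (a + s%:R) (b + t%:R) = rising a s * rising b t / rising (a + b) (s + t) * B a b.
Proof.
move=> a0 b0; elim: s => [|s IH].
  rewrite addr0 rising0 mul1r add0n; elim: t => [|t IH].
    by rewrite addr0 !rising0 divr1 mul1r.
  have b0' : 0 < b + t%:R by rewrite ltr_wpDr.
  rewrite -natr1 addrA (Bsucc a0 b0').2 IH !risingS.
  have := rising_gt0 t (addr_gt0 a0 b0) => r0.
  by rewrite [a + (b + _)]addrA; field; rewrite (gt_eqF r0) gt_eqF// ltr_wpDr// addr_gt0.
have a0' : 0 < a + s%:R by rewrite ltr_wpDr.
have b0' : 0 < b + t%:R by rewrite ltr_wpDr.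
rewrite -natr1 addrA (Bsucc a0' b0').1 IH addSn !risingS natrD.
have := rising_gt0 (s + t) (addr_gt0 a0 b0) => r0.
have -> : a + s%:R + (b + t%:R) = a + b + (s%:R + t%:R) by ring.
by field; rewrite (gt_eqF r0) gt_eqF// ltr_wpDr ?addr_gt0// addr_ge0.
Qed.

Let expr_powR (x a : R) s : 0 <= x -> 0 < a -> x ^+ s * x `^ (a - 1) = x `^ (a + s%:R - 1).
Proof.
move=> x0 a0; elim: s => [|s IH]; first by rewrite mul1r addr0.
rewrite exprS -mulrA IH mulr_powRB1//; last by rewrite ltr_wpDr.
by rewrite -natr1 addrA addrK.
Qed.

(** The formula persists at [b = 0]: there the law is the point mass at 1, and both [rising 0 t] and
    the power of [1 - 1] vanish unless [t = 0]. *)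
Lemma beta_law_moment a b d (T : measurableType d) (P : probability T R)
    (Z : {RV P >-> R}) s t : 0 < a -> 0 <= b ->
  (forall E, measurable E -> distribution P Z E = beta_law a b E) ->
  (\int[P]_x (clip (Z x) ^+ s * (1 - clip (Z x)) ^+ t)%:E =
   (rising a s * rising b t / rising (a + b) (s + t))%:E)%E.
Proof.
move=> a0 b0 ZE.
pose f (z : R) : \bar R := (clip z ^+ s * (1 - clip z) ^+ t)%:E.
have f0 z : (0 <= f z)%E.
  by rewrite lee_fin mulr_ge0 ?exprn_ge0 ?subr_ge0 ?clip_ge0 ?clip_le1.
have mf : measurable_fun setT f.
  apply/measurable_EFinP; apply: measurable_funM; apply: measurable_funX.
    exact: measurable_clip.
  by apply: measurable_funB; [exact: measurable_cst|exact: measurable_clip].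
have mZ : measurable_fun setT Z by [].
have PZ E : measurable E -> (\int[P]_(x in Z @^-1` E) cst 1 x = beta_law a b E)%E.
  move=> mE; rewrite integral_cst; first by rewrite mul1e -ZE.
  by rewrite -[X in measurable X]setTI; exact: mZ.
transitivity (\int[P]_x (f (Z x) * cst 1 x))%E.
  by apply: eq_integral => x _; rewrite mule1.
have [b00|bn0] := eqVneq b 0.
  rewrite (@ge0_integral_transfer _ T _ _ _ R R P (dirac (1 : R)) Z id (cst 1%E) (cst 1%E) f)//.
  - rewrite (eq_integral f); last by move=> x _; rewrite mule1.
    rewrite integral_dirac//= diracE mem_set// mul1e /f clip_id ?ler01 ?lexx//.
    rewrite expr1n mul1r subrr b00 rising0n addr0 expr0n; congr EFin.
    case: (t) => [|t'] /=; last by rewrite mulr0 mul0r.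
    by rewrite addn0 mulr1 divff// gt_eqF// rising_gt0.
  - move=> E mE; rewrite PZ// /beta_law (gt_eqF a0) b00 eqxx integral_cst//.
    by rewrite mul1e.
have b1 : 0 < b by rewrite lt_neqAle eq_sym bn0.
have PT : (beta_law a b setT = 1)%E by rewrite -ZE//; exact: probability_setT.
(* Positivity of the normalizing integral is read off from the total mass: were it 0, the convention
   for inverses would give the law mass 0 instead of 1. *)
have Bn0 : B a b != 0.
  apply/eqP => B0; move: PT; rewrite /beta_law (gt_eqF a0) (gt_eqF b1).
  rewrite [X in (_ / X)%:E](_ : _ = B a b)// B0 invr0 mulr0 => /eqP.
  by rewrite eqe eq_sym oner_eq0.
have B0 : 0 < B a b by rewrite lt_neqAle eq_sym Bn0 fine_ge0// beta_integral_ge0.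
pose h (x : R) : \bar R := ((fun x => (beta_density a b x / B a b)%:E) \_ `[0%R, 1%R]) x.
have h0 x : (0 <= h x)%E.
  by rewrite /h patchE; case: ifP => // _; rewrite lee_fin mulr_ge0 ?beta_density_ge0// invr_ge0 ltW.
have mden : measurable_fun setT (fun x => (beta_density a b x)%:E).
  by apply/measurable_EFinP; exact: measurable_beta_density.
have mh : measurable_fun setT h.
  apply/(measurable_restrictT _ (measurable_itv _)); apply: measurable_funTS.
  apply/measurable_EFinP; apply: measurable_funM; last exact: measurable_cst.
  exact: measurable_beta_density.
rewrite (@ge0_integral_transfer _ T _ _ _ R R P leb Z id (cst 1%E) h f)//.
  transitivity (\int[leb]_(x in `[0%R, 1%R])
     ((B a b)^-1%:E * (beta_density (a + s%:R) (b + t%:R) x)%:E))%E.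
    rewrite [RHS]integral_mkcond; apply: eq_integral => x _.
    rewrite /h !patchE; case: ifPn; last by rewrite mule0.
    rewrite inE /= in_itv /= => /andP[x0 x1].
    rewrite /f clip_id ?x0// -!EFinM; congr EFin.
    rewrite /beta_density -(expr_powR _ x0 a0) -(@expr_powR (1 - x) b) ?subr_ge0//.
    by ring.
  have aS : 0 < a + s%:R by rewrite ltr_wpDr.
  have bS : 0 < b + t%:R by rewrite ltr_wpDr.
  rewrite ge0_integralZl//.
  - rewrite -/(beta_integral _ _) (BE aS bS) (beta_integral_shift s t a0 b1) -EFinM.
    by congr EFin; rewrite mulrCA mulVf// mulr1.
  - by apply/measurable_EFinP; apply: measurable_funTS; exact: measurable_beta_density.
  - by move=> x _; rewrite lee_fin beta_density_ge0.
  - by rewrite lee_fin invr_ge0 ltW.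
move=> E mE; rewrite PZ// /beta_law (gt_eqF a0) (gt_eqF b1) /h -integral_mkcondr.
have mE' : measurable (E `&` `[0%R, 1%R]) by apply: measurableI => //; exact: measurable_itv.
under [RHS]eq_integral do rewrite EFinM.
rewrite ge0_integralZr//; last 3 first.
- exact: measurable_funTS.
- by move=> x _; rewrite lee_fin beta_density_ge0.
- by rewrite lee_fin invr_ge0 ltW.
rewrite /Rintegral EFinM fineK// ge0_fin_numE; last first.
  by apply: integral_ge0 => x _; rewrite lee_fin beta_density_ge0.
apply: le_lt_trans (beta_integral_lty a0 b1).
apply: ge0_subset_integral => //.
- exact: measurable_funTS.
- by move=> x _; rewrite lee_fin beta_density_ge0.
Qed.

End beta_moments.

(** * Labelled trees *)

Local Notation root := Defs.root.

Section plane_trees.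
Implicit Types (s : seq node) (u v w : node) (l : node -> nat).

Lemma is_childP u v : reflect (exists a, v = rcons u a) (is_child u v).
Proof.
apply: (iffP andP) => [[/prefixP[t ->]]|[a ->]].
  rewrite size_cat -addn1 eqn_add2l => /eqP.
  by case: t => [|a [|]]//= _; exists a; rewrite cats1.
by rewrite size_rcons eqxx prefix_rcons.
Qed.

Lemma is_child_rcons u v a : is_child u (rcons v a) = (u == v).
Proof.
apply/is_childP/eqP => [[b /rcons_inj[->]]//|->]; by exists a.
Qed.

Lemma is_child_root u : is_child u root = false.
Proof. by apply/is_childP => -[a]; case: u. Qed.

Definition parent v : node := take (size v).-1 v.

Lemma parent_rcons v a : parent (rcons v a) = v.
Proof. by rewrite /parent size_rcons /= -cats1 take_size_cat. Qed.

Definition parent_closed s := forall v a, rcons v a \in s -> v \in s.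

Lemma parent_closed_take s v i : parent_closed s -> v \in s -> take i v \in s.
Proof.
move=> cs; elim/last_ind: v => [//|v a IH] vs.
have [iv|iv] := leqP i (size v); last by rewrite take_oversize ?size_rcons.
by rewrite -cats1 takel_cat//; apply: IH; exact: cs vs.
Qed.

Definition sibling_injective l s := forall v a b,
  rcons v a \in s -> rcons v b \in s -> l (rcons v a) = l (rcons v b) -> a = b.

(** [l w] is the new last letter of [w]; collecting these letters along the path from the root gives
    a new address. [relabel] is the case of [sibling_rank], while in the other direction an
    arbitrary [l] sends a history to possible positions in the split tree. *)
Definition path_labels l v : node := [seq l (take i.+1 v) | i <- iota 0 (size v)].

Lemma size_path_labels l v : size (path_labels l v) = size v.
Proof. by rewrite size_map size_iota. Qed.

Lemma path_labels_rcons l v a :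
  path_labels l (rcons v a) = rcons (path_labels l v) (l (rcons v a)).
Proof.
rewrite /path_labels size_rcons -addn1 iotaD map_cat cats1 /=.
rewrite take_oversize ?size_rcons//; congr rcons; apply/eq_in_map => i.
by rewrite mem_iota => /= iv; rewrite -cats1 takel_cat.
Qed.

Lemma take_path_labels l v i : take i (path_labels l v) = path_labels l (take i v).
Proof.
elim/last_ind: v => [//|v a IH].
have [iv|iv] := leqP i (size v).
  by rewrite path_labels_rcons -!cats1 !takel_cat// size_path_labels.
by rewrite !take_oversize// ?size_path_labels size_rcons.
Qed.

Lemma eq_path_labels l l' v : (forall i, (i < size v)%N -> l (take i.+1 v) = l' (take i.+1 v)) ->
  path_labels l v = path_labels l' v.
Proof. by move=> ll'; apply/eq_in_map => i; rewrite mem_iota => /ll'. Qed.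

Lemma path_labels_inj l s : parent_closed s -> sibling_injective l s ->
  {in s &, injective (path_labels l)}.
Proof.
move=> cs ls; elim/last_ind => [|u a IH] v us vs.
  by case: v vs => //= b v _ /(congr1 size); rewrite !size_path_labels.
case/lastP: v vs => [|v b] vs.
  by move/(congr1 size); rewrite !size_path_labels size_rcons.
rewrite !path_labels_rcons => /rcons_inj[/(IH _ (cs _ _ us) (cs _ _ vs)) uv].
by rewrite uv => /ls -> //; rewrite -uv.
Qed.

Lemma is_child_path_labels l s : parent_closed s -> sibling_injective l s ->
  {in s &, forall u v, is_child (path_labels l u) (path_labels l v) = is_child u v}.
Proof.
move=> cs ls u v us; case/lastP: v => [|v a] vs; first by rewrite !is_child_root.
rewrite path_labels_rcons !is_child_rcons.
by apply/eqP/eqP => [/(path_labels_inj cs ls us (cs _ _ vs))|->].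
Qed.

Definition sibling_rank s v := index v [seq w <- s | is_child (parent v) w].

Lemma relabelE s v : relabel s v = path_labels (sibling_rank s) v.
Proof.
apply/eq_in_map => i; rewrite mem_iota => /= iv.
rewrite /sibling_rank /parent size_takel//=; congr (index _ _).
by apply: eq_filter => w; rewrite take_takel.
Qed.

Lemma sibling_rank_injective s : sibling_injective (sibling_rank s) s.
Proof.
move=> v a b va vb; rewrite /sibling_rank !parent_rcons => e.
have mem x : rcons v x \in s -> rcons v x \in [seq w <- s | is_child v w].
  by move=> vx; rewrite mem_filter is_child_rcons eqxx.
have := nth_index root (mem _ va); rewrite e nth_index ?mem// => /rcons_inj[].
by [].
Qed.

Lemma sibling_rank_rcons s v w : v \in s -> (0 < size v)%N ->
  sibling_rank (rcons s w) v = sibling_rank s v.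
Proof.
case/lastP: v => // v a vs _; rewrite /sibling_rank parent_rcons filter_rcons.
by case: ifP => // _; rewrite -[rcons [seq _ <- _ | _] _]cats1 index_cat mem_filter is_child_rcons eqxx vs.
Qed.

Lemma relabel_rcons s v w : parent_closed s -> v \in s -> relabel (rcons s w) v = relabel s v.
Proof.
move=> cs vs; rewrite !relabelE; apply: eq_path_labels => i iv.
by rewrite sibling_rank_rcons ?parent_closed_take// size_takel.
Qed.

Lemma relabel_new s p a : parent_closed s -> p \in s -> rcons p a \notin s ->
  relabel (rcons s (rcons p a)) (rcons p a) = rcons (relabel s p) (count (is_child p) s).
Proof.
move=> cs ps ns; rewrite relabelE path_labels_rcons -relabelE relabel_rcons//.
congr rcons; rewrite /sibling_rank parent_rcons filter_rcons is_child_rcons eqxx.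
rewrite -[rcons [seq _ <- _ | _] _]cats1 index_cat mem_filter (negbTE ns) andbF /= eqxx addn0.
by rewrite size_filter.
Qed.

Lemma landing_cases (c : node -> nat) s k v :
  landing c s k v = v \/ exists2 p, p \in s & landing c s k v = rcons p (c p).
Proof.
elim: k v => [|k IH] v /=; first by left.
case: ifPn => vs; last by left.
by right; have [->|//] := IH (rcons v (c v)); exists v.
Qed.

Lemma landing_path (c : node -> nat) s k w :
  (forall j, (j < size w)%N -> take j w \in s /\ c (take j w) = nth 0%N w j) ->
  w \notin s -> (size w <= k)%N -> landing c s k root = w.
Proof.
move=> cw ws; rewrite -[root](take0 w) -[X in (X <= _)%N]subn0.
have : (0 <= size w)%N by []; move: 0%N => i.
elim: k i => [|k IH] i iw wk.
  by rewrite take_oversize//= -subn_eq0 -leqn0.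
have [wi|wi] := leqP (size w) i; first by rewrite take_oversize//= (negbTE ws).
have [ts ci] := cw _ wi; rewrite /= ts ci -take_nth// IH//.
by rewrite subnS; case: (size w - i)%N wk.
Qed.

Variable c : nat -> node -> nat.

Lemma root_split_nodes n : root \in split_nodes c n.+1.
Proof.
elim: n => [|n IH]; first by rewrite /= inE.
by rewrite [split_nodes _ _]/= mem_rcons inE IH orbT.
Qed.

Lemma split_nodes_uniq n : uniq (split_nodes c n).
Proof. by elim: n => [//|n IH] /=; rewrite rcons_uniq landing_notin. Qed.

Lemma split_nodesS n : exists2 p, p \in split_nodes c n.+1 &
  split_nodes c n.+2 = rcons (split_nodes c n.+1) (rcons p (c n.+1 p)).
Proof.
pose s := split_nodes c n.+1.
have [e|[p ps e]] := landing_cases (c n.+1) s (size s) root; last first.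
  by exists p => //; rewrite -e.
by have := landing_notin (c n.+1) s; rewrite e root_split_nodes.
Qed.

Lemma split_nodes_closed n : parent_closed (split_nodes c n).
Proof.
case: n => [//|n]; elim: n => [|n IH]; first by move=> [|? ?] a //=; rewrite inE.
have [p ps ->] := split_nodesS n => v a; rewrite !mem_rcons !inE => /orP[/eqP|/IH->].
  by move=> /rcons_inj[-> _]; rewrite ps orbT.
by rewrite orbT.
Qed.

Lemma relabel_inj n : {in split_nodes c n &, injective (relabel (split_nodes c n))}.
Proof.
move=> u v us vs; rewrite !relabelE.
exact: (path_labels_inj (@split_nodes_closed n) (@sibling_rank_injective _) us vs).
Qed.

Lemma is_child_relabel n : {in split_nodes c n &, forall u v,
  is_child (relabel (split_nodes c n) u) (relabel (split_nodes c n) v) = is_child u v}.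
Proof.
move=> u v us vs; rewrite !relabelE.
by rewrite (is_child_path_labels (@split_nodes_closed n) (@sibling_rank_injective _)).
Qed.

(** This reduces the statement on unordered trees to the one on relabelled trees. *)
Lemma tree_iso_relabelled n : tree_iso (split_tree c n) (relabelled_split_tree c n).
Proof.
exists (relabel (split_nodes c n)); split => //.
- by move=> u v; rewrite !inE; exact: relabel_inj.
- apply/fsetP => v; apply/imfsetP/imfsetP => /= -[u us ->]; exists u => //.
    by move: us; rewrite !inE.
  by rewrite !inE.
- by move=> u v; rewrite !inE; exact: is_child_relabel.
Qed.

(** For [k > 0], the parent of the node filled by ball [k], named as in the relabelled tree that
    this ball finds. *)
Definition relabelled_parent k : node :=
  relabel (split_nodes c k) (parent (last root (split_nodes c k.+1))).

(** Relabelled split trees grow by [attach], so in both models the trees are the same function of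
    the sequence of parents, and only these sequences have to be compared. *)
Lemma relabelled_split_treeE n : relabelled_split_tree c n = pa_tree relabelled_parent n.
Proof.
rewrite /relabelled_split_tree; case: n => [|n].
  by apply/fsetP => v; rewrite inE; apply/negbTE/imfsetP => -[].
elim: n => [|n IH].
  by apply/fsetP => v; rewrite inE; apply/imfsetP/eqP => /= [[u]|->]; [rewrite inE => /eqP -> ->|exists root; rewrite ?inE].
have [p ps e] := split_nodesS n.
have cs := @split_nodes_closed n.+1.
have us : uniq (rcons (split_nodes c n.+1) (rcons p (c n.+1 p))).
  by rewrite -e split_nodes_uniq.
move: us; rewrite rcons_uniq => /andP[ns us].
have -> : pa_tree relabelled_parent n.+2 =
  attach (pa_tree relabelled_parent n.+1) (relabelled_parent n.+1) by [].
rewrite -IH /attach /relabelled_parent e last_rcons parent_rcons.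
set s := split_nodes c n.+1 in ps cs ns us *.
have -> : outdeg [fset relabel s v | v in s]%fset (relabel s p) = count (is_child p) s.
  rewrite /outdeg; have /permP -> : perm_eq [fset relabel s v | v in s]%fset [seq relabel s v | v <- s].
    apply: uniq_perm; first exact: fset_uniq.
      by rewrite map_inj_in_uniq//; exact: relabel_inj.
    by move=> v; apply/imfsetP/mapP => /= -[u us' ->]; exists u.
  by rewrite count_map; apply: eq_in_count => v vs /=; exact: is_child_relabel.
rewrite -(relabel_new cs ps ns); apply/fsetP => v; rewrite !inE.
apply/imfsetP/orP => /= [[u]|[/eqP->|/imfsetP[u us' ->]]].
- rewrite mem_rcons inE => /orP[/eqP-> ->|us' ->]; [by left|right].
  by rewrite relabel_rcons//; apply/imfsetP; exists u.
- by exists (rcons p (c n.+1 p)) => //=; rewrite mem_rcons mem_head.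
- by exists u => /=; [rewrite mem_rcons inE us' orbT|rewrite relabel_rcons].
Qed.

End plane_trees.

(** * Histories of the preferential attachment tree *)

Section pa_nodes.
Implicit Types (s : seq node) (u : nat -> node) (v w : node) (l : node -> nat).

(** The nodes of [pa_tree] as a list in order of birth; the order matches balls with nodes, and it
    governs the later summation over labels. *)
Fixpoint pa_nodes u n : seq node :=
  if n is k.+1 then
    if k == 0%N then [:: root]
    else rcons (pa_nodes u k) (rcons (u k) (count (is_child (u k)) (pa_nodes u k)))
  else [::].

Lemma pa_nodesS u n : (0 < n)%N ->
  pa_nodes u n.+1 = rcons (pa_nodes u n) (rcons (u n) (count (is_child (u n)) (pa_nodes u n))).
Proof. by case: n. Qed.

Lemma size_pa_nodes u n : size (pa_nodes u n) = n.
Proof. by elim: n => [//|[//|n] IH]; rewrite pa_nodesS// size_rcons IH. Qed.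

Lemma count_rconsE (T : Type) (P : pred T) (t : seq T) x :
  count P (rcons t x) = (count P t + P x)%N.
Proof. by rewrite -cats1 count_cat /= addn0. Qed.

Lemma pa_children u n v : [seq w <- pa_nodes u n | is_child v w] =
  [seq rcons v i | i <- iota 0 (count (is_child v) (pa_nodes u n))].
Proof.
elim: n => [//|[_|n IH]]; first by rewrite /= is_child_root.
rewrite pa_nodesS// filter_rcons count_rconsE is_child_rcons.
case: eqVneq => [<-|_]; last by rewrite addn0.
by rewrite iotaD map_cat IH cats1.
Qed.

Lemma pa_nodes_fresh u n v : rcons v (count (is_child v) (pa_nodes u n)) \notin pa_nodes u n.
Proof.
apply/negP => h; have : rcons v (count (is_child v) (pa_nodes u n)) \in
  [seq w <- pa_nodes u n | is_child v w] by rewrite mem_filter is_child_rcons eqxx.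
rewrite pa_children => /mapP[i]; rewrite mem_iota => /= iv /rcons_inj[e].
by rewrite -e ltnn in iv.
Qed.

Lemma pa_nodes_uniq u n : uniq (pa_nodes u n).
Proof.
by elim: n => [//|[//|n] IH]; rewrite pa_nodesS// rcons_uniq IH pa_nodes_fresh.
Qed.

Lemma root_pa_nodes u n : root \in pa_nodes u n.+1.
Proof. by elim: n => [//|n IH]; rewrite pa_nodesS// mem_rcons inE IH orbT. Qed.

Lemma outdeg_fset s v : uniq s -> outdeg [fset w in s]%fset v = count (is_child v) s.
Proof.
move=> us; rewrite /outdeg; have /permP -> : perm_eq [fset w in s]%fset s.
  by apply: uniq_perm => // w; rewrite inE.
by [].
Qed.

Lemma pa_treeE u n : pa_tree u n = [fset w in pa_nodes u n]%fset.
Proof.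
elim: n => [|[_|n IH]].
- by apply/fsetP => w; rewrite !inE.
- by apply/fsetP => w; rewrite !inE orbF.
have -> : pa_tree u n.+2 = attach (pa_tree u n.+1) (u n.+1) by [].
rewrite pa_nodesS// IH /attach outdeg_fset ?pa_nodes_uniq//.
by apply/fsetP => w; rewrite !inE mem_rcons inE.
Qed.

Definition pa_history u n := forall k, (0 < k < n)%N -> u k \in pa_nodes u k.

Lemma pa_historyS u n : pa_history u n.+1 -> pa_history u n.
Proof. by move=> h k /andP[k0 kn]; apply: h; rewrite k0 ltnW. Qed.

Lemma pa_nodes_closed u n : pa_history u n -> parent_closed (pa_nodes u n).
Proof.
elim: n => [//|[_ _|n IH h]]; first by move=> [|? ?] a //=; rewrite inE.
rewrite pa_nodesS// => v a; rewrite !mem_rcons !inE => /orP[/eqP/rcons_inj[-> _]|].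
  by rewrite h ?orbT//=.
by move=> /(IH (pa_historyS h)) ->; rewrite orbT.
Qed.

(** The [(size v).+1] prefixes of [v] are distinct elements of [s]. This guarantees that a ball has
    enough fuel to reach its node. *)
Lemma size_closed s v : parent_closed s -> v \in s -> (size v < size s)%N.
Proof.
move=> cs vs; have := @uniq_leq_size _ [seq take i v | i <- iota 0 (size v).+1] s.
rewrite size_map size_iota; apply.
  rewrite map_inj_in_uniq ?iota_uniq// => i j; rewrite !mem_iota !ltnS => /= iv jv.
  by move=> /(congr1 size); rewrite !size_takel.
by move=> _ /mapP[i _ ->]; exact: parent_closed_take.
Qed.

(* The first balls make the choices that lead to the nodes rs, once labelled by l. *)
Definition follows (c : nat -> node -> nat) l (rs : seq node) :=
  forall k j, (k < size rs)%N -> (j < size (nth root rs k))%N ->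
    c k (path_labels l (take j (nth root rs k))) = l (take j.+1 (nth root rs k)).

(** The balls spell out the addresses [path_labels l r] one after the other, so the split tree is
    the tree of the history with labels [l]. That relabelling by order of appearance undoes [l]
    belongs to the induction, because it identifies the parent of the next node. *)
Lemma split_nodes_follow c u n l : pa_history u n ->
  sibling_injective l (pa_nodes u n) -> follows c l (pa_nodes u n) ->
  [/\ split_nodes c n = map (path_labels l) (pa_nodes u n),
      {in pa_nodes u n, forall r, relabel (split_nodes c n) (path_labels l r) = r} &
      forall k, (0 < k < n)%N -> relabelled_parent c k = u k].
Proof.
elim: n => [|n IH] h lS f; first by split => // k; rewrite ltn0 andbF.
have [n0|n0] := posnP n.
  rewrite n0; split => //; last by move=> k; rewrite ltnS; case: k.
  by move=> r; rewrite inE => /eqP ->.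
have hn := pa_historyS h; have cn := pa_nodes_closed h; move: cn lS f.
rewrite pa_nodesS//; set p := u n; set d := count _ _; set rs := pa_nodes u n => cn lS f.
have lSn : sibling_injective l rs.
  by move=> v a b va vb; apply: lS; rewrite mem_rcons inE ?va ?vb orbT.
have fn : follows c l rs.
  move=> k j kn jk; have := f k j; rewrite size_rcons nth_rcons kn; apply => //.
  exact: leqW.
have [sE relE parE] := IH hn lSn fn.
have ps : p \in rs by apply: h; rewrite n0 /=.
have rsn : rcons p d \notin rs by exact: pa_nodes_fresh.
have crs : parent_closed rs by exact: pa_nodes_closed.
have srs : size rs = n by exact: size_pa_nodes.
have newn : path_labels l (rcons p d) \notin split_nodes c n.
  rewrite sE; apply/mapP => -[r rr] /(path_labels_inj cn lS); rewrite !mem_rcons !inE eqxx rr orbT.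
  by move=> /(_ isT isT) e; rewrite e rr in rsn.
have landE : landing (c n) (split_nodes c n) (size (split_nodes c n)) root = path_labels l (rcons p d).
  apply: landing_path => //.
  - rewrite size_path_labels => j jr; rewrite take_path_labels; split.
      rewrite sE; apply: map_f; rewrite size_rcons ltnS in jr.
      by rewrite -cats1 takel_cat//; exact: parent_closed_take.
    have := f n j; rewrite size_rcons nth_rcons srs ltnn eqxx ltnSn => -> //.
    by rewrite (nth_map 0%N) ?size_iota// nth_iota// add0n.
  - rewrite size_path_labels size_rcons sE size_map; exact: size_closed.
have sSE : split_nodes c n.+1 = rcons (split_nodes c n) (path_labels l (rcons p d)).
  by rewrite [LHS]/= landE.
have cse : parent_closed (split_nodes c n) by exact: split_nodes_closed.
have psn : path_labels l p \in split_nodes c n by rewrite sE map_f.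
split.
- by rewrite sSE map_rcons sE.
- move=> r; rewrite sSE mem_rcons inE => /orP[/eqP->|rr]; last first.
    by rewrite relabel_rcons ?relE// sE map_f.
  move: newn; rewrite path_labels_rcons => newn; rewrite relabel_new// relE//.
  congr rcons; rewrite sE count_map; apply: eq_in_count => r' rr' /=.
  exact: (is_child_path_labels crs lSn ps rr').
- move=> k /andP[k0]; rewrite ltnS leq_eqVlt => /predU1P[->|kn]; last by apply: parE; rewrite k0.
  by rewrite /relabelled_parent sSE last_rcons path_labels_rcons parent_rcons relE.
Qed.

Lemma big_children (R : Type) (idx : R) (op : Monoid.com_law idx) s (F : node -> R) :
  uniq s -> parent_closed s ->
  \big[op/idx]_(v <- s) \big[op/idx]_(c <- s | is_child v c) F c =
  \big[op/idx]_(c <- s | c != root) F c.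
Proof.
move=> us cs; rewrite (exchange_big_dep (fun c => c != root))/=; last first.
  by move=> v c _; apply: contraTneq => ->; rewrite is_child_root.
rewrite big_seq_cond [RHS]big_seq_cond; apply: eq_bigr => c /andP[cs' c0].
case/lastP: c cs' c0 => [//|p a] pas _.
rewrite (eq_bigl (fun v => v == p)); last by move=> v; rewrite is_child_rcons.
by rewrite -big_filter (filter_pred1_uniq us (cs _ _ pas)) big_seq1.
Qed.

(** Each ball stops at its own node, below every node it has visited; hence this is also the number
    of balls that visit [v]. *)
Definition subtree_size s v := count (prefix v) s.

Lemma subtree_size_children s v : uniq s -> parent_closed s -> v \in s ->
  subtree_size s v = (\sum_(c <- s | is_child v c) subtree_size s c).+1.
Proof.
move=> us cs vs; have cntE (a : pred node) : count a s = (\sum_(w <- s) a w)%N.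
  by rewrite -sum1_count big_mkcond /=; apply: eq_bigr => w _; case: (a w).
suff H w : w \in s -> prefix v w = ((w == v) + \sum_(c <- s | is_child v c) prefix c w)%N :> nat.
  rewrite /subtree_size cntE (eq_big_seq _ H) big_split/= exchange_big/= -add1n.
  congr (_ + _)%N; last by apply: eq_bigr => c _; rewrite cntE.
  by rewrite -(cntE (pred1 v)) count_uniq_mem// vs.
move=> ws.
have [->|wv] := eqVneq w v.
  rewrite prefix_refl big1 ?addn0// => c /is_childP[a ->].
  by apply/eqP; rewrite eqb0; apply/negP => /size_prefix; rewrite size_rcons ltnn.
rewrite add0n; case: (boolP (prefix v w)) => [/prefixP[[|a t] wE]|nvw].
- by rewrite wE cats0 eqxx in wv.
- have vas : rcons v a \in s.
    have := parent_closed_take (size v).+1 cs ws.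
    by rewrite wE -cat_rcons take_size_cat// size_rcons.
  rewrite big_mkcond /= (eq_bigr (fun c => c == rcons v a : nat)).
    by rewrite -(cntE (pred1 (rcons v a))) count_uniq_mem// vas.
  move=> c _; case: is_childP => [[b ->]|nc]; last first.
    by case: eqVneq => // e; case: nc; exists a.
  rewrite wE -cat_rcons; case: eqVneq => [/rcons_inj[->]|ba]; first by rewrite prefix_prefix.
  apply/eqP; rewrite eqb0; apply: contra ba => /prefixP[t'] /eqP.
  by rewrite eqseq_cat ?size_rcons// => /andP[/eqP -> _].
- rewrite big1// => c /is_childP[a ->].
  apply/eqP; rewrite eqb0; apply: contra nvw => /prefixP[t' ->].
  by rewrite cat_rcons prefix_prefix.
Qed.

Lemma big_path_labels (R : Type) (idx : R) (op : Monoid.com_law idx) s r (F : node -> R) :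
  uniq s -> parent_closed s -> r \in s ->
  \big[op/idx]_(j <- iota 0 (size r)) F (take j.+1 r) =
  \big[op/idx]_(c <- s | (c != root) && prefix c r) F c.
Proof.
move=> us cs rs; rewrite -[RHS]big_filter -[LHS](big_map (fun j => take j.+1 r) xpredT F).
apply: perm_big; apply: uniq_perm; rewrite ?filter_uniq//.
  rewrite map_inj_in_uniq ?iota_uniq// => i j; rewrite !mem_iota => /= ir jr.
  by move=> /(congr1 size); rewrite !size_takel// => -[].
move=> v; rewrite mem_filter; apply/mapP/andP.
  move=> [j]; rewrite mem_iota => /= jr ->; split; last exact: parent_closed_take.
  by rewrite prefix_take andbT -size_eq0 size_takel.
move=> [/andP[v0 /prefixP[t rE]] vs]; exists (size v).-1; last first.
  by rewrite prednK ?lt0n ?size_eq0// rE take_size_cat.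
rewrite mem_iota /= rE size_cat add0n; case: (v) v0 => //= a v' _.
by rewrite addSn ltnS leq_addr.
Qed.

(** The choices are regrouped by edge instead of by ball: the edge leading to [c] is crossed by
    every ball that stops at or below [c]. *)
Lemma big_path_prod (R : comPzSemiRingType) s (G : node -> R) : uniq s -> parent_closed s ->
  \prod_(r <- s) \prod_(j <- iota 0 (size r)) G (take j.+1 r) =
  \prod_(v <- s) \prod_(c <- s | is_child v c) G c ^+ subtree_size s c.
Proof.
move=> us cs; rewrite big_children//.
rewrite (eq_big_seq (fun r => \prod_(c <- s | (c != root) && prefix c r) G c)); last first.
  by move=> r rs; exact: big_path_labels.
rewrite (exchange_big_dep (fun c => c != root))/=; last by move=> r c _ /andP[].
apply: eq_bigr => c c0; rewrite (eq_bigl (prefix c)); last by move=> r; rewrite c0.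
by rewrite big_const_seq -Monoid.iteropE.
Qed.

End pa_nodes.

(** * The probability of a preferential attachment history *)

(* The exchangeable partition probability function of the Chinese restaurant
   process, for blocks A of sizes N.  At theta = 0 the quotient is 0 / 0 = 0
   unless A is empty. *)
Definition eppf (R : realType) (I : eqType) (alpha theta : R) (N : I -> nat) (A : seq I) : R :=
  \prod_(i < size A) (theta + i%:R * alpha) * \prod_(c <- A) rising (1 - alpha) (N c).-1
  / rising theta (\sum_(c <- A) N c).

Section pa_product.
Context (R : realType) (chi rho : R).
Hypotheses (rho_gt0 : 0 < rho) (D_gt0 : 0 < chi + rho).
Let alpha := chi / (chi + rho).
Let theta := rho / (chi + rho).

Let theta_gt0 : 0 < theta. Proof. by rewrite divr_gt0. Qed.

Let alphaE : 1 - alpha = theta.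
Proof. by rewrite /alpha /theta; field; rewrite gt_eqF. Qed.

Implicit Types (u : nat -> node) (n k : nat).

(** Outdegrees in a tree with [k.+1] nodes sum to [k], so the total weight is [chi * k + rho * (k +
    1) = (chi + rho) * (theta + k)]. *)
Lemma pa_probE u k : pa_history u k.+1 -> u k.+1 \in pa_nodes u k.+1 ->
  pa_prob chi rho (pa_tree u k.+1) (u k.+1) =
  (theta + (count (is_child (u k.+1)) (pa_nodes u k.+1))%:R * alpha) / (theta + k%:R).
Proof.
move=> h uk; rewrite /pa_prob pa_treeE inE /= uk.
set s := pa_nodes u k.+1; have us : uniq s by exact: pa_nodes_uniq.
have cs : parent_closed s by exact: pa_nodes_closed.
have -> : \sum_(w <- [fset w in s]%fset) pa_weight chi rho [fset w in s]%fset w =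
    (chi + rho) * (theta + k%:R).
  rewrite (perm_big s) /=; last by apply: uniq_perm; rewrite ?fset_uniq// => w; rewrite inE.
  under eq_bigr do rewrite /pa_weight outdeg_fset//.
  rewrite big_split/= -mulr_sumr.
  rewrite -natr_sum (_ : (\sum_(w <- s) _)%N = k); last first.
    under eq_bigr do rewrite -sum1_count.
    rewrite big_children// sum1_count; apply/eqP.
    rewrite -(eqn_add2l (count (pred1 root) s)) count_predC count_uniq_mem//.
    by rewrite root_pa_nodes size_pa_nodes.
  rewrite big_const_seq count_predT size_pa_nodes iter_addr_0 /theta -[rho *+ _]mulr_natr -natr1.
  by field; rewrite gt_eqF.
rewrite /pa_weight outdeg_fset//; set dg := (count _ _)%:R.
have tk : theta + k%:R != 0 by rewrite gt_eqF// ltr_wpDr.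
have -> : chi * dg + rho = (chi + rho) * (theta + dg * alpha).
  by rewrite /theta /alpha; field; rewrite gt_eqF.
by field; rewrite tk gt_eqF.
Qed.

(** Regrouping by parent: the successive children of [v] arrive when its outdegree is 0, 1, 2, and
    so on. *)
Let prod_degrees u n : pa_history u n.+1 ->
  \prod_(1 <= k < n.+1) (theta + (count (is_child (u k)) (pa_nodes u k))%:R * alpha) =
  \prod_(v <- pa_nodes u n.+1) \prod_(i < count (is_child v) (pa_nodes u n.+1)) (theta + i%:R * alpha).
Proof.
elim: n => [|n IH] h; first by rewrite big_nil big_seq1 /= big_ord0.
have hn := pa_historyS h; rewrite big_nat_recr// IH//.
have uk : u n.+1 \in pa_nodes u n.+1 by apply: h; rewrite ltnSn.
have us := pa_nodes_uniq u n.+1.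
rewrite [in RHS]pa_nodesS//; set p := u n.+1 in uk *; set s := pa_nodes u n.+1 in us uk *.
have cs : parent_closed s by exact: pa_nodes_closed.
have fr : rcons p (count (is_child p) s) \notin s by exact: pa_nodes_fresh.
have nochild : count (is_child (rcons p (count (is_child p) s))) s = 0%N.
  apply/eqP; rewrite -leqn0 leqNgt -has_count; apply/hasPn => w ws.
  by apply: contra fr => /is_childP[a wE]; apply: (cs _ a); rewrite -wE.
rewrite big_rcons /= count_rconsE is_child_rcons nochild.
rewrite [rcons _ _ == _](_ : _ = false) ?big_ord0 ?mulr1; last first.
  by apply/eqP => /(congr1 size)/eqP; rewrite size_rcons eqn_leq ltnn.
under [RHS]eq_bigr do rewrite count_rconsE is_child_rcons.
rewrite [RHS](eq_bigr (fun v => \prod_(i < count (is_child v) s) (theta + i%:R * alpha) *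
    (if v == p then theta + (count (is_child v) s)%:R * alpha else 1))); last first.
  move=> v _; case: (v == p) => /=; last by rewrite addn0 mulr1.
  by rewrite addn1 big_ord_recr.
rewrite big_split/=; congr (_ * _).
by rewrite -big_mkcond -big_filter (filter_pred1_uniq us uk) big_seq1.
Qed.

(* Each factor [rising theta] of a node cancels the one of the same node seen as
   a child, because [1 - alpha = theta]; only that of the root remains. *)
Lemma pa_prob_eppf u n : pa_history u n.+1 ->
  \prod_(1 <= k < n.+1) pa_prob chi rho (pa_tree u k) (u k) =
  \prod_(v <- pa_nodes u n.+1)
    eppf alpha theta (subtree_size (pa_nodes u n.+1)) [seq c <- pa_nodes u n.+1 | is_child v c].
Proof.
move=> h; set s := pa_nodes u n.+1.
have us : uniq s by exact: pa_nodes_uniq.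
have cs : parent_closed s by exact: pa_nodes_closed.
have rs : root \in s by exact: root_pa_nodes.
have rg m : rising theta m != 0 by rewrite gt_eqF// rising_gt0.
transitivity (\prod_(1 <= k < n.+1) (theta + (count (is_child (u k)) (pa_nodes u k))%:R * alpha)
    / rising theta n).
  have -> : rising theta n = \prod_(1 <= k < n.+1) (theta + k.-1%:R).
    by rewrite /rising big_add1 big_mkord.
  rewrite -prodf_div big_nat [RHS]big_nat; apply: eq_bigr => -[//|k] /andP[_ kn].
  by apply: pa_probE; [move=> j /andP[j0 jk]; apply: h; rewrite j0 (ltn_trans jk)|apply: h].
rewrite prod_degrees// /eppf.
under [RHS]eq_bigr do rewrite size_filter.
rewrite prodf_div big_split/= -/s -!mulrA; congr (_ * _).
under [X in _ = X * _]eq_bigr do rewrite big_filter.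
rewrite big_children// alphaE.
have -> : \prod_(v <- s) rising theta (\sum_(c <- [seq c <- s | is_child v c]) subtree_size s c)
    = \prod_(v <- s) rising theta (subtree_size s v).-1.
  apply: eq_big_seq => v vs; rewrite big_filter [in RHS]subtree_size_children//.
rewrite [in X in _ = _ / X](bigD1_seq root)//=.
have -> : (subtree_size s root).-1 = n.
  rewrite /subtree_size (eq_count (a2 := predT)) ?count_predT ?size_pa_nodes//.
  by move=> v; rewrite prefix0s.
rewrite invfM mulrCA mulfV ?mulr1//.
by rewrite prodf_seq_neq0; apply/allP => v _; rewrite rg implybT.
Qed.

End pa_product.

(** * Injection sums of stick-breaking sequences *)

Section injection_sum.
Context (R : realType) (I : eqType) (N : I -> nat).
Implicit Types (x z : nat -> R) (A : seq I) (ls : seq nat).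

(* The sum, over the injections i of A into ls, of \prod_(c <- A) x (i c) ^+ N c:
   at most one element of A is sent to the head of ls. *)
Fixpoint injection_sum x A ls : R :=
  if ls is l :: ls' then
    injection_sum x A ls' +
    \sum_(c <- A) x l ^+ N c * injection_sum x [seq c' <- A | c' != c] ls'
  else (A == [::])%:R.

Lemma injection_sum_map x (f : nat -> nat) A ls :
  injection_sum (x \o f) A ls = injection_sum x A (map f ls).
Proof.
elim: ls A => [//|l ls IH] A /=; rewrite IH; congr (_ + _).
by apply: eq_bigr => c _; rewrite IH.
Qed.

Lemma injection_sum_ge0 x A ls : (forall i, 0 <= x i) -> 0 <= injection_sum x A ls.
Proof.
move=> x0; elim: ls A => [|l ls IH] A /=; first by rewrite ler0n.
by rewrite addr_ge0// sumr_ge0// => c _; rewrite mulr_ge0// exprn_ge0.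
Qed.

Lemma eq_injection_sum x x' A ls : {in ls, x =1 x'} -> injection_sum x A ls = injection_sum x' A ls.
Proof.
elim: ls A => [//|l ls IH] A xx' /=.
have {}IH A' : injection_sum x A' ls = injection_sum x' A' ls.
  by apply: IH => i il; apply: xx'; rewrite inE il orbT.
by rewrite IH; congr (_ + _); apply: eq_bigr => c _; rewrite IH xx'// mem_head.
Qed.

(** Transpositions of labels give the symmetry of the sum, which is invisible in its recursive
    definition. The terms using both labels are matched by exchanging the two elements of [A]. *)
Lemma injection_sum_swap x A l l' ls :
  injection_sum x A (l :: l' :: ls) = injection_sum x A (l' :: l :: ls).
Proof.
rewrite /=; set T := injection_sum x; pose B c := [seq c' <- A | c' != c].
have E k k' : \sum_(c <- A) x k ^+ N c * (T (B c) ls +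
      \sum_(c' <- B c) x k' ^+ N c' * T [seq i <- B c | i != c'] ls) =
    \sum_(c <- A) x k ^+ N c * T (B c) ls +
    \sum_(c <- A) \sum_(c' <- A | c' != c) x k ^+ N c * (x k' ^+ N c' * T [seq i <- B c | i != c'] ls).
  rewrite -big_split/=; apply: eq_bigr => c _.
  by rewrite mulrDr big_filter mulr_sumr.
rewrite !E !addrA [X in X + _ = _]addrAC; congr (_ + _).
rewrite (exchange_big_dep predT)//=; apply: eq_bigr => c _.
apply: eq_big => [c'|c' _]; first by rewrite eq_sym.
rewrite mulrCA -!filter_predI; congr (_ * (_ * T _ _)).
by apply: eq_filter => i /=; rewrite andbC.
Qed.

Lemma injection_sum_rem x A l ls : l \in ls ->
  injection_sum x A ls = injection_sum x A (l :: rem l ls).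
Proof.
elim: ls A => // l0 ls IH A; have [->|l0l] := eqVneq l0 l; first by rewrite [rem _ _]/= eqxx.
rewrite inE eq_sym (negbTE l0l) /= => ll; rewrite (negbTE l0l).
rewrite -[RHS]/(injection_sum x A (l :: l0 :: rem l ls)) injection_sum_swap.
rewrite [RHS]/= -!/(injection_sum x _ (l :: rem l ls)).
rewrite IH//; congr (_ + _); apply: eq_bigr => c _.
by rewrite IH.
Qed.

Lemma injection_sum_subset x A ls ls' : (forall i, 0 <= x i) ->
  uniq ls -> {subset ls <= ls'} -> injection_sum x A ls <= injection_sum x A ls'.
Proof.
move=> x0; elim: ls A ls' => [|l ls IH] A ls'.
  move=> _ _; elim: ls' => [//|l' ls' IH'] /=.
  rewrite (le_trans IH')// lerDl sumr_ge0// => c _.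
  by rewrite mulr_ge0 ?exprn_ge0// injection_sum_ge0.
move=> /= /andP[nl uls] sub.
rewrite (@injection_sum_rem _ _ l ls'); last by apply: sub; rewrite mem_head.
have sub' : {subset ls <= rem l ls'}.
  move=> i il; have ls'i : i \in ls' by apply: sub; rewrite inE il orbT.
  have : i \in l :: rem l ls' by rewrite -(perm_mem (perm_to_rem _))// sub// mem_head.
  by rewrite inE => /predU1P[e|//]; rewrite -e il in nl.
rewrite /= lerD ?IH// ler_sum// => c _.
by rewrite ler_wpM2l ?exprn_ge0// IH.
Qed.

Lemma sum_remove A c : uniq A -> c \in A ->
  (\sum_(i <- A) N i = N c + \sum_(i <- [seq i <- A | i != c]) N i)%N.
Proof. by move=> uA cA; rewrite (bigD1_seq c)//= big_filter. Qed.

(* The injection sum of a stick-breaking sequence over the labels l, ..., l + L - 1,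
   with the contribution of the first l sticks factored out. *)
Fixpoint stick_sum z l L A : R :=
  if L is L'.+1 then
    (1 - z l) ^+ (\sum_(i <- A) N i) * stick_sum z l.+1 L' A +
    \sum_(c <- A) z l ^+ N c * (1 - z l) ^+ (\sum_(i <- [seq i <- A | i != c]) N i) *
      stick_sum z l.+1 L' [seq i <- A | i != c]
  else (A == [::])%:R.

(** Every piece with index at least [l] contains the mass left by the first [l] sticks as a factor,
    and such pieces are multiplied [\sum_(i <- A) N i] times. *)
Lemma injection_sum_stick_breaking z l L A : uniq A ->
  injection_sum (stick_breaking z) A (iota l L) =
  (\prod_(j < l) (1 - z j)) ^+ (\sum_(i <- A) N i) * stick_sum z l L A.
Proof.
elim: L l A => [|L IH] l A uA /=.
  by case: eqVneq => [->|]; rewrite ?big_nil ?mul1r ?mulr0.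
rewrite IH// mulrDr big_ord_recr/= exprMn mulrA; congr (_ + _).
rewrite mulr_sumr big_seq [RHS]big_seq; apply: eq_bigr => c cA.
rewrite IH ?filter_uniq// big_ord_recr/= (sum_remove uA cA) /stick_breaking !exprMn exprD.
by ring.
Qed.

Lemma stick_sum_ge0 z l L A : (forall i, 0 <= z i <= 1) -> 0 <= stick_sum z l L A.
Proof.
move=> z01; elim: L l A => [|L IH] l A /=; first by rewrite ler0n.
have /andP[z0 z1] := z01 l.
rewrite addr_ge0 ?mulr_ge0 ?exprn_ge0 ?subr_ge0// sumr_ge0// => c _.
by rewrite !mulr_ge0 ?exprn_ge0 ?subr_ge0.
Qed.

End injection_sum.

(** * Expected injection sums and the partition probability function *)

Section stick_moments.
Context (R : realType) (I : eqType) (N : I -> nat).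
Variable m : nat -> nat -> nat -> R.
Implicit Types (A : seq I) (l L : nat).

Local Notation total A := (\sum_(i <- A) N i)%N.
Local Notation remove A c := [seq i <- A | i != c].

(* The expectation of [stick_sum] when the stick z j has mixed moments m j. *)
Fixpoint expected_stick_sum l L A : R :=
  if L is L'.+1 then
    m l 0 (total A) * expected_stick_sum l.+1 L' A +
    \sum_(c <- A) m l (N c) (total (remove A c)) * expected_stick_sum l.+1 L' (remove A c)
  else (A == [::])%:R.

Variables alpha theta0 : R.
Local Notation theta l := (theta0 + l%:R * alpha).
(** [m l s t] stands for the expectation of [Z ^+ s * (1 - Z) ^+ t], where [Z] is the stick of index
    [l]. The Beta form is required as long as [theta l > 0]; the last four hypotheses hold for any
    stick with values in [0, 1] and control the truncation error. *)
Hypotheses (alpha_lt1 : alpha < 1)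
  (thetaS : forall l, 0 < theta l -> 0 <= theta l.+1)
  (m_rising : forall l s t, 0 < theta l ->
     m l s t = rising (1 - alpha) s * rising (theta l.+1) t / rising (1 + theta l) (s + t))
  (m_ge0 : forall l s t, 0 <= m l s t)
  (m_anti : forall l s t s' t', (s' <= s)%N -> (t' <= t)%N -> m l s t <= m l s' t')
  (m_split : forall l, m l 0 2 + m l 1 1 = m l 0 1)
  (m00 : forall l, m l 0 0 = 1).

Let e_ge0 l L A : 0 <= expected_stick_sum l L A.
Proof.
elim: L l A => [|L IH] l A /=; first by rewrite ler0n.
by rewrite addr_ge0 ?mulr_ge0// sumr_ge0// => c _; rewrite mulr_ge0.
Qed.

Let e_nil l L : expected_stick_sum l L [::] = 1.
Proof. by elim: L l => [//|L IH] l /=; rewrite !big_nil m00 mul1r IH addr0. Qed.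

Let thetaSE l : theta l.+1 = theta l + alpha.
Proof. by rewrite -natr1 mulrDl mul1r addrA. Qed.

(** By [thetaS] the sequence of factors cannot jump below 0 without taking the value 0, and from
    then on the product vanishes. *)
Let factors_ge0 l k : 0 <= theta l ->
  0 <= \prod_(i < k) (theta l + i%:R * alpha) /\
  (\prod_(i < k) (theta l + i%:R * alpha) != 0 -> 0 <= theta l + k%:R * alpha).
Proof.
move=> tl; elim: k => [|k [IH1 IH2]].
  by rewrite big_ord0 mul0r addr0; split.
rewrite big_ord_recr /=; split.
  have [->|/IH2 h] := eqVneq (\prod_(i < k) (theta l + i%:R * alpha)) 0; first by rewrite mul0r.
  exact: mulr_ge0.
rewrite mulf_eq0 negb_or => /andP[/IH2 h n0].
have : 0 < theta (l + k) by rewrite natrD mulrDl addrA lt_neqAle eq_sym n0.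
by move/thetaS; rewrite -addnS natrD mulrDl addrA.
Qed.

Lemma eppf_ge0 l A : 0 <= theta l -> 0 <= eppf alpha (theta l) N A.
Proof.
move=> tl; rewrite /eppf divr_ge0 ?rising_ge0// mulr_ge0//; first by case: (factors_ge0 (size A) tl).
by apply: prodr_ge0 => c _; rewrite rising_ge0// subr_ge0 ltW.
Qed.

Let rising_split (a : R) k k' : rising a (k + k') = rising a k * rising (a + k%:R) k'.
Proof.
rewrite /rising big_split_ord/=; congr (_ * _); apply: eq_bigr => i _.
by rewrite natrD addrA.
Qed.

Let total_ge A : {in A, forall c, (0 < N c)%N} -> (size A <= total A)%N.
Proof.
move=> N0; rewrite -sum1_size big_seq [X in (_ <= X)%N]big_seq.
by apply: leq_sum => c /N0.
Qed.

(** Adding a block multiplies the numerator by at most what it adds to the denominator. The factors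
    are compared one by one, using [alpha < 1], [theta l + alpha >= 0] and that there are at least
    as many balls as blocks. *)
Let eppf_le1 l A : 0 <= theta l -> {in A, forall c, (0 < N c)%N} ->
  eppf alpha (theta l) N A <= 1.
Proof.
move=> tl; elim: A => [|c A IH] N0.
  by rewrite /eppf big_ord0 !big_nil rising0 !mulr1 invr1.
have {}IH : eppf alpha (theta l) N A <= 1 by apply: IH => i iA; apply: N0; rewrite inE iA orbT.
have Nc : (0 < N c)%N by apply: N0; rewrite mem_head.
have NA : {in A, forall c, (0 < N c)%N} by move=> i iA; apply: N0; rewrite inE iA orbT.
have [f0 f1] := factors_ge0 (size A) tl.
move: IH; rewrite /eppf big_ord_recr /= -/(size A) !big_cons addnC rising_split.
set p := \prod_(i < size A) _ in f0 f1 *; set w := \prod_(c <- A) _.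
have [->|pn0] := eqVneq p 0; first by rewrite !mul0r.
have k0 := f1 pn0.
set r := rising (theta l) _ => IH.
have [t0|tn0] := eqVneq (theta l) 0.
  have A0 : size A = 0%N.
    apply/eqP; apply: contraNT pn0; rewrite -lt0n => sA.
    by rewrite /p (bigD1 (Ordinal sA))//= t0 mul0r addr0 mul0r.
  by rewrite t0 A0 mul0r addr0 mulr0 !mul0r.
have tp : 0 < theta l by rewrite lt_neqAle eq_sym tn0.
have ta : 0 <= theta l + alpha by rewrite -thetaSE thetaS.
have w0 : 0 <= w.
  by rewrite /w; apply: prodr_ge0 => i _; apply: rising_ge0; rewrite subr_ge0 ltW.
have rp : 0 < r by exact: rising_gt0.
set b := rising _ (N c); have bp : 0 < b by apply: rising_gt0; rewrite ltr_wpDr.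
suff h : (theta l + (size A)%:R * alpha) * rising (1 - alpha) (N c).-1 <= b.
  rewrite (_ : _ / _ = (p * w / r) * ((theta l + (size A)%:R * alpha) * rising (1 - alpha) (N c).-1 / b)).
    have w1 : 0 <= rising (1 - alpha) (N c).-1 by rewrite rising_ge0// subr_ge0 ltW.
    apply: mulr_ile1 => //.
    - by rewrite divr_ge0 ?mulr_ge0// ltW.
    - by rewrite divr_ge0 ?mulr_ge0// ltW.
    - by rewrite ler_pdivrMr ?mul1r.
  by field; rewrite !gt_eqF.
have tN : (size A)%:R * alpha <= (total A)%:R.
  rewrite (le_trans (y := (size A)%:R))//; first by rewrite ler_piMr// ltW.
  by rewrite ler_nat total_ge.
rewrite /b -{2}(prednK Nc) risingSl ler_pM// ?rising_ge0 ?subr_ge0 ?(ltW alpha_lt1)//.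
  by rewrite lerD2l.
rewrite /rising; apply: ler_prod => i _; apply/andP; split.
  by rewrite addr_ge0// subr_ge0 ltW.
have : 0 <= (total A)%:R :> R by [].
by lra.
Qed.

Let eppf_num (t : R) A := \prod_(i < size A) (t + i%:R * alpha) * \prod_(c <- A) rising (1 - alpha) (N c).-1.

Let rising_eppf (t : R) A : 0 <= t -> {in A, forall c, (0 < N c)%N} ->
  rising t (total A) * eppf alpha t N A = eppf_num t A.
Proof.
rewrite le_eqVlt => /predU1P[<-|t0] N0; last first.
  by rewrite /eppf mulrC divfK// gt_eqF// rising_gt0.
case: A N0 => [|c A] N0.
  by rewrite /eppf /eppf_num big_ord0 !big_nil !rising0 divr1 !mul1r.
rewrite /eppf_num [size _]/= big_ord_recl mul0r addr0 !mul0r rising0n.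
by rewrite big_cons -[N c]prednK ?mul0r// N0// mem_head.
Qed.

(** The first stick is used by no block or by one block [c]. Up to a common factor these cases have
    weights [theta l + size A * alpha] and [N c - alpha], with sum [theta l + \sum N]; this sum is
    absorbed in passing from [rising (1 + theta l)] to [rising (theta l)]. *)
Let eppf_rec l A : uniq A -> A != [::] -> {in A, forall c, (0 < N c)%N} -> 0 < theta l ->
  eppf alpha (theta l) N A = m l 0 (total A) * eppf alpha (theta l.+1) N A +
    \sum_(c <- A) m l (N c) (total (remove A c)) * eppf alpha (theta l.+1) N (remove A c).
Proof.
move=> uA A0 N0 tl; have tS := thetaS tl.
have r1 n : rising (1 + theta l) n != 0.
  by rewrite gt_eqF// rising_gt0// addr_gt0.
pose k := (size A).-1; have sA : size A = k.+1 by rewrite prednK// lt0n size_eq0.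
pose p := \prod_(i < k) (theta l.+1 + i%:R * alpha).
pose w := \prod_(c <- A) rising (1 - alpha) (N c).-1.
have -> : m l 0 (total A) * eppf alpha (theta l.+1) N A =
    p * w * (theta l + k.+1%:R * alpha) / rising (1 + theta l) (total A).
  rewrite m_rising// rising0 mul1r add0n mulrAC rising_eppf// /eppf_num sA big_ord_recr/=.
  by rewrite -/p -/w thetaSE -natr1; congr (_ / _); ring.
rewrite (eq_big_seq (fun c => p * w / rising (1 + theta l) (total A) * ((N c)%:R - alpha))); last first.
  move=> c cA; rewrite m_rising// -sum_remove// -!mulrA.
  rewrite [X in _ * X]mulrCA rising_eppf//; last by move=> i; rewrite mem_filter => /andP[_ /N0].
  have sc : size (remove A c) = k.
    by rewrite -rem_filter// size_rem// sA.
  rewrite /eppf_num sc -/p /w [in RHS](bigD1_seq c)//= big_filter.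
  by rewrite -{1}(prednK (N0 _ cA)) risingS -[in RHS](prednK (N0 _ cA)) -natr1; ring.
rewrite -mulr_sumr big_split/= -natr_sum sumrN big_const_seq count_predT iter_addr_0 sA.
rewrite /eppf sA big_ord_recl mul0r addr0 -/w.
have -> : \prod_(i < k) (theta l + (lift ord0 i)%:R * alpha) = p.
  by apply: eq_bigr => i _; rewrite thetaSE -[(lift _ _)%:R]natr1 mulrDl mul1r; ring.
have tN : rising (theta l) (total A) != 0 by rewrite gt_eqF// rising_gt0.
have e : rising (theta l) (total A) * (theta l + (total A)%:R) = theta l * rising (1 + theta l) (total A).
  by rewrite -risingS risingSl [theta l + 1]addrC.
rewrite -[alpha *+ _]mulr_natl.
apply: (mulIf tN); rewrite divfK//.
transitivity (p * w * ((theta l + (total A)%:R) * rising (theta l) (total A)) / rising (1 + theta l) (total A)).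
  by rewrite mulrC [X in _ * X / _]mulrC e; field.
by field.
Qed.

(** The constants are dictated by the induction: 0 for the empty family, which is summed exactly; at
    least 1 otherwise, to cover [L = 0]; and [bound k = k * bound k.-1] for [k > 1]. *)
Let bound k : R := if k == 0%N then 0 else k`!%:R.

(** By [eppf_rec] both sides obey the same recursion, so that only the errors have to be propagated.
    In the application the product of the [m j 0 1] is the expected mass left after [L] sticks. *)
Lemma expected_stick_sum_ge l L A : 0 <= theta l -> uniq A -> {in A, forall c, (0 < N c)%N} ->
  eppf alpha (theta l) N A <=
  expected_stick_sum l L A + bound (size A) * \prod_(j <- iota l L) m j 0 1.
Proof.
have r0 l' L' : 0 <= \prod_(j <- iota l' L') m j 0 1 by apply: prodr_ge0.
have b0 k : 0 <= bound k by rewrite /bound; case: ifP.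
elim: L l A => [|L IH] l A tl uA N0.
  rewrite big_nil mulr1 /=; have [->|A0] := eqVneq A [::].
    by rewrite /eppf big_ord0 !big_nil rising0 divr1 mulr1 /bound /= addr0.
  rewrite add0r (le_trans (eppf_le1 tl N0))// /bound size_eq0 (negbTE A0).
  by rewrite ler1n fact_gt0.
have [->|A0] := eqVneq A [::].
  by rewrite /eppf big_ord0 !big_nil rising0 divr1 mulr1 e_nil /bound mul0r addr0.
(* At [theta l = 0] with [A] nonempty the left side vanishes, since [theta l] is its first
   factor. *)
have [t0|tn0] := eqVneq (theta l) 0.
  rewrite {1}/eppf; case: (A) A0 => // c A' _; rewrite big_ord_recl t0 mul0r addr0 !mul0r.
  by rewrite addr_ge0// mulr_ge0.
have tp : 0 < theta l by rewrite lt_neqAle eq_sym tn0.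
have tS := thetaS tp.
rewrite eppf_rec//= big_cons; set r := \prod_(j <- _) _.
have rr : 0 <= r by exact: r0.
have IHA := IH _ _ tS uA N0.
have IHc c : c \in A -> eppf alpha (theta l.+1) N (remove A c) <=
    expected_stick_sum l.+1 L (remove A c) + bound (size A).-1 * r.
  move=> cA; rewrite -(size_rem cA) -rem_filter//.
  have := IH l.+1 (remove A c) tS (filter_uniq _ uA); rewrite -rem_filter//; apply.
  by move=> i /mem_rem /N0.
apply: (@le_trans _ _ (m l 0 (total A) * (expected_stick_sum l.+1 L A + bound (size A) * r) +
   \sum_(c <- A) m l (N c) (total (remove A c)) *
     (expected_stick_sum l.+1 L (remove A c) + bound (size A).-1 * r))).
  rewrite lerD ?ler_wpM2l// big_seq [leRHS]big_seq ler_sum// => c cA.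
  by rewrite ler_wpM2l// IHc.
under [X in _ + X <= _]eq_bigr do rewrite mulrDr.
rewrite big_split/= mulrDr addrACA lerD2l.
have Nc0 c : c \in A -> (0 < N c)%N by move/N0.
have totA := total_ge N0.
(* A single block is treated apart: removing it leaves no error, and one factor [1 - Z] is all that
   its moment provides for certain. *)
have [A1|A1] := eqVneq (size A) 1%N.
  rewrite A1 /bound /= [X in _ + X]big1 ?addr0; last by move=> c _; rewrite mul0r mulr0.
  rewrite mulrCA ler_wpM2l// ler_wpM2r//; apply: m_anti => //.
  by rewrite (leq_trans _ totA)// A1.
have A2 : (1 < size A)%N by rewrite ltn_neqAle eq_sym A1 lt0n size_eq0.
have -> : bound (size A) = (size A)%:R * bound (size A).-1.
  rewrite /bound; case: (size A) A2 => [//|[//|k]] _ /=.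
  by rewrite -natrM factS.
(* With two blocks or more there are two balls at least, so the moments are at most [m l 0 2] or
   [m l 1 1]; these add up to [m l 0 1], the next factor of the residual mass. *)
apply: (@le_trans _ _ (m l 0 2 * ((size A)%:R * bound (size A).-1 * r) +
    \sum_(c <- A) m l 1 1 * (bound (size A).-1 * r))).
  rewrite lerD ?ler_wpM2r ?mulr_ge0 ?m_anti//; first exact: leq_trans totA.
  rewrite big_seq [leRHS]big_seq ler_sum// => c cA.
  rewrite ler_wpM2r ?mulr_ge0// m_anti ?Nc0//.
  apply: leq_trans (total_ge _); last by move=> i; rewrite mem_filter => /andP[_ /N0].
  by rewrite -rem_filter// size_rem//; case: (size A) A2 => [//|[]].
rewrite big_const_seq count_predT iter_addr_0 -mulr_natl -m_split.
by rewrite le_eqVlt; apply/orP; left; apply/eqP; ring.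
Qed.

End stick_moments.

Section residual.
Context (R : realType) (m : nat -> nat -> nat -> R) (alpha theta0 : R).
Local Notation theta l := (theta0 + l%:R * alpha).
Hypotheses (alpha_lt1 : alpha < 1) (theta0_gt0 : 0 < theta0)
  (thetaS : forall l, 0 < theta l -> 0 <= theta l.+1)
  (m_rising : forall l s t, 0 < theta l ->
     m l s t = rising (1 - alpha) s * rising (theta l.+1) t / rising (1 + theta l) (s + t)).

(* Either some stick is 1 almost surely, or the residual masses decay like
   exp (- c (1 + 1/2 + ... + 1/L)). *)
Lemma stick_residual_small (eps : R) : 0 < eps ->
  exists L, \prod_(j <- iota 0 L) m j 0 1 <= eps.
Proof.
move=> eps0.
have m01 j : 0 < theta j -> m j 0 1 = theta j.+1 / (1 + theta j).
  move=> tj; rewrite m_rising// rising0 mul1r add0n.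
  by rewrite !risingS !rising0 !mul1r !addr0.
have [[j tj tj1]|H] := pselect (exists2 j, 0 < theta j & theta j.+1 = 0).
  exists j.+1; rewrite (_ : \prod_(_ <- _) _ = 0) ?ltW//.
  by rewrite (bigD1_seq j) ?mem_iota ?iota_uniq//= m01// tj1 mul0r mul0r.
have tp j : 0 < theta j.
  elim: j => [|j IH]; first by rewrite mul0r addr0.
  rewrite lt_neqAle thetaS// andbT; apply/eqP => e.
  by apply: H; exists j.
(* The mean stick [(1 - alpha) / (1 + theta j)] is at least [c / j.+1], because
   [1 + theta j <= j.+1 * (1 + theta0)]. *)
pose c := (1 - alpha) / (1 + theta0).
have t1 : 0 < 1 + theta0 by rewrite addr_gt0.
have c0 : 0 < c by rewrite divr_gt0 ?subr_gt0.
have mle j : m j 0 1 <= expR (- (c * j.+1%:R^-1)).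
  apply: le_trans (expR_ge1Dx _).
  have tj1 : 0 < 1 + theta j by rewrite addr_gt0.
  rewrite m01// (_ : theta j.+1 = 1 + theta j - (1 - alpha)); last by rewrite -natr1; ring.
  rewrite mulrBl divff ?gt_eqF// lerD2l lerN2 /c -mulrA -invfM ler_wpM2l//.
    by rewrite subr_ge0 ltW.
  rewrite lef_pV2 ?posrE ?mulr_gt0// -natr1.
  have : j%:R * alpha <= j%:R * (1 + theta0).
    by rewrite ler_wpM2l// (le_trans (ltW alpha_lt1))// lerDl ltW.
  by lra.
have nd : nondecreasing_seq (series (@harmonic R)).
  by apply: nondecreasing_series => n _ _; rewrite /harmonic invr_ge0.
have := nondecreasing_dvgn_lt nd (@dvg_harmonic R).
move=> /cvgryPge /(_ (- ln eps / c)) [L _ /(_ L (leqnn L)) /= HL].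
exists L; apply: (@le_trans _ _ (expR (- (c * series (@harmonic R) L)))).
  rewrite /series /= mulr_sumr -sumrN expR_sum [leRHS]big_mkord.
  rewrite (_ : iota 0 L = index_iota 0 L) ?big_mkord; last by rewrite /index_iota subn0.
  apply: ler_prod => j _; rewrite mle andbT m01// divr_ge0//; apply: ltW => //.
  by rewrite addr_gt0.
rewrite -ler_ln ?posrE ?expR_gt0// expRK lerNl.
by rewrite mulrC -ler_pdivrMr.
Qed.

End residual.

(** * Moments of independent sticks *)

Lemma probability_integral_fineK (R : realType) d (T : measurableType d) (P : probability T R)
    (f : T -> R) : measurable_fun setT f -> (forall x, 0 <= f x <= 1) ->
  (\int[P]_x (f x)%:E = (fine (\int[P]_x (f x)%:E))%:E)%E.
Proof.
move=> mf f01; rewrite fineK// ge0_fin_numE; last first.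
  by apply: integral_ge0 => x _; rewrite lee_fin; have /andP[] := f01 x.
apply: (@le_lt_trans _ _ (\int[P]_x (cst 1%E x))%E); last first.
  rewrite integral_cst// mul1e.
  exact: le_lt_trans (probability_le1 P measurableT) (ltry 1).
apply: ge0_le_integral => //.
- by move=> x _; rewrite lee_fin; have /andP[] := f01 x.
- exact/measurable_EFinP.
- by move=> x _; rewrite lee_fin; have /andP[] := f01 x.
Qed.

Section expectation.
Context (R : realType) d (T : measurableType d) (P : probability T R).
Variable zeta : nat -> T -> R.
Hypotheses (mzeta : forall j, measurable_fun setT (zeta j))
  (zeta01 : forall j x, 0 <= zeta j x <= 1)
  (ind_zeta : mutually_independent (@measurable _ R) P zeta).

Let g j (p : nat * nat) x := zeta j x ^+ p.1 * (1 - zeta j x) ^+ p.2.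

Let g01 j p x : 0 <= g j p x <= 1.
Proof.
have /andP[z0 z1] := zeta01 j x; rewrite /g mulr_ge0 ?exprn_ge0 ?subr_ge0//=.
by rewrite mulr_ile1 ?exprn_ge0 ?subr_ge0// exprn_ile1 ?subr_ge0// gerBl.
Qed.

Let mg j p : measurable_fun setT (g j p).
Proof.
apply: measurable_funM; apply: measurable_funX => //.
by apply: measurable_funB => //; exact: measurable_cst.
Qed.

Definition stick_moment j s t : R := fine (\int[P]_x (zeta j x ^+ s * (1 - zeta j x) ^+ t)%:E)%E.

Let momentE j p : (\int[P]_x (g j p x)%:E = (stick_moment j p.1 p.2)%:E)%E.
Proof. exact: probability_integral_fineK. Qed.

Lemma stick_moment_ge0 j s t : 0 <= stick_moment j s t.
Proof.
apply: fine_ge0; apply: integral_ge0 => x _; rewrite lee_fin.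
by have /andP[] := g01 j (s, t) x.
Qed.

Lemma stick_moment_anti j s t s' t' : (s' <= s)%N -> (t' <= t)%N ->
  stick_moment j s t <= stick_moment j s' t'.
Proof.
move=> ss tt; rewrite -lee_fin -(momentE j (s, t)) -(momentE j (s', t')).
apply: ge0_le_integral => //.
- by move=> x _; rewrite lee_fin; have /andP[] := g01 j (s, t) x.
- exact/measurable_EFinP.
- exact/measurable_EFinP.
- move=> x _; rewrite lee_fin /g /=; have /andP[z0 z1] := zeta01 j x.
  by rewrite ler_pM ?exprn_ge0 ?subr_ge0// ler_wiXn2l ?subr_ge0 ?gerBl.
Qed.

Lemma stick_moment00 j : stick_moment j 0 0 = 1.
Proof.
rewrite /stick_moment (eq_integral (cst 1%E)); last by move=> x _; rewrite mul1r.
rewrite integral_cst// mul1e; exact: (congr1 fine (probability_setT P)).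
Qed.

Lemma stick_moment_split j : stick_moment j 0 2 + stick_moment j 1 1 = stick_moment j 0 1.
Proof.
apply: EFin_inj; rewrite EFinD -(momentE j (0, 2)%N) -(momentE j (1, 1)%N) -(momentE j (0, 1)%N).
rewrite -ge0_integralD//.
- by apply: eq_integral => x _; rewrite -EFinD /g /=; congr EFin; ring.
- by move=> x _; rewrite lee_fin; have /andP[] := g01 j (0, 2)%N x.
- exact/measurable_EFinP.
- by move=> x _; rewrite lee_fin; have /andP[] := g01 j (1, 1)%N x.
- exact/measurable_EFinP.
Qed.

Context (I : eqType) (N : I -> nat).
Implicit Types (A : seq I).

Let measurable_stick_sum l L A : measurable_fun setT (fun x => stick_sum N (zeta^~ x) l L A).
Proof.
elim: L l A => [|L IH] l A /=; first exact: measurable_cst.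
apply: measurable_funD; first apply: measurable_funM => //.
  by apply: measurable_funX; apply: measurable_funB => //; exact: measurable_cst.
apply: measurable_sum => c; apply: measurable_funM => //; apply: measurable_funM.
  exact: measurable_funX.
by apply: measurable_funX; apply: measurable_funB => //; exact: measurable_cst.
Qed.

Let past l (st : nat -> nat * nat) x := \prod_(j <- iota 0 l) g j (st j) x.

Let past_ge0 l st x : 0 <= past l st x.
Proof. by apply: prodr_ge0 => j _; have /andP[] := g01 j (st j) x. Qed.

Let measurable_past l st : measurable_fun setT (past l st).
Proof. exact: measurable_prod. Qed.

Let upd (st : nat -> nat * nat) l p := fun j => if j == l then p else st j.

Let big_upd (F : nat -> nat * nat -> R) l st p :
  \prod_(j <- iota 0 l.+1) F j (upd st l p j) = (\prod_(j <- iota 0 l) F j (st j)) * F l p.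
Proof.
rewrite -addn1 iotaD big_cat big_seq1 /upd add0n eqxx; congr (_ * _).
rewrite big_seq [RHS]big_seq; apply: eq_bigr => j; rewrite mem_iota => /= jl.
by rewrite ltn_eqF.
Qed.

Let integral_past l st : (\int[P]_x (past l st x)%:E =
  (\prod_(j <- iota 0 l) stick_moment j (st j).1 (st j).2)%:E)%E.
Proof.
have ind := mutually_independent_comp (S' := R) (h := fun j z => z ^+ (st j).1 * (1 - z) ^+ (st j).2) _ ind_zeta.
have {}ind := ind _.
transitivity (\int[P]_x \prod_(j <- iota 0 l) (g j (st j) x)%:E)%E.
  by apply: eq_integral => x _; rewrite prodEFin.
rewrite (@independent_integral_prod _ _ _ _ P (fun j => g j (st j)))//; last 3 first.
- apply: ind => j B mB; rewrite -[X in measurable X]setTI.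
  suff : measurable_fun setT (fun z : R => z ^+ (st j).1 * (1 - z) ^+ (st j).2) by exact.
  apply: measurable_funM; apply: measurable_funX; first exact: measurable_id.
  by apply: measurable_funB; [exact: measurable_cst|exact: measurable_id].
- by move=> j x; have /andP[] := g01 j (st j) x.
- exact: iota_uniq.
by rewrite -prodEFin; apply: eq_bigr => j _; exact: momentE.
Qed.

(** Carrying along one factor for each stick already passed turns the expanded sum into integrals of
    products over distinct sticks; independence is then invoked only at [L = 0]. *)
Let integral_past_stick_sum l L A st :
  (\int[P]_x (past l st x * stick_sum N (zeta^~ x) l L A)%:E =
   (\prod_(j <- iota 0 l) stick_moment j (st j).1 (st j).2
      * expected_stick_sum N stick_moment l L A)%:E)%E.
Proof.
have tau0 x l' L' A' : 0 <= stick_sum N (zeta^~ x) l' L' A' by exact: stick_sum_ge0.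
elim: L l A st => [|L IH] l A st /=.
  under eq_integral do rewrite EFinM.
  rewrite ge0_integralZr ?integral_past//.
  - exact/measurable_EFinP.
  - by move=> x _; rewrite lee_fin.
pose p0 := (0%N, \sum_(i <- A) N i)%N.
pose pc c := (N c, \sum_(i <- [seq i <- A | i != c]) N i)%N.
pose F p A' x := past l.+1 (upd st l p) x * stick_sum N (zeta^~ x) l.+1 L A'.
have F0 p A' x : 0 <= F p A' x by rewrite mulr_ge0.
have mF p A' : measurable_fun setT (fun x => (F p A' x)%:E).
  by apply/measurable_EFinP; exact: measurable_funM.
transitivity (\int[P]_x ((F p0 A x)%:E + \sum_(c <- A) (F (pc c) [seq i <- A | i != c] x)%:E))%E.
  apply: eq_integral => x _; rewrite sumEFin -EFinD; congr EFin.
  rewrite mulrDr mulr_sumr /F /past (big_upd (fun j p => g j p x)) [g l p0 x]/g /= mul1r mulrA; congr (_ + _).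
  by apply: eq_bigr => c _; rewrite (big_upd (fun j p => g j p x)) [g l (pc c) x]/g /= !mulrA.
rewrite ge0_integralD//; last 3 first.
- by move=> x _; rewrite lee_fin.
- by move=> x _; rewrite sume_ge0// => c _; rewrite lee_fin.
- exact: emeasurable_sum.
rewrite ge0_integral_sum//; last by move=> c x _; rewrite lee_fin.
rewrite IH mulrDr EFinD (big_upd (fun j p => stick_moment j p.1 p.2)) /= !mulrA; congr (_ + _)%E.
rewrite mulr_sumr -sumEFin; apply: eq_bigr => c _.
by rewrite IH (big_upd (fun j p => stick_moment j p.1 p.2)) /= !mulrA.
Qed.

Lemma integral_stick_sum L A :
  (\int[P]_x (stick_sum N (zeta^~ x) 0 L A)%:E =
   (expected_stick_sum N stick_moment 0 L A)%:E)%E.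
Proof.
have := integral_past_stick_sum 0 L A (fun=> (0, 0)%N); rewrite big_nil mul1r => <-.
by apply: eq_integral => x _; rewrite /past big_nil mul1r.
Qed.

End expectation.

(** * Laws of real sequences *)

Definition real_seq_gen (R : realType) : set (set (nat -> R)) :=
  [set E | exists i, exists2 B, @measurable _ R B & E = [set x | B (x i)]].

Section real_sequences.
Context (R : realType).
Local Notation seqR := (g_sigma_algebraType (@real_seq_gen R)).

Lemma measurable_coord i : measurable_fun setT (fun x : seqR => x i : R).
Proof. by move=> _ B mB; rewrite setTI; apply: sub_sigma_algebra; exists i, B. Qed.

Lemma measurable_to_seq d (T : measurableType d) (X : T -> nat -> R) :
  (forall i, measurable_fun setT (X^~ i)) -> measurable_fun setT (X : T -> seqR).
Proof.
move=> mX; apply: (@measurability _ _ T seqR setT X (@real_seq_gen R)) => //.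
move=> _ [_ [i [B mB ->]] <-]; rewrite -[X in measurable (_ `&` X)]/(X^~ i @^-1` B).
exact: mX.
Qed.

Lemma same_law_integral d (T : measurableType d) (P : probability T R) (X : T -> nat -> R)
    d' (T' : measurableType d') (P' : probability T' R) (X' : T' -> nat -> R)
    (f : seqR -> R) :
  same_law (@real_seq_sigma R) P X P' X' ->
  (forall i, measurable_fun setT (X^~ i)) -> (forall i, measurable_fun setT (X'^~ i)) ->
  measurable_fun setT f -> (forall x, 0 <= f x) ->
  (\int[P]_x (f (X x))%:E = \int[P']_x (f (X' x))%:E)%E.
Proof.
move=> XX' mX mX' mf f0.
have mX1 := measurable_to_seq mX; have mX1' := measurable_to_seq mX'.
transitivity (\int[P]_x ((f (X x))%:E * cst 1 x))%E.
  by apply: eq_integral => x _; rewrite mule1.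
transitivity (\int[P']_x ((f (X' x))%:E * cst 1 x))%E; last first.
  by apply: eq_integral => x _; rewrite mule1.
apply: (@ge0_integral_transfer _ _ _ _ _ seqR R P P' X X' (cst 1%E) (cst 1%E) (EFin \o f)) => //.
- exact/measurable_EFinP.
- move=> B mB; rewrite !integral_cst; last 2 first.
  + by rewrite -[X in measurable X]setTI; exact: mX1'.
  + by rewrite -[X in measurable X]setTI; exact: mX1.
  by rewrite !mul1e; exact: XX'.
Qed.

Variables (I : eqType) (N : I -> nat).

Definition clipped_injection_sum (x : nat -> R) A L :=
  injection_sum N (fun i => clip (x i)) A (iota 0 L).

Lemma measurable_injection_sum d (T : measurableType d) (X : T -> nat -> R) A ls :
  (forall i, measurable_fun setT (X^~ i)) ->
  measurable_fun setT (fun x => injection_sum N (X x) A ls).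
Proof.
move=> mX; elim: ls A => [|l ls IH] A /=; first exact: measurable_cst.
apply: measurable_funD => //; apply: measurable_sum => c.
by apply: measurable_funM => //; exact: measurable_funX.
Qed.

Lemma measurable_clipped_injection_sum d (T : measurableType d) (X : T -> nat -> R) A L :
  (forall i, measurable_fun setT (X^~ i)) ->
  measurable_fun setT (fun x => clipped_injection_sum (X x) A L).
Proof.
move=> mX; apply: (@measurable_injection_sum _ _ (fun x i => clip (X x i))) => i.
by apply: measurableT_comp => //; exact: measurable_clip.
Qed.

Lemma clipped_injection_sum_ge0 x A L : 0 <= clipped_injection_sum x A L.
Proof. by apply: injection_sum_ge0 => i; exact: clip_ge0. Qed.

Lemma same_law_clipped_injection_sum d (T : measurableType d) (P : probability T R) (X : T -> nat -> R)
    d' (T' : measurableType d') (P' : probability T' R) (X' : T' -> nat -> R) A L :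
  same_law (@real_seq_sigma R) P X P' X' ->
  (forall i, measurable_fun setT (X^~ i)) -> (forall i, measurable_fun setT (X'^~ i)) ->
  (\int[P]_x (clipped_injection_sum (X x) A L)%:E =
   \int[P']_x (clipped_injection_sum (X' x) A L)%:E)%E.
Proof.
move=> XX' mX mX'; apply: (same_law_integral (f := fun x => clipped_injection_sum x A L)) => //.
- by apply: (@measurable_clipped_injection_sum _ seqR (fun x => x)) => i; exact: measurable_coord.
- by move=> x; exact: clipped_injection_sum_ge0.
Qed.

End real_sequences.

(** * GEM and Poisson-Dirichlet vectors *)

Section GEM.
Context (R : realType) (alpha theta0 : R).
Local Notation theta l := (theta0 + l%:R * alpha).
Hypotheses (alpha_lt1 : alpha < 1) (theta0_gt0 : 0 < theta0)
  (thetaS : forall l, 0 < theta l -> 0 <= theta l.+1).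

(** The parameters cannot become negative without passing through 0, where the stick is 1 almost
    surely. *)
Let invalid_after_one j : theta j.+1 < 0 -> exists2 i, (i < j)%N & theta i.+1 = 0.
Proof.
elim: j => [|j IH] tj.
  suff : 0 <= theta 1 by rewrite leNgt tj.
  by apply: thetaS; rewrite mul0r addr0.
have [tj1|tj1|tj1] := ltgtP (theta j.+1) 0.
- by have [i ij ti] := IH tj1; exists i => //; exact: leqW.
- by have := thetaS tj1; rewrite leNgt tj.
- by exists j.
Qed.

Context d (T : measurableType d) (P : probability T R) (Z : nat -> {RV P >-> R}).
Hypotheses
  (indZ : mutually_independent (@measurable _ R) P (fun j => Z j : T -> R))
  (lawZ : forall j, 0 <= theta j.+1 -> forall B, measurable B ->
     distribution P (Z j) B = beta_law (1 - alpha) (theta j.+1) B).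

(** A stick with negative parameter has an unspecified law; the constant 1 puts it into [0, 1] and
    preserves independence. An earlier stick is then 1 almost surely, so the pieces of the broken
    stick do not change. *)
Let h j (z : R) : R := if 0 <= theta j.+1 then clip z else 1.
Let zeta j x : R := h j (Z j x).

Let mh j : measurable_fun setT (h j).
Proof. by rewrite /h; case: (0 <= theta j.+1); [exact: measurable_clip|exact: measurable_cst]. Qed.

Let mzeta j : measurable_fun setT (zeta j).
Proof. exact: measurableT_comp. Qed.

Let zeta01 j x : 0 <= zeta j x <= 1.
Proof. by rewrite /zeta /h; case: ifP => _; rewrite ?clip_ge0 ?clip_le1// ler01 lexx. Qed.

Let ind_zeta : mutually_independent (@measurable _ R) P zeta.
Proof.
apply: (mutually_independent_comp (h := h) _ indZ) => j B mB.
by rewrite -[X in measurable X]setTI; exact: mh.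
Qed.

Let alpha1 : 1 - alpha != 0. Proof. by rewrite gt_eqF// subr_gt0. Qed.

Let Z_clip j : 0 <= theta j.+1 -> \forall x \ae P, clip (Z j x) = Z j x.
Proof.
move=> tj; pose B : set R := ~` `[0%R, 1%R].
have mB : measurable B by apply: measurableC; exact: measurable_itv.
have mZB : measurable (Z j @^-1` B) by rewrite -[X in measurable X]setTI; exact: measurable_funP.
exists (Z j @^-1` B); split => //.
  have := lawZ tj mB; rewrite /distribution /pushforward => ->.
  rewrite /beta_law (negbTE alpha1); case: ifP => _.
    by rewrite diracE memNset// /B /= in_itv /= ler01 lexx.
  by rewrite /B setICl Rintegral_set0 mul0r.
by move=> x /= H Zx; apply: H; apply: clip_id; move: Zx; rewrite /= in_itv.
Qed.

Let Z_one j : theta j.+1 = 0 -> \forall x \ae P, Z j x = 1.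
Proof.
move=> tj; pose B : set R := ~` [set 1].
have mB : measurable B by apply: measurableC; exact: measurable_set1.
have mZB : measurable (Z j @^-1` B) by rewrite -[X in measurable X]setTI; exact: measurable_funP.
have tj0 : 0 <= theta j.+1 by rewrite tj.
exists (Z j @^-1` B); split => //.
have := lawZ tj0 mB; rewrite /distribution /pushforward => ->.
by rewrite /beta_law (negbTE alpha1) tj eqxx diracE memNset// /B /=; apply.
Qed.

Let stick_breaking_clip : \forall x \ae P, forall i,
  stick_breaking (Z^~ x) i = stick_breaking (zeta^~ x) i.
Proof.
have H : \forall x \ae P, forall j, (0 <= theta j.+1 -> clip (Z j x) = Z j x) /\ (theta j.+1 = 0 -> Z j x = 1).
  apply: ae_foralln => j; apply: filterI.
    by have [/Z_clip|_] := leP 0 (theta j.+1); [apply: filterS|apply: aeW].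
  by have [/Z_one|/eqP] := eqVneq (theta j.+1) 0; [apply: filterS|move=> ?; apply: aeW].
apply: filterS H => x H i.
(* If some parameter up to [i] is negative, a stick before [i] is 1 and both residual products are
   0; otherwise the sticks agree one by one. *)
have [tneg|ok] := pselect (exists2 j, (j <= i)%N & theta j.+1 < 0).
  have {tneg} [j ji /invalid_after_one[k kj tk]] := tneg.
  have ki : (k < i)%N by exact: leq_trans ji.
  have zk : zeta k x = 1.
    have [+ Zk] := H k; rewrite tk lexx => /(_ isT) cZ.
    by rewrite /zeta /h tk lexx cZ Zk.
  have Zk : Z k x = 1 by have [_ ->] := H k.
  rewrite /stick_breaking (bigD1 (Ordinal ki))//= [in RHS](bigD1 (Ordinal ki))//=.
  by rewrite Zk zk subrr !mul0r !mulr0.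
have E j : (j <= i)%N -> zeta j x = Z j x.
  move=> ji; rewrite /zeta /h; case: leP => [/(H j).1//|tj].
  by case: ok; exists j.
by rewrite /stick_breaking E//; congr (_ * _); apply: eq_bigr => j _; rewrite E// ltnW.
Qed.

Let stick_breaking01 (z : nat -> R) i : (forall j, 0 <= z j <= 1) -> 0 <= stick_breaking z i <= 1.
Proof.
move=> z01; have p01 : 0 <= \prod_(j < i) (1 - z j) <= 1.
  have f01 j : 0 <= 1 - z j <= 1 by have /andP[? ?] := z01 j; rewrite subr_ge0 gerBl; apply/andP.
  apply/andP; split; first by apply: prodr_ge0 => j _; have /andP[] := f01 j.
  by apply: prodr_ile1 => j _; exact: f01.
have /andP[? ?] := z01 i; have /andP[? ?] := p01.
by rewrite /stick_breaking mulr_ge0//= mulr_ile1.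
Qed.

Lemma stick_breaking_injection_sum_ge (I : eqType) (N : I -> nat) (A : seq I) (eps : R) :
  uniq A -> {in A, forall c, (0 < N c)%N} -> 0 < eps ->
  exists L, ((eppf alpha theta0 N A - eps)%:E <=
    \int[P]_x (clipped_injection_sum N (stick_breaking (Z^~ x)) A L)%:E)%E.
Proof.
move=> uA N0 eps0; pose m := stick_moment P zeta.
have m_rising l s t : 0 < theta l ->
    m l s t = rising (1 - alpha) s * rising (theta l.+1) t / rising (1 + theta l) (s + t).
  move=> tl; have tl1 := thetaS tl; rewrite /m /stick_moment /zeta /h tl1.
  rewrite (beta_law_moment _ _ _ tl1 (lawZ tl1)) ?subr_gt0//=.
  by rewrite -natr1; congr (_ / rising _ _); ring.
pose b : R := if size A == 0%N then 0 else (size A)`!%:R.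
have b0 : 0 <= b by rewrite /b; case: ifP.
(* The truncation error is at most [b] times the residual mass, hence at most [eps]; adding 1 allows
   for [b = 0]. *)
have [L HL] : exists L, \prod_(j <- iota 0 L) m j 0 1 <= eps / (1 + b).
  by apply: (stick_residual_small alpha_lt1 theta0_gt0 thetaS m_rising); rewrite divr_gt0// ltr_pwDl.
exists L; have -> : (\int[P]_x (clipped_injection_sum N (stick_breaking (Z^~ x)) A L)%:E =
    (expected_stick_sum N m 0 L A)%:E)%E.
  rewrite -integral_stick_sum//.
  have msb (W : nat -> T -> R) : (forall j, measurable_fun setT (W j)) ->
      forall i, measurable_fun setT (fun x => stick_breaking (W^~ x) i).
    move=> mW i; apply: measurable_funM => //; apply: measurable_prod => j _.
    by apply: measurable_funB => //; exact: measurable_cst.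
  apply: ge0_ae_eq_integral => //.
  - apply/measurable_EFinP.
    apply: (@measurable_clipped_injection_sum R I N _ _ (fun x => stick_breaking (Z^~ x))).
    by apply: msb => j; exact: measurable_funPT.
  - apply/measurable_EFinP.
    have -> : (fun x => stick_sum N (zeta^~ x) 0 L A) =
       (fun x => injection_sum N (stick_breaking (zeta^~ x)) A (iota 0 L)).
      by apply/funext => x; rewrite injection_sum_stick_breaking// big_ord0 expr1n mul1r.
    apply: (@measurable_injection_sum R I N _ _ (fun x => stick_breaking (zeta^~ x))).
    exact: msb.
  - by move=> x _; rewrite lee_fin clipped_injection_sum_ge0.
  - by move=> x _; rewrite lee_fin stick_sum_ge0.
  apply: filterS stick_breaking_clip => x E _; congr EFin.
  have -> : stick_sum N (zeta^~ x) 0 L A =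
      injection_sum N (stick_breaking (zeta^~ x)) A (iota 0 L).
    by rewrite injection_sum_stick_breaking// big_ord0 expr1n mul1r.
  by apply: eq_injection_sum => i _; rewrite E clip_id// stick_breaking01.
rewrite lee_fin lerBlDr.
have t00 : 0 <= theta 0 by rewrite mul0r addr0 ltW.
have := expected_stick_sum_ge alpha_lt1 thetaS m_rising
  (@stick_moment_ge0 _ _ _ P _ zeta01) (@stick_moment_anti _ _ _ P _ mzeta zeta01)
  (stick_moment_split P mzeta zeta01) (stick_moment00 P zeta) L t00 uA N0.
rewrite mul0r addr0 => /le_trans; apply; rewrite lerD2l -/b.
apply: le_trans (ler_wpM2l b0 HL) _.
rewrite mulrCA -[leRHS]mulr1 ler_wpM2l ?(ltW eps0)// ler_pdivrMr ?ltr_pwDl// mul1r.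
by rewrite lerDr.
Qed.

End GEM.

Section GEM_PD.
Context (R : realType) (alpha theta0 : R).
Local Notation theta l := (theta0 + l%:R * alpha).
Hypotheses (alpha_lt1 : alpha < 1) (theta0_gt0 : 0 < theta0)
  (thetaS : forall l, 0 < theta l -> 0 <= theta l.+1).
Context (I : eqType) (N : I -> nat) (A : seq I).
Hypotheses (uA : uniq A) (N0 : {in A, forall c, (0 < N c)%N}).

Lemma GEM_injection_sum_ge d (T : measurableType d) (P : probability T R)
    (X : nat -> {RV P >-> R}) (eps : R) : is_GEM alpha theta0 X -> 0 < eps ->
  exists L, ((eppf alpha theta0 N A - eps)%:E <=
    \int[P]_x (clipped_injection_sum N (X^~ x) A L)%:E)%E.
Proof.
move=> [d' [T' [P' [Z [indZ lawZ XZ]]]]] eps0.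
have [L HL] := stick_breaking_injection_sum_ge alpha_lt1 theta0_gt0 thetaS indZ lawZ uA N0 eps0.
exists L; rewrite (same_law_clipped_injection_sum N A L XZ)//.
move=> i; apply: measurable_funM => //; apply: measurable_prod => j _.
by apply: measurable_funB => //; exact: measurable_cst.
Qed.

(** The first [L] coordinates of [x] occupy finitely many places of [y], and the terms with other
    labels are nonnegative. An equality for fixed [L] is not to be expected, because the places
    depend on the sequence. *)
Let rearrangement_le (x y : nat -> R) L : decreasing_rearrangement x y ->
  exists L', clipped_injection_sum N x A L <= clipped_injection_sum N y A L'.
Proof.
move=> [_ [s [t st ts] yx]].
pose ls := map t (iota 0 L).
exists (\max_(i <- ls) i).+1.
have -> : clipped_injection_sum N x A L = injection_sum N (fun i => clip (y i)) A ls.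
  rewrite -injection_sum_map; apply: eq_injection_sum => i _ /=.
  by rewrite yx ts.
apply: injection_sum_subset.
- by move=> i; exact: clip_ge0.
- by rewrite map_inj_uniq ?iota_uniq//; exact: can_inj ts.
- by move=> i il; rewrite mem_iota /= ltnS; exact: leq_bigmax_seq.
Qed.

Let clipped_injection_sum_nd (x : nat -> R) : nondecreasing_seq (clipped_injection_sum N x A).
Proof.
move=> L L' LL'; apply: injection_sum_subset; first by move=> i; exact: clip_ge0.
  exact: iota_uniq.
by move=> i; rewrite !mem_iota /= => iL; exact: leq_trans LL'.
Qed.

(** The range [L'] given by [rearrangement_le] varies with the sample point. Monotone convergence in
    the number of labels restores a uniform one: half of [eps] is lost on the GEM side, and the rest
    leaves room for the limit. *)
Lemma PD_injection_sum_ge d (T : measurableType d) (P : probability T R)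
    (X : nat -> {RV P >-> R}) (eps : R) : is_PD alpha theta0 X -> 0 < eps ->
  exists L, ((eppf alpha theta0 N A - eps)%:E <=
    \int[P]_x (clipped_injection_sum N (X^~ x) A L)%:E)%E.
Proof.
move=> [d' [T' [P' [G [Y [GEM_G GY XY]]]]]] eps0.
have [L1 HL1] := GEM_injection_sum_ge GEM_G (divr_gt0 eps0 (ltr0Sn R 1)).
pose g (n : nat) x := (clipped_injection_sum N (Y^~ x) A n)%:E.
have mg n : measurable_fun setT (g n).
  by apply/measurable_EFinP; apply: (@measurable_clipped_injection_sum R I N _ _ (fun x => Y^~ x)).
have g0 n x : (0 <= g n x)%E by rewrite lee_fin clipped_injection_sum_ge0.
have ndg x : nondecreasing_seq (g^~ x).
  by move=> n n' nn'; rewrite lee_fin clipped_injection_sum_nd.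
have cg x : g^~ x @ \oo --> ereal_sup (range (g^~ x)) by exact: ereal_nondecreasing_cvgn.
apply: contrapT => /forallNP H.
have cvg_int := cvg_monotone_convergence (mu := P') measurableT mg
  (fun n x _ => g0 n x) (fun x _ => ndg x).
have : (\int[P']_x limn (g^~ x) <= (eppf alpha theta0 N A - eps)%:E)%E.
  apply: cvge_le cvg_int; apply: nearW => n.
  rewrite -(same_law_clipped_injection_sum N A n XY)//.
  by rewrite ltW// ltNge; apply/negP/H.
apply/negP; rewrite -ltNge.
apply: (@lt_le_trans _ _ (eppf alpha theta0 N A - eps / 2)%:E).
  by rewrite lte_fin ltrD2l ltrN2 ltr_pdivrMr// ltr_pMr// ltr1n.
apply: le_trans HL1 _; apply: ae_ge0_le_integral => //.
- by move=> x _; rewrite lee_fin clipped_injection_sum_ge0.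
- apply/measurable_EFinP.
  by apply: (@measurable_clipped_injection_sum R I N _ _ (fun x => G^~ x)).
- move=> x _; apply: le_trans (g0 0%N x) _; rewrite (cvg_lim _ (cg x))//.
  by apply: ereal_sup_ubound; exists 0%N.
- rewrite (_ : (fun x => _) = (fun x => limn_esup (g^~ x))).
    exact: measurable_fun_limn_esup.
  apply/funext => x; rewrite is_cvg_limn_esupE//.
  by apply/cvg_ex; eexists; exact: cg.
apply: filterS GY => x /(@rearrangement_le _ _ L1)[L' h] _.
apply: (@le_trans _ _ (g L' x)); first by rewrite lee_fin.
rewrite (cvg_lim _ (cg x))//.
by apply: ereal_sup_ubound; exists L'.
Qed.

End GEM_PD.

(** * The law of the split tree *)

Section injection_measure.
Context (R : realType) d (T : measurableType d) (Q : probability T R).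
Context (I : choiceType) (N : I -> nat) (lab : I -> T -> nat) (X : T -> nat -> R).
Hypotheses (mlab : forall c, atomwise_measurable (lab c))
  (mX : forall i, measurable_fun setT (X^~ i)) (X0 : forall x i, 0 <= X x i).
Implicit Types (A : seq I) (ls : seq nat) (H : set T).

Let agree A (l : I -> nat) : set T := [set x | forall c, c \in A -> lab c x = l c].
Let within A ls : set T := [set x | forall c, c \in A -> lab c x \in ls].

Let measurable_within A ls : measurable (within A ls).
Proof.
rewrite /within (_ : [set x | _] = \bigcap_(c in [set` A]) (lab c @^-1` [set i | i \in ls])).
  by apply: fin_bigcap_measurable => // c _; exact: atomwise_measurable_preimage.
by [].
Qed.

(* The induction follows the recursive definition of [injection_sum]: the event in
   which c gets the head l of ls contributes the factor X l ^+ N c, which is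
   absorbed by f. *)
Lemma injection_measure_ge ls A H (l0 : I -> nat) (f : T -> R) :
  uniq ls -> uniq A -> measurable H -> measurable_fun setT f -> (forall x, 0 <= f x) ->
  (forall l : I -> nat, (forall c, c \notin A -> l c = l0 c) -> {in A &, injective l} ->
     {in A, forall c, l c \in ls} ->
     (\int[Q]_x (f x * \prod_(c <- A) X x (l c) ^+ N c)%:E <= Q (H `&` agree A l))%E) ->
  (\int[Q]_x (f x * injection_sum N (X x) A ls)%:E <= Q (H `&` within A ls))%E.
Proof.
elim: ls A H l0 f => [|l ls IH] A H l0 f uls uA mH mf f0 le.
  case: A uA le => [|c A] uA le /=; last first.
    rewrite (eq_integral (cst 0%E)) ?integral0 ?measure_ge0//.
    by move=> x _; rewrite mulr0.
  have := le l0; rewrite (_ : agree [::] l0 = within [::] [::]); last by apply/seteqP; split.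
  move=> /(_ (fun _ _ => erefl)) h; apply: le_trans (h _ _) => //.
  by rewrite le_eqVlt; apply/orP; left; apply/eqP; apply: eq_integral => x _; rewrite big_nil.
move: uls => /= /andP[nl uls].
pose B c := (H `&` lab c @^-1` [set l]) `&` within [seq c' <- A | c' != c] ls.
have mB c : measurable (B c) by do 2!apply: measurableI => //; exact: mlab.
pose S := \bigcup_(c in [set` A]) B c.
have mS : measurable S by apply: fin_bigcup_measurable.
have mIS A' : measurable_fun setT (fun x => injection_sum N (X x) A' ls).
  exact: measurable_injection_sum.
pose F c x := f x * X x l ^+ N c.
have mF c : measurable_fun setT (F c) by apply: measurable_funM => //; exact: measurable_funX.
have F0 c x : 0 <= F c x by rewrite mulr_ge0// exprn_ge0.
have -> : (\int[Q]_x (f x * (injection_sum N (X x) A ls +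
      \sum_(c <- A) X x l ^+ N c * injection_sum N (X x) [seq c' <- A | c' != c] ls))%:E =
    \int[Q]_x (f x * injection_sum N (X x) A ls)%:E +
    \sum_(c <- A) \int[Q]_x (F c x * injection_sum N (X x) [seq c' <- A | c' != c] ls)%:E)%E.
  rewrite -ge0_integral_sum//; last 2 first.
  - by move=> c; apply/measurable_EFinP; exact: measurable_funM.
  - by move=> c x _; rewrite lee_fin mulr_ge0// injection_sum_ge0.
  rewrite -ge0_integralD//.
  - apply: eq_integral => x _; rewrite sumEFin -EFinD; congr EFin.
    by rewrite mulrDr mulr_sumr; congr (_ + _); apply: eq_bigr => c _; rewrite mulrA.
  - by move=> x _; rewrite lee_fin mulr_ge0// injection_sum_ge0.
  - by apply/measurable_EFinP; exact: measurable_funM.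
  - by move=> x _; apply: sume_ge0 => c _; rewrite lee_fin mulr_ge0// injection_sum_ge0.
  - by apply: emeasurable_sum => c; apply/measurable_EFinP; exact: measurable_funM.
apply: (@le_trans _ _ (Q (H `&` within A ls) + Q S)%E).
  rewrite leeD//.
    apply: (IH A H l0) => // l' l'0 l'i l'ls; apply: le => // c cA.
    by rewrite inE l'ls// orbT.
  have tB : trivIset [set` A] B.
    apply/trivIsetP => c c' /= cA c'A cc'; apply/seteqP; split => // x [[[_ lc] wc] [[_ lc'] wc']].
    have := wc' c; rewrite mem_filter cc' cA => /(_ isT).
    by rewrite lc (negbTE nl).
  have -> : (Q S = \sum_(c <- A) Q (B c))%E.
    by rewrite fsbig_seq//; apply: measure_fin_bigcup.
  rewrite big_seq [leRHS]big_seq; apply: lee_sum => c cA.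
  (* Once removed from [A], [c] has its label recorded in the reference labelling. *)
  apply: (IH _ _ (fun c' => if c' == c then l else l0 c')) => //.
  - by rewrite filter_uniq.
  - by apply: measurableI => //; exact: mlab.
  move=> l' l'0 l'i l'ls.
  have lc : l' c = l by rewrite l'0 ?eqxx// mem_filter eqxx.
  have l'A c' : c' \in A -> c' != c -> l' c' \in ls.
    by move=> c'A c'c; apply: l'ls; rewrite mem_filter c'c.
  rewrite (_ : _ `&` _ = H `&` agree A l').
    rewrite (eq_integral (fun x => (f x * \prod_(c <- A) X x (l' c) ^+ N c)%:E)); last first.
      by move=> x _; rewrite [in RHS](bigD1_seq c)//= lc mulrA big_filter.
    apply: le.
    - move=> c' c'A; rewrite l'0; last by rewrite mem_filter negb_and c'A orbT.
      by case: eqVneq => // e; rewrite e cA in c'A.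
    - move=> c1 c2 c1A c2A.
      have [->|n1] := eqVneq c1 c; have [->|n2] := eqVneq c2 c => //.
      + by rewrite lc => e; move: nl; rewrite e l'A.
      + by rewrite lc => e; move: nl; rewrite -e l'A.
      + by apply: l'i; rewrite mem_filter ?n1 ?n2.
    - move=> c' c'A; rewrite inE; have [->|n1] := eqVneq c' c; first by rewrite lc eqxx.
      by rewrite l'A ?orbT.
  apply/seteqP; split => x /=.
    move=> [[Hx labc] ag]; split => // c' c'A.
    have [->|n1] := eqVneq c' c; first by rewrite lc.
    by apply: ag; rewrite mem_filter n1.
  move=> [Hx ag]; split; first by split => //; rewrite /= ag// lc.
  by move=> c'; rewrite mem_filter => /andP[_ c'A]; exact: ag.
rewrite -measureU//.
- apply: le_measure; rewrite ?inE.
  + by apply: measurableU => //; exact: measurableI.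
  + exact: measurableI.
  + move=> x [[Hx w]|[c cA [[Hx lc] w]]]; split => // c' c'A; rewrite inE.
      by rewrite w// orbT.
    have [->|n1] := eqVneq c' c; first by rewrite lc eqxx.
    by rewrite w ?orbT// mem_filter n1.
- exact: measurableI.
- apply/seteqP; split => // x [[_ w] [c cA [[_ lc] _]]].
  by move: nl; rewrite -[l](_ : lab c x = l)// w.
Qed.

End injection_measure.

Section split_process.
Context (R : realType) d (T : measurableType d) (Q : probability T R).
Context (V : node -> nat -> {RV Q >-> R}) (C : nat -> node -> {RV Q >-> nat}).
Hypothesis indV : mutually_independent (@real_seq_sigma R) Q (fun v x i => V v i x).
Hypothesis condC : forall (F : {fset nat * node}) (i : nat * node -> nat) (A : set T),
  env_sigma V A ->
  Q (A `&` [set x | forall kv, kv \in F -> C kv.1 kv.2 x = i kv]) =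
  (\int[Q]_(x in A) (\prod_(kv <- enum_fset F) V kv.2 (i kv) x)%:E)%E.

(** By [condC], the integral of [V v i] over the event where it is negative is itself a probability;
    so this event is null. *)
Lemma split_vector_ge0 v i : \forall x \ae Q, 0 <= V v i x.
Proof.
pose A := V v i @^-1` `]-oo, 0[%classic.
have mA : measurable A by exact: measurable_funPTI.
have eA : env_sigma V A.
  by apply: sub_sigma_algebra; exists v, i, `]-oo, 0[%classic => //; exact: measurable_itv.
have /esym := condC [fset (0%N, v)]%fset (fun=> i) eA.
rewrite (eq_integral (fun x => (- (- V v i x)%:E)%E)); last first.
  by move=> x _; rewrite big_seq_fset1; exact: (congr1 EFin (esym (opprK _))).
have f0 x : A x -> (0 <= (- V v i x)%:E)%E by rewrite /A /= in_itv /= lee_fin oppr_ge0 => /ltW.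
rewrite integral_ge0N// => e.
have mf : measurable_fun A (fun x => (- V v i x)%:E).
  by apply/measurable_EFinP; apply: measurable_funTS; exact: measurableT_comp.
have : (\int[Q]_(x in A) `|(- V v i x)%:E| = 0)%E.
  rewrite (eq_integral (fun x => (- V v i x)%:E)); last first.
    by move=> x; rewrite inE => /f0 /gee0_abs.
  apply/eqP; rewrite eq_le integral_ge0// andbT -oppe_ge0 e.
  exact: measure_ge0.
move=> /(ae_eq_integral_abs _ mA mf); apply: filterS => x /= H.
rewrite leNgt; apply/negP => Vx; have : A x by rewrite /A /= in_itv.
by move=> /H [] /eqP; rewrite oppr_eq0 => /eqP V0; rewrite V0 ltxx in Vx.
Qed.

Lemma atomwise_measurable_landing k s fuel v :
  atomwise_measurable (fun x => landing (fun w => C k w x) s fuel v).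
Proof.
have mC w : atomwise_measurable (C k w) by move=> i; exact: measurable_funPTI.
have mcst (w : node) : atomwise_measurable (fun _ : T => w).
  move=> w'; have [<-|ww'] := eqVneq w w'.
    by rewrite (_ : _ @^-1` _ = setT)//; apply/seteqP; split.
  rewrite (_ : _ @^-1` _ = set0)//; apply/seteqP; split => // x /= /eqP.
  by rewrite (negbTE ww').
elim: fuel v => [|fuel IH] v /=; first exact: mcst.
case: (v \in s); last exact: mcst.
exact: (atomwise_measurable_bind (F := fun i x => landing (fun w => C k w x) s fuel (rcons v i)) (mC v)).
Qed.

Lemma atomwise_measurable_split_nodes k :
  atomwise_measurable (fun x => split_nodes (fun j v => C j v x) k).
Proof.
elim: k => [|k IH] /=.
  move=> s; have [->|s0] := eqVneq s [::].
    by rewrite (_ : _ @^-1` _ = setT)//; apply/seteqP; split.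
  rewrite (_ : _ @^-1` _ = set0)//; apply/seteqP; split => // x /= e.
  by rewrite -e eqxx in s0.
apply: (atomwise_measurable_bind (F := fun s x =>
  rcons s (landing (fun w => C k w x) s (size s) root)) IH) => s.
exact: (atomwise_measurable_comp (rcons s) (atomwise_measurable_landing k s (size s) root)).
Qed.

Lemma atomwise_measurable_relabelled_parent k :
  atomwise_measurable (fun x => relabelled_parent (fun j v => C j v x) k).
Proof.
apply: (atomwise_measurable_bind (F := fun s x => relabel s
  (parent (last root (split_nodes (fun j v => C j v x) k.+1)))) (@atomwise_measurable_split_nodes k)) => s.
exact: (atomwise_measurable_comp (fun s' => relabel s (parent (last root s')))
  (@atomwise_measurable_split_nodes k.+1)).
Qed.

Variables (u : nat -> node) (n : nat).
Hypothesis hist : pa_history u n.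
Let rs := pa_nodes u n.
Let children v := [seq c <- rs | is_child v c].
Let N := subtree_size rs.

Let us : uniq rs. Proof. exact: pa_nodes_uniq. Qed.
Let cs : parent_closed rs. Proof. exact: pa_nodes_closed. Qed.

(** On the history event the node filled by ball [index c rs] is the image of [c], and its last
    letter is the label that [c] received in the split tree. *)
Definition child_label c (x : T) : nat :=
  last 0%N (nth root (split_nodes (fun k v => C k v x) n) (index c rs)).

Definition history_event : set T :=
  [set x | forall k, (0 < k < n)%N -> relabelled_parent (fun k v => C k v x) k = u k].

Definition children_moment (l : node -> nat) v : R :=
  fine (\int[Q]_x (\prod_(c <- children v) clip (V (path_labels l v) (l c) x) ^+ N c)%:E)%E.

Let mclipV v i e : measurable_fun setT (fun x => clip (V v i x) ^+ e).
Proof. by apply: measurable_funX; apply: measurableT_comp => //; exact: measurable_clip. Qed.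

Let children_momentE l v :
  (\int[Q]_x (\prod_(c <- children v) clip (V (path_labels l v) (l c) x) ^+ N c)%:E =
   (children_moment l v)%:E)%E.
Proof.
apply: probability_integral_fineK; first exact: measurable_prod.
have f01 c x : 0 <= clip (V (path_labels l v) (l c) x) ^+ N c <= 1.
  by rewrite exprn_ge0 ?clip_ge0//= exprn_ile1 ?clip_ge0 ?clip_le1.
move=> x; apply/andP; split; last by apply: prodr_ile1 => c _; exact: f01.
by apply: prodr_ge0 => c _; have /andP[] := f01 c x.
Qed.

Lemma measurable_history_event : measurable history_event.
Proof.
rewrite (_ : history_event = \bigcap_(k in [set k | (0 < k < n)%N])
   ((fun x => relabelled_parent (fun j v => C j v x) k) @^-1` [set u k])).
  by apply: bigcap_measurableType => k _; exact: atomwise_measurable_relabelled_parent.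
by [].
Qed.

Lemma atomwise_measurable_child_label c : atomwise_measurable (child_label c).
Proof.
exact: (atomwise_measurable_comp (fun s => last 0%N (nth root s (index c rs)))
  (@atomwise_measurable_split_nodes n)).
Qed.

Section labelling.
Variable l : node -> nat.
Hypothesis lS : sibling_injective l rs.

Let pl_inj : {in rs &, injective (path_labels l)}. Proof. exact: path_labels_inj. Qed.

(** The pairs of a ball and a node which it leaves, when the history unfolds with labels [l];
    [choice_label] is the child then to be chosen. *)
Let choices : seq (nat * node) :=
  [seq (k, path_labels l (take j (nth root rs k))) | k <- iota 0 n, j <- iota 0 (size (nth root rs k))].

Let choice_label (kv : nat * node) := l (take (size kv.2).+1 (nth root rs kv.1)).

Let choices_uniq : uniq choices.
Proof.
apply: allpairs_uniq_dep; [exact: iota_uniq|by move=> k _; exact: iota_uniq|].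
move=> _ _ /allpairsPdep[k [j [_ jk ->]]] /allpairsPdep[k' [j' [_ jk' ->]]] /= [kk].
rewrite kk in jk *; move: jk jk'; rewrite !mem_iota /= => jk jk'.
by move=> /(congr1 size); rewrite !size_path_labels !size_takel// 1?ltnW// => ->.
Qed.

Let big_choices (F : node -> nat -> R) :
  \prod_(kv <- choices) F kv.2 (choice_label kv) =
  \prod_(r <- rs) \prod_(j <- iota 0 (size r)) F (path_labels l (take j r)) (l (take j.+1 r)).
Proof.
rewrite big_allpairs_dep (big_nth root) size_pa_nodes /index_iota subn0.
apply: eq_bigr => k _; rewrite big_seq [RHS]big_seq; apply: eq_bigr => j.
rewrite mem_iota /= => jk; rewrite /choice_label /= size_path_labels size_takel//.
exact: ltnW.
Qed.

Let event_sub :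
  [set x | forall kv, kv \in [fset kv in choices]%fset -> C kv.1 kv.2 x = choice_label kv] `<=`
  history_event `&` [set x | forall c, c \in rs -> c != root -> child_label c x = l c].
Proof.
move=> x H; have f : follows (fun k v => C k v x) l rs.
  move=> k j; rewrite size_pa_nodes => kn jk.
  have := H (k, path_labels l (take j (nth root rs k))).
  rewrite inE /= => -> //; last first.
    by apply/allpairsPdep; exists k, j; rewrite !mem_iota.
  by rewrite /choice_label /= size_path_labels size_takel// ltnW.
have [sE _ pE] := split_nodes_follow hist lS f.
split => // c crs c0; rewrite /child_label sE (nth_map root) ?index_mem// nth_index//.
by case/lastP: c crs c0 => // v a _ _; rewrite path_labels_rcons last_rcons.
Qed.

(** When [w] is the position of a node [v], only [v] contributes. Indexing by positions makes this a
    function of the vector at [w], as independence of the vectors requires. *)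
Let h w (y : nat -> R) : R :=
  \prod_(v <- [seq v <- rs | path_labels l v == w]) \prod_(c <- children v) clip (y (l c)) ^+ N c.

Let hE v y : v \in rs -> h (path_labels l v) y = \prod_(c <- children v) clip (y (l c)) ^+ N c.
Proof.
move=> vs; rewrite /h big_filter big_seq_cond (eq_bigl (fun v' => v' == v)).
  by rewrite -big_filter (filter_pred1_uniq us vs) big_seq1.
move=> v'; apply/andP/eqP => [[v's /eqP/pl_inj->//]|->]; by rewrite eqxx.
Qed.

Let children_moments_prod :
  (\int[Q]_x (\prod_(v <- rs) h (path_labels l v) (fun i => V (path_labels l v) i x))%:E =
   (\prod_(v <- rs) children_moment l v)%:E)%E.
Proof.
transitivity (\int[Q]_x \prod_(w <- map (path_labels l) rs) (h w (fun i => V w i x))%:E)%E.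
  by apply: eq_integral => x _; rewrite prodEFin big_map.
rewrite (@independent_integral_prod _ _ _ _ Q (fun w x => h w (fun i => V w i x))).
- rewrite big_map -prodEFin big_seq [RHS]big_seq; apply: eq_bigr => v vs.
  by rewrite -children_momentE; apply: eq_integral => x _; rewrite hE.
- apply: mutually_independent_comp indV => w B mB.
  suff mh : measurable_fun [set: g_sigma_algebraType (@real_seq_gen R)] (h w).
    by have := mh measurableT B mB; rewrite setTI.
  apply: measurable_prod => v _; apply: measurable_prod => c _; apply: measurable_funX.
  by apply: measurableT_comp; [exact: measurable_clip|exact: measurable_coord].
- move=> w; rewrite /h; apply: measurable_prod => v _.
  by apply: measurable_prod => c _; exact: mclipV.
- move=> w x; rewrite /h; apply: prodr_ge0 => v _; apply: prodr_ge0 => c _.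
  by rewrite exprn_ge0 ?clip_ge0.
- by rewrite map_inj_in_uniq.
Qed.

(** The prescribed choices force both the history and the labels. Their probability is the
    expectation of a product of coordinates, which [big_path_prod] regroups by node and independence
    factors. *)
Lemma history_label_ge :
  ((\prod_(v <- rs) children_moment l v)%:E <=
   Q (history_event `&` [set x | forall c, c \in rs -> c != root -> child_label c x = l c]))%E.
Proof.
set B := _ `&` _; pose F : {fset nat * node} := [fset kv in choices]%fset.
pose E := [set x | forall kv, kv \in F -> C kv.1 kv.2 x = choice_label kv].
have mB : measurable B.
  apply: measurableI; first exact: measurable_history_event.
  rewrite (_ : [set x | _] = \bigcap_(c in [set c | c \in rs /\ c != root]) (child_label c @^-1` [set l c])).
    apply: fin_bigcap_measurable => [|c _]; last exact: atomwise_measurable_child_label.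
    by apply: (@sub_finite_set _ _ [set` rs]) => // c [].
  by apply/seteqP; split => x H c => [[]|cr c0]; apply: H.
have mE : measurable E.
  rewrite (_ : E = \bigcap_(kv in [set` F]) (C kv.1 kv.2 @^-1` [set choice_label kv])).
    by apply: fin_bigcap_measurable => // kv _; exact: measurable_funPTI.
  by [].
apply: (@le_trans _ _ (Q E)); last first.
  by apply: le_measure; rewrite ?inE//; exact: event_sub.
have eT : env_sigma V setT.
  suff sT (G : set (set T)) : <<s G >> setT by exact: sT.
  case: (smallest_sigma_algebra setT G) => s0 sC _.
  by have := sC _ s0; rewrite setD0.
have := condC F choice_label eT; rewrite setTI -/E => ->.
have bigF (x : T) (G : R -> R) : \prod_(kv <- enum_fset F) G (V kv.2 (choice_label kv) x) =
   \prod_(r <- rs) \prod_(j <- iota 0 (size r)) G (V (path_labels l (take j r)) (l (take j.+1 r)) x).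
  rewrite -(big_choices (fun w i => G (V w i x))); apply: perm_big.
  by apply: uniq_perm; rewrite ?fset_uniq// => kv; rewrite inE.
rewrite -children_moments_prod.
(* Coordinates are nonnegative only almost surely, whereas [clip] is bounded by the absolute value
   everywhere. *)
apply: (@le_trans _ _ (\int[Q]_x (\prod_(kv <- enum_fset F) `|V kv.2 (choice_label kv) x|)%:E)%E).
  apply: ge0_le_integral => //.
  - move=> x _; rewrite lee_fin /h; do 3!(apply: prodr_ge0 => ? _).
    by rewrite exprn_ge0// clip_ge0.
  - apply/measurable_EFinP; do 3!(apply: measurable_prod => ? _); exact: mclipV.
  - apply/measurable_EFinP; apply: measurable_prod => kv _.
    by apply: measurableT_comp => //; exact: measurable_realfun.normr_measurable.
  move=> x _; rewrite lee_fin bigF.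
  pose G c := clip (V (path_labels l (parent c)) (l c) x).
  apply: (@le_trans _ _ (\prod_(r <- rs) \prod_(j <- iota 0 (size r)) G (take j.+1 r))).
    rewrite big_path_prod//= big_seq [leRHS]big_seq; apply: ler_prod => v vs.
    rewrite hE// big_filter; apply/andP; split.
      by apply: prodr_ge0 => c _; rewrite exprn_ge0// clip_ge0.
    rewrite le_eqVlt; apply/orP; left; apply/eqP; apply: eq_bigr => c /is_childP[a ->].
    by rewrite /G parent_rcons.
  apply: ler_prod => r _; apply/andP; split; first by apply: prodr_ge0 => j _; exact: clip_ge0.
  rewrite big_seq [leRHS]big_seq; apply: ler_prod => j; rewrite mem_iota /= => jr.
  rewrite clip_ge0 /= /G (_ : parent (take j.+1 r) = take j r) ?clip_le_norm//.
  by rewrite /parent size_takel// take_takel.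
have mV : measurable_fun setT (fun x => (\prod_(kv <- enum_fset F) V kv.2 (choice_label kv) x)%:E).
  by apply/measurable_EFinP; exact: measurable_prod.
rewrite le_eqVlt; apply/orP; left; apply/eqP; apply: ae_eq_integral => //.
  apply/measurable_EFinP; apply: measurable_prod => kv _.
  by apply: measurableT_comp => //; exact: measurable_realfun.normr_measurable.
(* Nonnegativity for all nodes and labels at once, by enumerating the countable set of pairs. *)
have : \forall x \ae Q, forall m, if @choice.unpickle (node * nat)%type m is Some p
    then 0 <= V p.1 p.2 x else true.
  by apply: ae_foralln => m; case: choice.unpickle => [p|]; [exact: split_vector_ge0|exact: aeW].
apply: filterS => x H _; congr EFin; apply: eq_bigr => kv _.
rewrite ger0_norm//; have := H (choice.pickle (kv.2, choice_label kv)).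
by rewrite choice.pickleK.
Qed.

End labelling.
Let take_pa_nodes k : (k <= n)%N -> take k rs = pa_nodes u k.
Proof.
rewrite /rs; elim: n => [|m IH]; first by rewrite leqn0 => /eqP ->.
rewrite leq_eqVlt => /predU1P[->|]; first by rewrite take_oversize// size_pa_nodes.
rewrite ltnS => km; rewrite -IH//; case: (posnP m) km => [->|m0] km.
  by move: km; rewrite leqn0 => /eqP ->; rewrite !take0.
by rewrite pa_nodesS// -cats1 takel_cat// size_pa_nodes.
Qed.

Variables (alpha theta : R).
Local Notation q v := (eppf alpha theta N (children v)).
Hypotheses (q_ge0 : forall v, 0 <= q v)
  (V_ge : forall w v eps, 0 < eps -> exists L, ((q v - eps)%:E <=
     \int[Q]_x (clipped_injection_sum N (fun i => V w i x) (children v) L)%:E)%E).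

Let children_moment_ge0 l v : 0 <= children_moment l v.
Proof.
apply: fine_ge0; apply: integral_ge0 => x _; rewrite lee_fin.
by apply: prodr_ge0 => c _; rewrite exprn_ge0// clip_ge0.
Qed.

(** Labels are prescribed for the children of the first [j] nodes: [j = n] fixes all of them,
    [j = 0] none. *)
Let labelled j (l : node -> nat) : set T :=
  [set x | forall v, v \in take j rs -> forall c, c \in children v -> child_label c x = l c].

Let measurable_labelled j l : measurable (labelled j l).
Proof.
rewrite (_ : labelled j l = \bigcap_(v in [set` take j rs])
    \bigcap_(c in [set` children v]) (child_label c @^-1` [set l c])); last by [].
apply: fin_bigcap_measurable => // v _; apply: fin_bigcap_measurable => // c _.
exact: atomwise_measurable_child_label.
Qed.

(** A node is born after its parent, so changing the labels of the children of node [j] does not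
    move the first [j.+1] nodes. *)
Let no_child j c : (j < n)%N -> c \in take j.+1 rs -> c \notin children (nth root rs j).
Proof.
move=> jn; have jr : (j < size rs)%N by rewrite size_pa_nodes.
rewrite (take_nth root jr) mem_rcons inE mem_filter negb_and => cj; apply/orP; left.
apply/negP => /is_childP[a cE]; move: cj; rewrite {}cE => /orP[/eqP/(congr1 size)/eqP|].
  by rewrite size_rcons eqn_leq ltnn.
rewrite take_pa_nodes ?(ltnW jn)// => cin.
have hj : pa_history u j.
  by move=> k /andP[k0 kj]; apply: hist; rewrite k0 (ltn_trans kj).
have := pa_nodes_closed hj cin; rewrite -take_pa_nodes ?(ltnW jn)// => rj.
have : uniq (take j rs ++ drop j rs) by rewrite cat_take_drop.
by rewrite (drop_nth root jr) cat_uniq => /and3P[_ /hasPn/(_ _ (mem_head _ _))]; rewrite /= rj.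
Qed.

(* The labels are summed out one family of siblings at a time, in the reverse of
   the order of the parents: the labels of the children of the j-th node do not
   affect the vectors of the nodes that precede it. *)
Let history_labelled_ge j l : (j <= n)%N ->
  (forall v, v \in take j rs -> {in children v &, injective l}) ->
  ((\prod_(v <- take j rs) children_moment l v * \prod_(v <- drop j rs) q v)%:E <=
   Q (history_event `&` labelled j l))%E.
Proof.
move=> jn; rewrite -(subKn jn); move: (n - j)%N (leq_subr j n) => k kn {j jn}.
elim: k kn l => [_|k IH kn] l linj.
  have sn : size rs = n by exact: size_pa_nodes.
  rewrite subn0 take_oversize ?sn// drop_oversize ?sn// big_nil mulr1.
  have lS : sibling_injective l rs.
    move=> v a b va vb e; suff /rcons_inj[] : rcons v a = rcons v b by [].
    apply: (linj v) => //; rewrite ?mem_filter ?is_child_rcons ?eqxx//.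
    by rewrite subn0 take_oversize ?sn//; exact: cs va.
  apply: le_trans (history_label_ge lS) _; apply: le_measure; rewrite ?inE.
  - apply: measurableI; first exact: measurable_history_event.
    rewrite (_ : [set x | _] = \bigcap_(c in [set c | c \in rs /\ c != root]) (child_label c @^-1` [set l c])).
      apply: fin_bigcap_measurable => [|c _]; last exact: atomwise_measurable_child_label.
      by apply: (@sub_finite_set _ _ [set` rs]) => // c [].
    by apply/seteqP; split => x H c => [[]|cr c0]; apply: H.
  - by apply: measurableI => //; exact: measurable_history_event.
  - move=> x [Hx lx]; split => // v _ c; rewrite mem_filter => /andP[/is_childP[a ->] cr].
    by apply: lx => //; rewrite -size_eq0 size_rcons.
set j := (n - k.+1)%N in linj *.
have jE : (n - k)%N = j.+1 by rewrite /j subnSK.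
have jn : (j < n)%N by rewrite -jE leq_subr.
have jr : (j < size rs)%N by rewrite size_pa_nodes.
have {}IH := IH (ltnW kn); rewrite jE in IH.
set r := nth root rs j.
rewrite (drop_nth root jr) big_cons -/r.
pose a l' := \prod_(v <- take j rs) children_moment l' v * \prod_(v <- drop j.+1 rs) q v.
have a0 l' : 0 <= a l' by rewrite mulr_ge0 ?prodr_ge0.
have -> : \prod_(v <- take j rs) children_moment l v * (q r * \prod_(v <- drop j.+1 rs) q v) = a l * q r.
  by rewrite /a mulrCA mulrC.
have mH : measurable (history_event `&` labelled j l).
  by apply: measurableI => //; exact: measurable_history_event.
(* The bound on the injection sum holds up to [eps], and this error gets multiplied by [a l]; since
   [a l] may be 0, the division is by [a l + 1]. *)
suff key eps : 0 < eps -> ((a l * (q r - eps))%:E <= Q (history_event `&` labelled j l))%E.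
  have Qf : Q (history_event `&` labelled j l) \is a fin_num by exact: fin_num_measure.
  rewrite -(fineK Qf) lee_fin; apply/ler_addgt0Pr => eps eps0.
  have al1 : 0 < a l + 1 by rewrite ltr_pwDr.
  have := key (eps / (a l + 1)) (divr_gt0 eps0 al1); rewrite -(fineK Qf) lee_fin mulrBr.
  rewrite lerBlDr => /le_trans; apply; rewrite lerD2l mulrCA ler_piMr ?(ltW eps0)//.
  by rewrite ler_pdivrMr// mul1r lerDl.
move=> eps0; have [L HL] := V_ge (path_labels l r) r eps0.
pose X x i := clip (V (path_labels l r) i x).
have mX i : measurable_fun setT (X^~ i).
  by apply: measurableT_comp => //; exact: measurable_clip.
have X0 x i : 0 <= X x i by exact: clip_ge0.
have uc : uniq (children r) by rewrite filter_uniq.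
(* The constant weight [a l] carries the factors of all other nodes; only the labels of the children
   of [r] are summed. *)
have := @injection_measure_ge R d T Q _ N child_label X atomwise_measurable_child_label
  mX X0 (iota 0 L) (children r) (history_event `&` labelled j l) l (cst (a l))
  (iota_uniq _ _) uc mH (measurable_cst _) (fun=> a0 l).
have -> : (\int[Q]_x (cst (a l) x * injection_sum N (X x) (children r) (iota 0 L))%:E =
    (a l)%:E * \int[Q]_x (clipped_injection_sum N (fun i => V (path_labels l r) i x) (children r) L)%:E)%E.
  rewrite -ge0_integralZl//.
  - apply/measurable_EFinP.
    by apply: (@measurable_clipped_injection_sum R _ N _ _ (fun x i => V (path_labels l r) i x)).
  - by move=> x _; rewrite lee_fin clipped_injection_sum_ge0.
  - by rewrite lee_fin.
move=> main; apply: (@le_trans _ _ ((a l)%:E * \int[Q]_x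
   (clipped_injection_sum N (fun i => V (path_labels l r) i x) (children r) L)%:E)%E).
  by rewrite EFinM lee_wpmul2l// lee_fin.
apply: le_trans (main _) _ => [l' l'0 l'inj _|]; last first.
  apply: le_measure; rewrite ?inE//.
    apply: measurableI => //.
    rewrite (_ : [set x | _] = \bigcap_(c in [set` children r]) (child_label c @^-1` [set i | i \in iota 0 L])).
      apply: fin_bigcap_measurable => // c _; apply: atomwise_measurable_preimage.
      exact: atomwise_measurable_child_label.
    by [].

have plE v : v \in take j.+1 rs -> path_labels l' v = path_labels l v.
  move=> vj; apply: eq_path_labels => i iv; apply: l'0; apply: no_child => //.
  rewrite take_pa_nodes// in vj *; apply: parent_closed_take => //.
  apply: pa_nodes_closed => m /andP[m0 mj]; apply: hist; rewrite m0.
  exact: leq_trans jn.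
have rj : r \in take j.+1 rs by rewrite (take_nth root jr) mem_rcons mem_head.
have sub v : v \in take j rs -> v \in take j.+1 rs.
  by rewrite (take_nth root jr) mem_rcons inE => ->; rewrite orbT.
have nr v : v \in take j rs -> v != r.
  move=> vj; apply: contraTneq vj => ->.
  have : uniq (take j rs ++ drop j rs) by rewrite cat_take_drop.
  by rewrite (drop_nth root jr) cat_uniq => /and3P[_ /hasPn/(_ _ (mem_head _ _))].
have chl v c : v \in take j rs -> c \in children v -> l' c = l c.
  move=> vj; rewrite mem_filter => /andP[/is_childP[b ->] _]; apply: l'0.
  by rewrite mem_filter is_child_rcons eq_sym (negbTE (nr _ vj)).
have aE : a l' = a l.
  rewrite /a; congr (_ * _); apply: eq_big_seq => v vj.
  rewrite /children_moment plE ?sub//; congr fine; apply: eq_integral => x _; congr EFin.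
  by apply: eq_big_seq => c cv; rewrite (chl v).
have -> : (\int[Q]_x (cst (a l) x * \prod_(c <- children r) X x (l' c) ^+ N c)%:E =
    (\prod_(v <- take j.+1 rs) children_moment l' v * \prod_(v <- drop j.+1 rs) q v)%:E)%E.
  under eq_integral do rewrite EFinM /=.
  rewrite ge0_integralZl//; last 3 first.
  - apply/measurable_EFinP; apply: measurable_prod => c _; exact: measurable_funX.
  - by move=> x _; rewrite lee_fin prodr_ge0// => c _; rewrite exprn_ge0.
  - by rewrite lee_fin a0.
  have := children_momentE l' r; rewrite plE// => ->.
  rewrite -EFinM (take_nth root jr) big_rcons /= -/r -aE /a; congr EFin.
  by rewrite mulrC mulrA; congr (_ * _); rewrite mulrC.
apply: le_trans (IH l' _) _.
  move=> v; rewrite (take_nth root jr) mem_rcons inE => /orP[/eqP->//|vj].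
  move=> c c' cv cv'; rewrite (chl v)// (chl v)//; exact: (linj v vj).
apply: le_measure; rewrite ?inE.
- by apply: measurableI => //; exact: measurable_history_event.
- apply: measurableI => //.
  rewrite (_ : [set x | _] = \bigcap_(c in [set` children r]) (child_label c @^-1` [set l' c])); last by [].
  by apply: fin_bigcap_measurable => // c _; exact: atomwise_measurable_child_label.
move=> x [Hx lx]; split; first split => // v vj c cv.
  by rewrite (lx v)// ?(chl v)//; exact: sub.
by move=> c cr; exact: (lx r).
Qed.

Lemma history_event_ge : ((\prod_(v <- rs) q v)%:E <= Q history_event)%E.
Proof.
have := @history_labelled_ge 0%N (fun=> 0%N) (leq0n n).
rewrite take0 drop0 big_nil mul1r => h; apply: le_trans (h _) _ => //.
apply: le_measure; rewrite ?inE; last by move=> x [].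
  by apply: measurableI => //; exact: measurable_history_event.
exact: measurable_history_event.
Qed.

End split_process.

Lemma eq_pa_tree (u u' : nat -> node) n : (forall k, (0 < k < n)%N -> u k = u' k) ->
  pa_tree u n = pa_tree u' n.
Proof.
elim: n => [//|[//|n] IH] uu'.
have -> (w : nat -> node) : pa_tree w n.+2 = attach (pa_tree w n.+1) (w n.+1) by [].
rewrite (uu' n.+1 (ltnSn _)) IH// => k /andP[k0 kn]; apply: uu'; rewrite k0; exact: ltnW.
Qed.

(** * Comparison of the two models *)

Section main.
Context (R : realType) (chi rho : R).
Hypotheses (rho_gt0 : 0 < rho) (chiDrho_gt0 : 0 < chi + rho)
  (chi_rho : 0 <= chi \/ (chi < 0 /\ exists2 m : nat, (0 < m)%N & rho / `|chi| = m%:R)).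
Let alpha := chi / (chi + rho).
Let theta := rho / (chi + rho).

Let alpha_lt1 : alpha < 1. Proof. by rewrite ltr_pdivrMr// mul1r ltrDl. Qed.

Let theta_gt0 : 0 < theta. Proof. exact: divr_gt0. Qed.

(** For negative [chi] the parameter is [(m - l) * (- chi) / (chi + rho)]; as [m] is an integer, the
    sequence takes the value 0 at [l = m] before turning negative. *)
Lemma stick_parameters_ge0 l : 0 < theta + l%:R * alpha -> 0 <= theta + l.+1%:R * alpha.
Proof.
have tE k : theta + k%:R * alpha = (rho + k%:R * chi) / (chi + rho).
  by rewrite /theta /alpha; field; rewrite gt_eqF.
rewrite !tE pmulr_lgt0 ?invr_gt0// pmulr_lge0 ?invr_gt0//.
case: chi_rho => [chi0 _|[chi0 [m m0]]]; first by rewrite addr_ge0 ?mulr_ge0// ltW.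
have nchi : 0 < - chi by rewrite oppr_gt0.
rewrite ltr0_norm// => e; have -> : rho = m%:R * - chi by rewrite -e divfK// gt_eqF.
rewrite !mulrN -!mulNr -!mulrDl -mulrN1.
have k j : (- m%:R + j%:R) * chi = (m%:R - j%:R) * - chi by ring.
rewrite mulrN1 !k pmulr_lgt0// pmulr_lge0// subr_gt0 subr_ge0.
by rewrite ltr_nat ler_nat.
Qed.

Context d (T : measurableType d) (P : probability T R)
  (U : nat -> T -> node) (PA : pa_process chi rho P U).

Let pa_process_prob u n :
  P [set x | forall k, (0 < k < n.+1)%N -> U k x = u k] =
  (\prod_(1 <= k < n.+1) pa_prob chi rho (pa_tree u k) (u k))%:E.
Proof.
elim: n => [|n IH].
  rewrite big_nil (_ : [set x | _] = setT) ?probability_setT//.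
  by apply/seteqP; split => // x _ k; case: k.
have [_ /(_ n.+1 u isT)] := PA.
rewrite (_ : [set x | forall k, (0 < k < n.+2)%N -> U k x = u k] =
  [set x | forall k, (0 < k <= n.+1)%N -> U k x = u k])// => ->.
by rewrite IH -EFinM [in RHS]big_nat_recr.
Qed.

Context d' (T' : measurableType d') (Q : probability T' R)
  (V : node -> nat -> {RV Q >-> R}) (C : nat -> node -> {RV Q >-> nat}).
Hypotheses
  (indV : mutually_independent (@real_seq_sigma R) Q (fun v x i => V v i x))
  (condC : forall (F : {fset nat * node}) (i : nat * node -> nat) (A : set T'),
    env_sigma V A ->
    Q (A `&` [set x | forall kv, kv \in F -> C kv.1 kv.2 x = i kv]) =
    (\int[Q]_(x in A) (\prod_(kv <- enum_fset F) V kv.2 (i kv) x)%:E)%E)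
  (V_ge : forall (w : node) (N : node -> nat) (A : seq node) (eps : R),
     uniq A -> {in A, forall c, (0 < N c)%N} -> 0 < eps ->
     exists L, ((eppf alpha theta N A - eps)%:E <=
       \int[Q]_x (clipped_injection_sum N (fun i => V w i x) A L)%:E)%E).

Let c x k v := C k v x.

Let parents n x := [seq U k x | k <- iota 1 n].
Let parents' n x := [seq relabelled_parent (c x) k | k <- iota 1 n].

Let atomwise_measurable_map S (mS : measurableType S) (F : nat -> mS -> node) n :
  (forall k, atomwise_measurable (F k)) -> atomwise_measurable (fun x => [seq F k x | k <- iota 1 n]).
Proof.
move=> mF; elim: n => [|n IH].
  move=> y; have [->|y0] := eqVneq y [::].
    by rewrite (_ : _ @^-1` _ = setT)//; apply/seteqP; split.
  rewrite (_ : _ @^-1` _ = set0)//; apply/seteqP; split => // x /= e.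
  by rewrite -e eqxx in y0.
have -> : (fun x => [seq F k x | k <- iota 1 n.+1]) =
    (fun x => rcons [seq F k x | k <- iota 1 n] (F n.+1 x)).
  apply/funext => x; rewrite -map_rcons; congr map.
  by rewrite -[X in iota _ X]addn1 iotaD cats1 add1n.
apply: (atomwise_measurable_bind (F := fun s x => rcons s (F n.+1 x)) IH) => s.
exact: (atomwise_measurable_comp (rcons s) (mF n.+1)).
Qed.

Let mparents n : atomwise_measurable (parents n).
Proof. by apply: atomwise_measurable_map => k; exact: PA.1. Qed.

Let mparents' n : atomwise_measurable (parents' n).
Proof.
apply: (atomwise_measurable_map (F := fun k x => relabelled_parent (c x) k)) => k.
exact: atomwise_measurable_relabelled_parent.
Qed.

(** If some parent is not yet in the tree, the left side is 0. Otherwise the product of the [eppf]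
    over the nodes equals the left side and bounds the right side from below. *)
Let parents_atom_le n y : (P (parents n @^-1` [set y]) <= Q (parents' n @^-1` [set y]))%E.
Proof.
have [sy|sy] := eqVneq (size y) n; last first.
  rewrite (_ : parents n @^-1` _ = set0) ?measure0 ?measure_ge0//.
  apply/seteqP; split => // x /= /(congr1 size); rewrite size_map size_iota => e.
  by rewrite -e eqxx in sy.
(* The choices start at [k = 1]: entry [k.-1] of [y] is the parent chosen in the tree with [k]
   nodes. *)
pose u k := nth root y k.-1.
have atomE S (F : nat -> S -> node) :
    (fun x => [seq F k x | k <- iota 1 n]) @^-1` [set y] =
    [set x | forall k, (0 < k < n.+1)%N -> F k x = u k].
  apply/seteqP; split => x /=.
    move=> yE [//|k] /andP[_]; rewrite ltnS => kn.
    by rewrite /u -yE (nth_map 0%N) ?size_iota// nth_iota.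
  move=> H; apply: (@eq_from_nth _ root); rewrite size_map size_iota ?sy// => k kn.
  by rewrite (nth_map 0%N) ?size_iota// nth_iota// H.
rewrite [parents n @^-1` _]atomE pa_process_prob.
rewrite [parents' n @^-1` _](atomE _ (fun k x => relabelled_parent (c x) k)).
have [hist|nhist] := pselect (pa_history u n.+1); last first.
  suff -> : \prod_(1 <= k < n.+1) pa_prob chi rho (pa_tree u k) (u k) = 0 by exact: measure_ge0.
  move/existsNP : nhist => [k /not_implyP[kn uk]].
  rewrite (bigD1_seq k) ?iota_uniq ?mem_index_iota//= /pa_prob pa_treeE inE.
  by move/negP/negbTE: uk => ->; rewrite mul0r.
rewrite (pa_prob_eppf rho_gt0 chiDrho_gt0 hist).
apply: (history_event_ge indV condC hist) => [v|w v eps eps0].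
  have := @eppf_ge0 R _ (subtree_size (pa_nodes u n.+1)) alpha theta alpha_lt1 stick_parameters_ge0 0%N.
  by rewrite mul0r addr0; apply; exact: ltW.
apply: V_ge => //; first by rewrite filter_uniq// pa_nodes_uniq.
move=> v'; rewrite mem_filter => /andP[_ v's].
by rewrite /subtree_size -has_count; apply/hasP; exists v'; rewrite ?prefix_refl.
Qed.

Let same_law_parents n : same_law setT P (parents n) Q (parents' n).
Proof. by apply: same_law_of_le_atoms => // y; exact: parents_atom_le. Qed.

Let tree_of (y : seq node) n := pa_tree (fun k => nth root y k.-1) n.+1.

Let tree_ofE S (F : nat -> S -> node) n i x : (i <= n)%N ->
  pa_tree (fun k => F k x) i.+1 = tree_of [seq F k x | k <- iota 1 n] i.
Proof.
move=> iltn; apply: eq_pa_tree => -[//|k] /andP[_]; rewrite ltnS => ki.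
have kn : (k < n)%N by exact: leq_trans iltn.
by rewrite (nth_map 0%N) ?size_iota// nth_iota.
Qed.

Lemma relabelled_tree_same_law : same_law tree_seq_sigma
  P (fun x n => pa_tree (fun k => U k x) n.+1)
  Q (fun x n => relabelled_split_tree (c x) n.+1).
Proof.
apply: same_law_prod_sigma => [i|i|n E _].
- rewrite (_ : (fun x => _) = (fun x => tree_of (parents i x) i)).
    exact: (atomwise_measurable_comp (tree_of^~ i) (@mparents i)).
  by apply/funext => x; exact: tree_ofE.
- rewrite (_ : (fun x => _) = (fun x => tree_of (parents' i x) i)).
    exact: (atomwise_measurable_comp (tree_of^~ i) (@mparents' i)).
  apply/funext => x; rewrite relabelled_split_treeE.
  exact: (tree_ofE (fun k x => relabelled_parent (c x) k)).
have mkE S (F : nat -> S -> node) x : mkseq (tree_of [seq F k x | k <- iota 1 n]) n =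
    mkseq (fun i => pa_tree (fun k => F k x) i.+1) n.
  apply/eq_in_map => i; rewrite mem_iota => /= iltn.
  exact: esym (tree_ofE F x (ltnW iltn)).
have := @same_law_parents n [set y | E (mkseq (tree_of y) n)] I.
rewrite (_ : parents n @^-1` _ = (fun x => mkseq (fun i => pa_tree (fun k => U k x) i.+1) n) @^-1` E); last first.
  by apply/seteqP; split => x; rewrite /= (mkE _ U).
move=> ->; congr (Q _); apply/seteqP; split => x /=.
  rewrite (mkE _ (fun k x => relabelled_parent (c x) k)).
  by under [in X in _ -> X]eq_fun do rewrite relabelled_split_treeE.
rewrite (mkE _ (fun k x => relabelled_parent (c x) k)).
by under [in X in X -> _]eq_fun do rewrite relabelled_split_treeE.
Qed.

Lemma split_tree_same_unordered_law n : (0 < n)%N ->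
  same_unordered_law P (fun x => pa_tree (fun k => U k x) n)
                     Q (fun x => split_tree (c x) n).
Proof.
case: n => // n _ E Eiso.
have tE x := tree_ofE U x (leqnn n).
have tE' x : relabelled_split_tree (c x) n.+1 = tree_of (parents' n x) n.
  by rewrite relabelled_split_treeE; exact: (tree_ofE (fun k x => relabelled_parent (c x) k)).
have := @same_law_parents n [set y | E (tree_of y n)] I.
rewrite (_ : parents n @^-1` _ = (fun x => pa_tree (fun k => U k x) n.+1) @^-1` E); last first.
  by apply/funext => x; rewrite /preimage /mkset tE.
move=> ->; congr (Q _); apply/funext => x; rewrite /preimage /mkset -tE'.
by apply/propext; split => /(Eiso _ _ (tree_iso_relabelled (c x) n.+1)).
Qed.

End main.

Theorem theorem1p5 (R : realType) (chi rho : R)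
  (rho_gt0 : 0 < rho)
  (chi_rho : 0 <= chi \/
     (chi < 0 /\ exists2 m : nat, (0 < m)%N & rho / `|chi| = m%:R))
  (chiDrho_gt0 : 0 < chi + rho)
  (d : measure_display) (T : measurableType d) (P : probability T R)
  (U : nat -> T -> node) (PA : pa_process chi rho P U)
  (d' : measure_display) (T' : measurableType d') (Q : probability T' R)
  (V : node -> nat -> {RV Q >-> R}) (C : nat -> node -> {RV Q >-> nat}) :
  let alpha := chi / (chi + rho) in
  let theta := rho / (chi + rho) in
  let assertion1 := forall n : nat, (0 < n)%N ->
    same_unordered_law P (fun x => pa_tree (fun k => U k x) n)
                       Q (fun x => split_tree (fun k v => C k v x) n) in
  let assertion2 :=
    same_law tree_seq_sigma
      P (fun x n => pa_tree (fun k => U k x) n.+1)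
      Q (fun x n => relabelled_split_tree (fun k v => C k v x) n.+1) in
  [/\ split_process (is_GEM alpha theta (P := Q)) V C -> assertion1,
      split_process (is_GEM alpha theta (P := Q)) V C -> assertion2
    & split_process (is_PD alpha theta (P := Q)) V C -> assertion1 /\ assertion2].
Proof.
move=> alpha theta assertion1 assertion2.
have alpha_lt1 : alpha < 1 by rewrite ltr_pdivrMr// mul1r ltrDl.
have theta_gt0 : 0 < theta by exact: divr_gt0.
have thetaS := stick_parameters_ge0 rho_gt0 chiDrho_gt0 chi_rho.
(* The law of the split vector enters only through a lower bound on its expected injection sums,
   which GEM and PD share. *)
suff main (law : (nat -> {RV Q >-> R}) -> Prop) :
    (forall (X : nat -> {RV Q >-> R}) (N : node -> nat) (A : seq node) (eps : R), law X ->
       uniq A -> {in A, forall c, (0 < N c)%N} -> 0 < eps ->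
       exists L, ((eppf alpha theta N A - eps)%:E <=
         \int[Q]_x (clipped_injection_sum N (X^~ x) A L)%:E)%E) ->
    split_process law V C -> assertion1 /\ assertion2.
  have GEM := main (is_GEM alpha theta (P := Q)) (fun X N A eps lX uA N0 eps0 =>
    GEM_injection_sum_ge alpha_lt1 theta_gt0 thetaS uA N0 lX eps0).
  have PD := main (is_PD alpha theta (P := Q)) (fun X N A eps lX uA N0 eps0 =>
    PD_injection_sum_ge alpha_lt1 theta_gt0 thetaS uA N0 lX eps0).
  by split => [/GEM[]|/GEM[]|].
move=> law_ge [lawV indV condC].
have V_ge w N A eps := @law_ge (V w) N A eps (lawV w).
split => [n n0|]; first exact: (split_tree_same_unordered_law rho_gt0 chiDrho_gt0 chi_rho PA indV condC V_ge n0).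
exact: (relabelled_tree_same_law rho_gt0 chiDrho_gt0 chi_rho PA indV condC V_ge).
Qed.
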